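(* Let $-1<\alpha<+\infty$ and $\beta\in\mathcal J_\alpha$. Let $\nu$ be a finite positive Borel measure on $\mathbb D$. If $\nu$ is a Carleson measure on $\mathcal A^2_{\alpha,\beta}$, then $T_\nu$ is bounded on $\mathcal A^2_{\alpha,\beta}$; and if $T_\nu$ is bounded on $\mathcal A^2_{\alpha,\beta}$, then $\tilde\nu$ is a bounded function on $\mathbb D$.
   Context: $\mathbb D$ is the open unit disc in $\mathbb C$, $\mathbb D^*=\mathbb D\setminus\{0\}$, $dA$ is the area measure on $\mathbb D$ normalized so that $\mathbb D$ has measure $1$, and $\mathrm B(\cdot,\cdot)$ is the Euler beta function. For $\alpha>-1$ and $-1<\beta\le 0$, $$d\mu_{\alpha,\beta}(z)=\frac{1}{\mathrm B(\alpha+1,\beta+1)}|z|^{2\beta}(1-|z|^2)^\alpha\,dA(z),$$ and $\mathcal A^p_{\alpha,\beta}$ is the space of holomorphic functions $f$ on $\mathbb D^*$ with $\|f\|_{\alpha,\beta,p}=\left(\int_{\mathbb D}|f|^p\,d\mu_{\alpha,\beta}\right)^{1/p}<+\infty$. The Bergman (reproducing) kernel of $\mathcal A^2_{\alpha,\beta}$ is $$\mathbb K_{\alpha,\beta}(w,z)=\frac{Q_{\alpha,\beta}(w\overline z)}{(1-w\overline z)^{2+\alpha}},\qquad Q_{\alpha,\beta}(\xi)=\sum_{n=0}^{+\infty}\frac{\beta(-\xi)^n}{n+\beta}\binom{\alpha+1}{n}$$ ($Q_{\alpha,0}\equiv1$). $\mathcal J_\alpha$ is the set of $\beta\in(-1,0]$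 such that $Q_{\alpha,\beta}$ has no zero in $\mathbb D$. A finite positive Borel measure $\nu$ on $\mathbb D$ is a Carleson measure on $\mathcal A^p_{\alpha,\beta}$ ($p\ge1$) if there is a finite constant $C>0$ with $\int_{\mathbb D}|f|^p\,d\nu\le C\int_{\mathbb D}|f|^p\,d\mu_{\alpha,\beta}$ for all $f\in\mathcal A^p_{\alpha,\beta}$. The Toeplitz operator with symbol $\nu$ is $T_\nu f(z)=\int_{\mathbb D}f(w)\,\overline{\mathbb K_{\alpha,\beta}(w,z)}\,d\nu(w)$. The normalized kernel is $k^z_{\alpha,\beta,2}(w)=\mathbb K_{\alpha,\beta}(w,z)/\|\mathbb K_{\alpha,\beta}(\cdot,z)\|_{\alpha,\beta,2}$, and the Berezin symbol of $\nu$ is $$\tilde\nu(z)=\langle T_\nu k^z_{\alpha,\beta,2},k^z_{\alpha,\beta,2}\rangle_{\alpha,\beta}=\int_{\mathbb D}|k^z_{\alpha,\beta,2}(w)|^2\,d\nu(w),$$ where $\langle f,g\rangle_{\alpha,\beta}=\int_{\mathbb D}f\overline g\,d\mu_{\alpha,\beta}$. *)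

(* Defs.v *)
From HB Require Import structures.
From mathcomp Require Import all_boot all_order all_algebra.
From mathcomp Require Import all_classical all_reals all_analysis.
From mathcomp Require Import complex.

Set Implicit Arguments.
Unset Strict Implicit.
Unset Printing Implicit Defensive.

Import Order.TTheory GRing.Theory Num.Theory.
Import numFieldNormedType.Exports.

Local Open Scope classical_set_scope.
Local Open Scope ring_scope.
Local Open Scope complex_scope.

Local Notation Re := complex.Re.
Local Notation Im := complex.Im.
Local Notation normc := Normc.normc.

(* Usual topology of R[i], as a normed space over itself: [derivable f z 1]    *)
(* is then complex differentiability at z.                                     *)
Set Warnings "-redundant-canonical-projection".
HB.instance Definition _ (R : realType) := NormedModule.copy R[i] (R[i])^o.
Set Warnings "redundant-canonical-projection".

Section complex_preliminaries.
Context {R : realType}.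
Implicit Types (z : R[i]) (f : R[i] -> R[i]).

(* Principal argument, in ]-pi, pi] for z != 0. *)
Definition carg z : R :=
  if 0 <= Im z then acos (Re z / normc z) else - acos (Re z / normc z).

(* Principal value of z ^ a for z != 0. *)
Definition cpow z (a : R) : R[i] :=
  (normc z `^ a)%:C * (cos (a * carg z) +i* sin (a * carg z)).

Definition disc : set R[i] := [set z | normc z < 1].

Definition holomorphic_on (U : set R[i]) f : Prop :=
  forall z, U z -> derivable f z 1.

(* A function on the punctured disc is encoded by a total function whose value *)
(* at 0 is irrelevant; [ext0 f] takes the limit of f as its value at 0. When   *)
(* -1 < beta <= 0, the singularity at 0 of an element of the weighted Bergman  *)
(* space A^2 is removable, so this limit exists.                               *)
Definition ext0 f z : R[i] := if z == 0 then lim (f w @[w --> 0^']) else f z.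

End complex_preliminaries.

(* C as a measurable space is R * R, whose product sigma-algebra is the Borel  *)
(* one; [toC] is the identification.                                           *)
Notation plane R := (measurableTypeR R * measurableTypeR R)%type.

Section integration.
Context {R : realType}.

Definition toC (p : plane R) : R[i] := (p.1 : R) +i* (p.2 : R).

Definition pdisc : set (plane R) := toC @^-1` disc.

Definition lebesgue2 : {measure set (plane R) -> \bar R} :=
  (@lebesgue_measure R \x @lebesgue_measure R)%E.

Definition cintegral (nu : {measure set (plane R) -> \bar R})
    (D : set (plane R)) (g : R[i] -> R[i]) : R[i] :=
  (\int[nu]_(p in D) Re (g (toC p))) +i* (\int[nu]_(p in D) Im (g (toC p))).

Definition cintegrable (nu : {measure set (plane R) -> \bar R})
    (D : set (plane R)) (g : R[i] -> R[i]) : Prop :=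
  nu.-integrable D (fun p => (Re (g (toC p)))%:E) /\
  nu.-integrable D (fun p => (Im (g (toC p)))%:E).

End integration.

Section special_functions.
Context {R : realType}.
Implicit Types (a b x y : R).

(* Euler's beta function at real arguments. *)
Definition Beta x y : R :=
  \int[lebesgue_measure]_(t in `]0, 1[) (t `^ (x - 1) * (1 - t) `^ (y - 1)).

(* Binomial coefficient with real upper argument. *)
Definition gbinom a (n : nat) : R := (\prod_(i < n) (a - i%:R)) / n`!%:R.

End special_functions.

Section bergman.
Context {R : realType}.
Variables (alpha beta : R).
Implicit Types (f : R[i] -> R[i]) (z w xi : R[i]).
Implicit Type nu : {measure set (plane R) -> \bar R}.

(* Density of mu_{alpha, beta} with respect to Lebesgue measure on R * R; the  *)
(* factor pi^-1 normalizes the area of the disc to 1.                          *)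
Definition weight z : R :=
  (Beta (alpha + 1) (beta + 1))^-1 *
  (normc z `^ (2 * beta) * (1 - normc z ^+ 2) `^ alpha) * pi^-1.

(* Integral of |f|^2 with respect to mu_{alpha, beta}. *)
Definition sqnorm f : \bar R :=
  (\int[lebesgue2]_(p in pdisc)
     (normc (f (toC p)) ^+ 2 * weight (toC p))%:E)%E.

Definition bnorm f : \bar R := (sqnorm f `^ 2^-1)%E.

Definition bergman : set (R[i] -> R[i]) :=
  [set f | holomorphic_on (disc `\ 0) f /\ (bnorm f < +oo)%E].

(* For beta = 0 the general coefficient would read 0 / 0 at n = 0. *)
Definition Qcoef (n : nat) : R :=
  if beta == 0 then (n == 0%N)%:R
  else beta / (n%:R + beta) * gbinom (alpha + 1) n.

Definition Q xi : R[i] :=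
  limn (series (fun n => (Qcoef n)%:C * (- xi) ^+ n)).

Definition bergman_kernel w z : R[i] :=
  Q (w * conjc z) / cpow (1 - w * conjc z) (2 + alpha).

Definition nkernel z w : R[i] :=
  bergman_kernel w z / (fine (bnorm (bergman_kernel ^~ z)))%:C.

Definition carleson nu : Prop :=
  exists2 C : R, 0 < C &
    forall f, bergman f ->
      (\int[nu]_(p in pdisc) (normc (ext0 f (toC p)) ^+ 2)%:E
         <= C%:E * sqnorm f)%E.

Definition toeplitz_integrand f z w : R[i] := ext0 f w * conjc (bergman_kernel w z).

Definition toeplitz nu f z : R[i] := cintegral nu pdisc (toeplitz_integrand f z).

(* T_nu f is defined by an absolutely convergent integral for every f in the   *)
(* Bergman space, and T_nu is a bounded operator of that space into itself.    *)
Definition toeplitz_bounded nu : Prop :=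
  (forall f z, bergman f -> disc z ->
     cintegrable nu pdisc (toeplitz_integrand f z)) /\
  exists C : R, forall f, bergman f ->
    bergman (toeplitz nu f) /\ (bnorm (toeplitz nu f) <= C%:E * bnorm f)%E.

(* <T_nu k, k> for k the normalized kernel at z, in the form int |k|^2 dnu,     *)
(* which makes sense whether or not T_nu is bounded.                           *)
Definition berezin nu z : \bar R :=
  (\int[nu]_(p in pdisc) (normc (nkernel z (toC p)) ^+ 2)%:E)%E.

End bergman.

Definition Jset {R : realType} (alpha : R) : set R :=
  [set beta | -1 < beta <= 0 /\ forall xi, disc xi -> Q alpha beta xi != 0].

(* Main.v *)
Require Import Defs.
From HB Require Import structures.
From mathcomp Require Import all_boot all_order all_algebra.
From mathcomp Require Import all_classical all_reals all_analysis.
From mathcomp Require Import measurable_realfun complex ring lra.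

Set Implicit Arguments.
Unset Strict Implicit.
Unset Printing Implicit Defensive.

Import Order.TTheory GRing.Theory Num.Theory.
Import numFieldNormedType.Exports.

Local Open Scope classical_set_scope.
Local Open Scope ring_scope.
Local Open Scope complex_scope.

Local Notation Re := complex.Re.
Local Notation Im := complex.Im.
Local Notation normc := Normc.normc.

(** Expand the kernel as K(w, z) = sum_n c_n (w conj z)^n. The coefficients are
    c_n = (alpha + beta + 2)_n / (beta + 1)_n > 0, by Euler's transformation of the
    hypergeometric series ([bergman_kernel_pser]); here this identity comes from
    comparing first-order differential equations along rays from the origin.

    The monomials are orthogonal, with |z^n|^2 = kappa / c_n for a constant
    kappa > 0. The norms come from a recurrence for beta integrals
    ([betaI_recurrence], [monomial_norm]). Orthogonality is used in the following
    form: a rotation preserves the measure, and the average of |f|^2 over the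
    rotations by the N-th roots of unity is a sum over the diagonal, exactly for a
    polynomial of degree less than N and asymptotically for a power series. This
    gives the norm of a polynomial ([sqnorm_psum]) and Bessel's inequality
    ([bessel]).

    If f is square integrable for nu, then T_nu f is the power series with
    coefficients c_n m_n, where m_n is the integral of f(w) conj(w)^n against nu
    ([toeplitz_expansion]). Let G be a partial sum of this series and S the
    corresponding partial sum of c_n |m_n|^2. On the one hand |G|^2 = kappa S; on the
    other hand S is the integral of f conj(G) against nu. If nu is a Carleson
    measure with constant C, the inequality of arithmetic and geometric means thus
    bounds S by (l C |f|^2 + C kappa S / l) / 2, and l = C kappa gives
    |G| <= C kappa |f|. Fatou's lemma passes to the limit
    ([carleson_toeplitz_bounded]).

    Conversely, let T_nu have norm at most C and let k be the kernel function at z.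
    The integral of |k|^2 against nu is (T_nu k)(z), which is at most
    |T_nu k| |k| / kappa <= C |k|^2 / kappa by [point_evaluation]; dividing by |k|^2
    bounds the Berezin symbol by C / kappa ([toeplitz_bounded_berezin]). *)

(** * Complex numbers and complex series *)

Section complex_norm.
Context {R : realType}.
Implicit Types z w : R[i].

Lemma normcE z : `|z| = (normc z)%:C.
Proof. by case: z. Qed.

Lemma normc_ge0 z : 0 <= normc z.
Proof. by case: z => a b; rewrite sqrtr_ge0. Qed.

Lemma normcD z w : normc (z + w) <= normc z + normc w.
Proof. exact: le_normcD. Qed.

Lemma normcN z : normc (- z) = normc z.
Proof. exact: (@normcN R z). Qed.

Lemma normcB z w : normc (z - w) <= normc z + normc w.
Proof. by rewrite (le_trans (normcD _ _))// normcN. Qed.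

Lemma normcX z n : normc (z ^+ n) = normc z ^+ n.
Proof.
by elim: n => [|n IH]; rewrite ?expr0 ?Normc.normc1// !exprS Normc.normcM IH.
Qed.

Lemma normc_real (x : R) : normc x%:C = `|x|.
Proof. by rewrite /Normc.normc/= expr0n addr0 sqrtr_sqr. Qed.

Lemma normc_conj z : normc (conjc z) = normc z.
Proof. by case: z => a b; rewrite /= sqrrN. Qed.

Lemma sqr_normc z : normc z ^+ 2 = Re z ^+ 2 + Im z ^+ 2.
Proof. by case: z => a b; rewrite sqr_sqrtr// addr_ge0// sqr_ge0. Qed.

Lemma Re_le_normc z : `|Re z| <= normc z.
Proof.
rewrite -(ler_pXn2r (ltn0Sn 1)) ?nnegrE ?normc_ge0// sqr_normc real_normK ?num_real//.
by rewrite lerDl sqr_ge0.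
Qed.

Lemma Im_le_normc z : `|Im z| <= normc z.
Proof.
rewrite -(ler_pXn2r (ltn0Sn 1)) ?nnegrE ?normc_ge0// sqr_normc real_normK ?num_real//.
by rewrite lerDr sqr_ge0.
Qed.

Lemma normc_le_ReIm z : normc z <= `|Re z| + `|Im z|.
Proof.
rewrite -(ler_pXn2r (ltn0Sn 1)) ?nnegrE ?normc_ge0 ?addr_ge0//.
rewrite sqr_normc sqrrD -!(@real_normK _ (Re z)) ?num_real//.
rewrite -(@real_normK _ (Im z)) ?num_real// lerD2r lerDl.
by rewrite mulrn_wge0 ?mulr_ge0.
Qed.

Lemma normc_eq0 z : (normc z == 0) = (z == 0).
Proof.
by apply/eqP/eqP => [|->]; [exact: Normc.eq0_normc|rewrite Normc.normc0].
Qed.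

Lemma mulr_conjc z : z * conjc z = (normc z ^+ 2)%:C.
Proof. by rewrite sqr_normc; case: z => a b; simpc; congr (_ +i* _); ring. Qed.

Lemma ReM z w : Re (z * w) = Re z * Re w - Im z * Im w.
Proof. by case: z; case: w. Qed.

Lemma ImM z w : Im (z * w) = Re z * Im w + Im z * Re w.
Proof. by case: z; case: w => *. Qed.

Lemma ReD z w : Re (z + w) = Re z + Re w.
Proof. by case: z; case: w. Qed.

Lemma ImD z w : Im (z + w) = Im z + Im w.
Proof. by case: z; case: w. Qed.

Lemma ReB z w : Re (z - w) = Re z - Re w.
Proof. by case: z; case: w. Qed.

Lemma ImB z w : Im (z - w) = Im z - Im w.
Proof. by case: z; case: w. Qed.

Lemma ReZ (x : R) z : Re (x%:C * z) = x * Re z.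
Proof. by rewrite ReM mul0r subr0. Qed.

Lemma ImZ (x : R) z : Im (x%:C * z) = x * Im z.
Proof. by rewrite ImM mul0r addr0. Qed.

Lemma Re_sum (I : Type) (r : seq I) (P : pred I) (F : I -> R[i]) :
  Re (\sum_(i <- r | P i) F i) = \sum_(i <- r | P i) Re (F i).
Proof. by elim/big_rec2: _ => // i y x _ <-; case: x; case: (F i). Qed.

Lemma Im_sum (I : Type) (r : seq I) (P : pred I) (F : I -> R[i]) :
  Im (\sum_(i <- r | P i) F i) = \sum_(i <- r | P i) Im (F i).
Proof. by elim/big_rec2: _ => // i y x _ <-; case: x; case: (F i). Qed.

Lemma normc_sum (I : Type) (r : seq I) (P : pred I) (F : I -> R[i]) :
  normc (\sum_(i <- r | P i) F i) <= \sum_(i <- r | P i) normc (F i).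
Proof.
elim/big_rec2: _ => [|i y x _ xy]; first by rewrite Normc.normc0.
by rewrite (le_trans (normcD _ _))// lerD2l.
Qed.

(** A positive element of the ordered field of complex numbers is a positive
    real, so that neighbourhoods have real radii. *)
Lemma posc_real (e : R[i]) : 0 < e -> exists2 d : R, 0 < d & e = d%:C.
Proof.
case: e => a b; rewrite ltcE/= => /andP[/eqP-> a0]; by exists a.
Qed.

End complex_norm.

Section complex_limits.
Context {R : realType} {T : Type} {F : set_system T} {FF : Filter F}.
Implicit Types u : T -> R[i].

Lemma cvgcP u (l : R[i]) :
  u @ F --> l <-> (forall e : R, 0 < e -> \forall x \near F, normc (u x - l) < e).
Proof.
split=> [/cvgrPdist_lt ul e e0|ul].
  have := ul e%:C; rewrite ltcR => /(_ e0).
  by apply: filterS => x; rewrite normcE ltcR -normcN opprB.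
apply/cvgrPdist_lt => e /posc_real[d d0 ->].
by apply: filterS (ul d d0) => x; rewrite normcE ltcR -normcN opprB.
Qed.

Lemma cvg_ReIm u (l : R[i]) :
  u @ F --> l <->
  Re (u x) @[x --> F] --> Re l /\ Im (u x) @[x --> F] --> Im l.
Proof.
split=> [/cvgcP ul|[/cvgrPdist_lt rl /cvgrPdist_lt il]].
  by split; apply/cvgrPdist_lt => e /ul; apply: filterS => x;
    apply: le_lt_trans; rewrite distrC -?ReB -?ImB ?Re_le_normc ?Im_le_normc.
apply/cvgcP => e e0; have e2 : 0 < e / 2 by lra.
near=> x; rewrite (le_lt_trans (normc_le_ReIm _))// (splitr e) ReB ImB.
by rewrite ltrD// distrC; near: x; [exact: rl|exact: il].
Unshelve. all: by end_near. Qed.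

End complex_limits.

Section complex_series.
Context {R : realType}.
Implicit Types (u v : nat -> R[i]) (z : R[i]).

Definition summable u := cvgn (series (fun n => normc (u n))).

Definition csum u : R[i] := limn (series u).

Lemma Re_series u : (fun n => Re (series u n)) = series (fun n => Re (u n)).
Proof. by apply/funext => n; rewrite /series/= Re_sum. Qed.

Lemma Im_series u : (fun n => Im (series u n)) = series (fun n => Im (u n)).
Proof. by apply/funext => n; rewrite /series/= Im_sum. Qed.

Lemma summable_le u (b : nat -> R) :
  (forall n, normc (u n) <= b n) -> cvgn (series b) -> summable u.
Proof.
move=> ub; apply: series_le_cvg => // n; first exact: normc_ge0.
exact: le_trans (normc_ge0 _) (ub n).
Qed.

Lemma summable_Re u : summable u -> cvgn (series (fun n => Re (u n))).
Proof.
move=> su; apply: normed_cvg; apply: series_le_cvg su => n; rewrite /=.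
- exact: normr_ge0.
- exact: normc_ge0.
- exact: Re_le_normc.
Qed.

Lemma summable_Im u : summable u -> cvgn (series (fun n => Im (u n))).
Proof.
move=> su; apply: normed_cvg; apply: series_le_cvg su => n; rewrite /=.
- exact: normr_ge0.
- exact: normc_ge0.
- exact: Im_le_normc.
Qed.

Lemma csum_eq u l : series u @ \oo --> l -> csum u = l.
Proof. by apply: cvg_lim; exact: norm_hausdorff. Qed.

Lemma cvg_csum u : summable u -> series u @ \oo --> csum u.
Proof.
move=> su; have [l ul] : exists l : R[i], series u @ \oo --> l.
  exists (limn (series (fun n => Re (u n))) +i* limn (series (fun n => Im (u n)))).
  apply/cvg_ReIm; rewrite Re_series Im_series; split => /=.
    exact: summable_Re.
  exact: summable_Im.
by rewrite (csum_eq ul).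
Qed.

Lemma summableD u v : summable u -> summable v -> summable (u \+ v).
Proof.
move=> su sv; apply: (@summable_le _ ((fun n => normc (u n)) \+ (fun n => normc (v n)))).
  by move=> n; exact: normcD.
exact: is_cvg_seriesD.
Qed.

Lemma summableZ z u : summable u -> summable (fun n => z * u n).
Proof.
move=> su; apply: (@summable_le _ (fun n => normc z *: normc (u n))).
  by move=> n; rewrite Normc.normcM.
exact: is_cvg_seriesZ.
Qed.

Lemma csumD u v : summable u -> summable v -> csum (u \+ v) = csum u + csum v.
Proof.
move=> su sv; apply: csum_eq; rewrite seriesD.
by apply: cvgD; exact: cvg_csum.
Qed.

Lemma csumZ z u : summable u -> csum (fun n => z * u n) = z * csum u.
Proof.
move=> su; apply: csum_eq; rewrite (_ : series _ = fun n => z * series u n).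
  by apply: cvgMl_tmp; exact: cvg_csum.
by apply/funext => n; rewrite /series/= mulr_sumr.
Qed.

Lemma csumB u v : summable u -> summable v ->
  csum (fun n => u n - v n) = csum u - csum v.
Proof.
move=> su sv; rewrite -[- csum v]mulN1r -csumZ// -csumD//; last exact: summableZ.
by congr csum; apply/funext => n /=; rewrite mulN1r.
Qed.

Lemma normc_csum u : summable u ->
  normc (csum u) <= limn (series (fun n => normc (u n))).
Proof.
move=> su; apply/ler_addgt0Pr => e e0.
have /cvgcP/(_ e e0)[N _ HN] := cvg_csum su.
have := HN N (leqnn N) => /= /ltW uN.
rewrite -(subrK (series u N) (csum u)) (le_trans (normcD _ _))// addrC.
rewrite lerD//; last by rewrite -normcN opprB.
rewrite (le_trans (normc_sum _ _ _))//.
apply: nondecreasing_cvgn_le => //.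
by apply/nondecreasing_seqP => n; rewrite seriesSr/= lerDl normc_ge0.
Qed.

Lemma summable_shift u : summable u -> summable (fun n => u n.+1).
Proof.
move=> su; rewrite /summable.
rewrite (_ : series _ = fun n => series (fun k => normc (u k)) n.+1 - normc (u 0%N)).
  apply: is_cvgB; last exact: is_cvg_cst.
  by apply/cvg_ex; exists (limn (series (fun k => normc (u k)))); rewrite (cvg_shiftS (series _)).
apply/funext => n; by rewrite /series/= [X in _ = X - _]big_nat_recl//= addrAC subrr add0r.
Qed.

Lemma csum_shift u : summable u -> csum u = u 0%N + csum (fun n => u n.+1).
Proof.
move=> su; apply: csum_eq; rewrite -cvg_shiftS.
rewrite (_ : (fun n => _) = fun n => u 0%N + series (fun n => u n.+1) n).
  by apply: cvgD; [exact: cvg_cst|exact/cvg_csum/summable_shift].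
by apply/funext => n; rewrite /series/= big_nat_recl.
Qed.

End complex_series.

(** * Power series in the unit disc *)

Section power_series.
Context {R : realType}.
Implicit Types (a b : nat -> R[i]) (z h : R[i]) (r : R).

(** Radius of convergence at least one, in the form that is easiest to
    transfer from one coefficient sequence to another. *)
Definition subexp a :=
  forall r, 0 <= r < 1 -> exists M, forall n, normc (a n) * r ^+ n <= M.

Definition pser a z := csum (fun n => a n * z ^+ n).

Definition dcoef a : nat -> R[i] := fun n => n.+1%:R%:C * a n.+1.

Lemma subexp_dominated a b (K : R) :
  (forall n, normc (b n) <= K * normc (a n)) -> subexp a -> subexp b.
Proof.
move=> ba sa r r01; have [M HM] := sa r r01.
have r0 : 0 <= r by case/andP: r01.
exists (`|K| * M) => n; rewrite (le_trans (ler_wpM2r _ (ba n)))// ?exprn_ge0//.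
rewrite -mulrA (le_trans (ler_norm _))// normrM ler_wpM2l//.
by rewrite ger0_norm// mulr_ge0 ?exprn_ge0 ?normc_ge0.
Qed.

(** The ratio test. *)
Lemma subexp_ratio a :
  (forall r, 0 < r < 1 -> exists N, forall n, (N <= n)%N ->
     normc (a n.+1) * r <= normc (a n)) -> subexp a.
Proof.
move=> H r /andP[]; rewrite le_eqVlt => /predU1P[<- _|r0 r1].
  exists (normc (a 0%N)) => -[|n]; first by rewrite expr0 mulr1.
  by rewrite expr0n mulr0 normc_ge0.
have [|N HN] := H r; first by rewrite r0.
exists (\sum_(n < N.+1) normc (a n) * r ^+ n) => n.
have t0 m : 0 <= normc (a m) * r ^+ m by rewrite mulr_ge0 ?normc_ge0 ?exprn_ge0 ?ltW.
have small m : (m <= N)%N ->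
    normc (a m) * r ^+ m <= \sum_(n < N.+1) normc (a n) * r ^+ n.
  by move=> mN; rewrite (bigD1 (Ordinal (mN : (m < N.+1)%N)))//= lerDl sumr_ge0.
have [nN|/ltnW Nn] := leqP n N; first exact: small.
rewrite -(subnK Nn); elim: (n - N)%N => [|k IH]; first exact: small.
rewrite addSn (le_trans _ IH)// exprS mulrA ler_wpM2r ?exprn_ge0 ?(ltW r0)//.
by rewrite HN// leq_addl.
Qed.

Lemma half_way r : 0 <= r < 1 -> exists2 s, r < s & 0 < s < 1.
Proof. by move=> /andP[r0 r1]; exists ((1 + r) / 2); lra. Qed.

Lemma subexp_series a r : subexp a -> 0 <= r < 1 ->
  cvgn (series (fun n => normc (a n) * r ^+ n)).
Proof.
move=> sa r01; have [s rs /andP[s0 s1]] := half_way r01.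
have /andP[r0 r1] := r01.
have [|M HM] := sa s; first by rewrite s1 ltW.
have M0 : 0 <= M by rewrite (le_trans _ (HM 0%N))// expr0 mulr1 normc_ge0.
have q1 : `|r / s| < 1 by rewrite ger0_norm ?divr_ge0 ?(ltW s0)// ltr_pdivrMr// mul1r.
apply: (series_le_cvg _ _ _ (is_cvg_geometric_series (a := M) q1)) => n /=.
- by rewrite mulr_ge0 ?normc_ge0 ?exprn_ge0.
- by rewrite mulr_ge0 ?exprn_ge0// divr_ge0// ltW.
- rewrite (_ : _ * r ^+ n = normc (a n) * s ^+ n * (r / s) ^+ n).
    by rewrite ler_wpM2r// exprn_ge0// divr_ge0// ltW.
  by rewrite -mulrA -exprMn mulrC (mulrC r) mulVKf ?gt_eqF// mulrC.
Qed.

Lemma summable_pser a z : subexp a -> normc z < 1 ->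
  summable (fun n => a n * z ^+ n).
Proof.
move=> sa z1; apply: summable_le (subexp_series sa (r := normc z) _).
  by move=> n; rewrite Normc.normcM normcX.
by rewrite normc_ge0.
Qed.

(** The factor n that differentiation puts in front of the coefficients is
    absorbed by an arbitrarily small increase of the radius. *)
Lemma mul_geometric_bounded (q : R) n : 0 <= q <= 1 ->
  n.+1%:R * q ^+ n * (1 - q) <= 1 - q ^+ n.+1.
Proof.
move=> /andP[q0 q1]; elim: n => [|n IH]; first by rewrite expr0 expr1; lra.
have p0 : 0 <= q ^+ n.+1 <= 1 by rewrite exprn_ge0// exprn_ile1.
have : q * (n.+1%:R * q ^+ n * (1 - q)) <= q * (1 - q ^+ n.+1) by rewrite ler_wpM2l.
have -> : q * (n.+1%:R * q ^+ n * (1 - q)) = n.+1%:R * q ^+ n.+1 * (1 - q).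
  by rewrite exprS; ring.
rewrite -natr1 (exprS q n.+1); move: (q ^+ n.+1) p0 (n.+1%:R : R) => p /andP[p0 p1] k H.
have : 0 <= (1 - q) * (1 - p) by rewrite mulr_ge0// subr_ge0.
by nra.
Qed.

Lemma subexp_dcoef a : subexp a -> subexp (dcoef a).
Proof.
move=> sa r r01; have [s rs /andP[s0 s1]] := half_way r01.
have /andP[r0 r1] := r01.
have [|M HM] := sa s; first by rewrite s1 ltW.
have M0 : 0 <= M by rewrite (le_trans _ (HM 0%N))// expr0 mulr1 normc_ge0.
have q1 : r / s < 1 by rewrite ltr_pdivrMr// mul1r.
have q0 : 0 <= r / s by rewrite divr_ge0// ltW.
exists (M / s * (1 - r / s)^-1) => n.
have -> : normc (dcoef a n) * r ^+ n =
    normc (a n.+1) * s ^+ n.+1 / s * (n.+1%:R * (r / s) ^+ n).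
  rewrite Normc.normcM normc_real ger0_norm// exprS expr_div_n.
  by field; rewrite ?expf_neq0 gt_eqF.
apply: ler_pM.
- by rewrite mulr_ge0 ?invr_ge0 ?(ltW s0)// mulr_ge0 ?normc_ge0 ?exprn_ge0 ?(ltW s0).
- by rewrite mulr_ge0 ?exprn_ge0.
- by rewrite ler_wpM2r ?invr_ge0 ?(ltW s0).
- rewrite -[leRHS]mul1r ler_pdivlMr ?subr_gt0//.
  rewrite (le_trans (mul_geometric_bounded _ _)) ?q0 ?(ltW q1)//.
  by rewrite gerBl exprn_ge0.
Qed.

(** By induction on the exponent: multiplying a remainder by z + h only adds a
    multiple of h^2. *)
Lemma power_taylor z h r n : normc z <= r -> normc (z + h) <= r ->
  normc ((z + h) ^+ n.+2 - z ^+ n.+2 - n.+2%:R%:C * (h * z ^+ n.+1))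
  <= normc h ^+ 2 * (n.+1%:R * n.+2%:R * r ^+ n).
Proof.
move=> zr zhr; have r0 : 0 <= r := le_trans (normc_ge0 _) zr.
elim: n => [|n IH].
  rewrite (_ : _ - _ = h ^+ 2); last by rewrite rmorph_nat; ring.
  by rewrite normcX expr0 mulr1 mul1r ler_peMr ?exprn_ge0 ?normc_ge0// ler1n.
rewrite (_ : _ - _ = (z + h) *
    ((z + h) ^+ n.+2 - z ^+ n.+2 - n.+2%:R%:C * (h * z ^+ n.+1))
    + n.+2%:R%:C * (h ^+ 2 * z ^+ n.+1)); last first.
  by rewrite !rmorph_nat !(exprS _ n.+2) !(exprS _ n.+1) -(natr1 n.+2); ring.
rewrite (le_trans (normcD _ _))// !Normc.normcM !normcX normc_real ger0_norm//.
have H1 : normc (z + h) * normc ((z + h) ^+ n.+2 - z ^+ n.+2 - n.+2%:R%:C * (h * z ^+ n.+1))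
   <= r * (normc h ^+ 2 * (n.+1%:R * n.+2%:R * r ^+ n)).
  by apply: ler_pM => //; rewrite normc_ge0.
have H2 : n.+2%:R * (normc h ^+ 2 * normc z ^+ n.+1)
    <= n.+2%:R * (normc h ^+ 2 * r ^+ n.+1).
  by rewrite !ler_wpM2l ?exprn_ge0 ?normc_ge0// lerXn2r ?nnegrE ?normc_ge0.
rewrite (le_trans (lerD H1 H2))// (exprS r n) -(natr1 n.+2) -(natr1 n.+1).
have p0 : 0 <= normc h ^+ 2 * (r * r ^+ n) by rewrite !mulr_ge0 ?exprn_ge0 ?normc_ge0.
rewrite -subr_ge0.
rewrite [leRHS](_ : _ = normc h ^+ 2 * (r * r ^+ n) * (n.+1%:R + 1)); last by ring.
by rewrite mulr_ge0// addr_ge0.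
Qed.

(** A quadratic remainder, obtained term by term; it gives at once the complex
    derivative and the real derivative along a ray. *)
Lemma pser_taylor a z h r : subexp a -> r < 1 ->
  normc z <= r -> normc (z + h) <= r ->
  normc (pser a (z + h) - pser a z - h * pser (dcoef a) z) <=
    normc h ^+ 2 *
    limn (series (fun n => normc (dcoef (dcoef a) n) * r ^+ n)).
Proof.
move=> sa r1 zr zhr; have r0 : 0 <= r := le_trans (normc_ge0 _) zr.
have z1 : normc z < 1 := le_lt_trans zr r1.
have zh1 : normc (z + h) < 1 := le_lt_trans zhr r1.
have s1 := summable_pser sa z1; have s2 := summable_pser sa zh1.
have s3 := summable_pser (subexp_dcoef sa) z1.
rewrite /pser (csum_shift s1) (csum_shift s2) (csum_shift s3).
have s1' := summable_shift s1; have s2' := summable_shift s2.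
have s3' := summable_shift s3.
rewrite (csum_shift s1') (csum_shift s2').
have s1'' := summable_shift s1'; have s2'' := summable_shift s2'.
set A := csum _; set B := csum _; set D := csum _.
have -> : a 0%N * (z + h) ^+ 0 + (a 1%N * (z + h) ^+ 1 + A)
    - (a 0%N * z ^+ 0 + (a 1%N * z ^+ 1 + B)) - h * (dcoef a 0 * z ^+ 0 + D)
    = A - B - h * D.
  by rewrite /dcoef rmorph_nat !expr0 !expr1; ring.
have s4 := summableZ (z := h) s3'.
have s5 : summable (fun n => a n.+2 * (z + h) ^+ n.+2 - a n.+2 * z ^+ n.+2).
  rewrite (_ : (fun _ => _) = (fun n => a n.+2 * (z + h) ^+ n.+2)
       \+ (fun n => -1 * (a n.+2 * z ^+ n.+2))).
    by apply: summableD => //; exact: (summableZ (z := -1)).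
  by apply/funext => n /=; rewrite mulN1r.
rewrite /A /B /D -csumB// -csumZ// -csumB//.
have sr : cvgn (series (fun n => normc (dcoef (dcoef a) n) * r ^+ n)).
  by apply: subexp_series; [exact/subexp_dcoef/subexp_dcoef|rewrite r0].
have le n : normc (a n.+2 * (z + h) ^+ n.+2 - a n.+2 * z ^+ n.+2
     - h * (dcoef a n.+1 * z ^+ n.+1))
   <= normc h ^+ 2 * (normc (dcoef (dcoef a) n) * r ^+ n).
  rewrite (_ : _ - _ = a n.+2 *
     ((z + h) ^+ n.+2 - z ^+ n.+2 - n.+2%:R%:C * (h * z ^+ n.+1))).
    rewrite Normc.normcM (le_trans (ler_wpM2l (normc_ge0 _) (power_taylor n zr zhr)))//.
    rewrite /dcoef !Normc.normcM !normc_real !ger0_norm// le_eqVlt; apply/orP; left.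
    by apply/eqP; ring.
  by rewrite /dcoef; ring.
have sv : cvgn (series (fun n => normc h ^+ 2 * (normc (dcoef (dcoef a) n) * r ^+ n))).
  exact: is_cvg_seriesZ.
rewrite (le_trans (normc_csum (summable_le le sv)))//.
apply: (@le_trans _ _ (limn (series
    (normc h ^+ 2 *: (fun n => normc (dcoef (dcoef a) n) * r ^+ n)))));
  last by rewrite lim_seriesZ.
by apply: lim_series_le => //; exact: summable_le le sv.
Qed.

End power_series.

(** * Differentiation of power series *)

Section quadratic_remainder.
Context {K : numFieldType}.

(** Over an arbitrary numeric field, so as to serve both the real and the
    complex derivative. *)
Lemma is_derive_quadratic (f : K -> K) (z d k e : K) : 0 < e ->
  (forall h, `|h| < e -> `|f (z + h) - f z - h * d| <= k * `|h| ^+ 2) ->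
  is_derive z 1 f d.
Proof.
move=> e0 H; have k0 : 0 <= k.
  have /H : `|e / 2| < e.
    by rewrite gtr0_norm ?divr_gt0// ltr_pdivrMr// ltr_pMr// ltr1n.
  move=> /(le_trans (normr_ge0 _)); rewrite pmulr_lge0//.
  by rewrite exprn_gt0// normr_gt0 gt_eqF// divr_gt0.
suff fd : h^-1 *: (f (h *: 1 + z) - f z) @[h --> 0^'] --> d.
  apply: DeriveDef; first by apply/cvg_ex; exists d.
  by apply: cvg_lim => //; exact: norm_hausdorff.
apply/cvgrPdist_le => s s0.
have r0 : 0 < s / (k + 1) by rewrite divr_gt0// ltr_wpDl.
near=> h.
have h0 : h != 0 by near: h; exact: nbhs_dnbhs_neq.
have he : `|h| < e by near: h; apply: dnbhs0_lt.
have hr : `|h| < s / (k + 1) by near: h; apply: dnbhs0_lt.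
rewrite -(ler_pM2l (x := `|h|)) ?normr_gt0// -normrM.
rewrite (_ : h * _ = - (f (z + h) - f z - h * d)); last first.
  rewrite -[h^-1 *: _]/(h^-1 * (f (h *: 1 + z) - f z)) mulrBr mulVKf//.
  by rewrite [h *: 1]mulr1 (addrC h) [RHS]opprB.
rewrite normrN (le_trans (H _ he))// expr2 mulrCA ler_wpM2l//.
rewrite (le_trans (ler_wpM2l k0 (ltW hr)))// mulrA ler_pdivrMr ?ltr_wpDl//.
by rewrite mulrC ler_wpM2l ?(ltW s0)// lerDl.
Unshelve. all: by end_near. Qed.

End quadratic_remainder.

Section power_series_derivative.
Context {R : realType}.
Implicit Types (a : nat -> R[i]) (z : R[i]).

Lemma is_derive_pser a z : subexp a -> normc z < 1 ->
  is_derive z 1 (pser a : R[i] -> R[i]) (pser (dcoef a) z).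
Proof.
move=> sa z1; have [|r zr /andP[r0 r1]] := @half_way R (normc z).
  by rewrite normc_ge0.
set M := limn (series (fun n => normc (dcoef (dcoef a) n) * r ^+ n)).
apply: (@is_derive_quadratic _ _ _ _ M%:C (r - normc z)%:C).
  by rewrite ltcR subr_gt0.
move=> h; rewrite !normcE -rmorphXn -rmorphM ltcR lecR => hr.
rewrite [leRHS]mulrC; apply: pser_taylor => //; first exact: ltW.
by rewrite (le_trans (normcD _ _))// -lerBrDl ltW.
Qed.

Lemma holomorphic_pser a : subexp a -> holomorphic_on (disc `\ 0) (pser a).
Proof. by move=> sa z [z1 _]; have [] := is_derive_pser sa z1. Qed.

Lemma continuous_pser a z : subexp a -> normc z < 1 ->
  {for z, continuous (pser a : R[i] -> R[i])}.
Proof.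
move=> sa z1; apply: differentiable_continuous; apply/derivable1_diffP.
by have [] := is_derive_pser sa z1.
Qed.

End power_series_derivative.

(** Derivatives of complex-valued functions of a real variable, taken on real
    and imaginary parts. *)
Section complex_curve.
Context {R : realType}.
Implicit Types (u v : R -> R[i]) (t : R) (d e z : R[i]).

Definition cder u t d :=
  is_derive t 1 (fun s => Re (u s)) (Re d) /\
  is_derive t 1 (fun s => Im (u s)) (Im d).

Lemma cder_eq u t d e : cder u t d -> d = e -> cder u t e.
Proof. by move=> ? <-. Qed.

Lemma cder_cst z t : cder (cst z) t 0.
Proof. by split; exact: is_derive_cst. Qed.

Lemma cderB u v t d e : cder u t d -> cder v t e ->
  cder (fun s => u s - v s) t (d - e).
Proof.
move=> [u1 u2] [v1 v2]; split.
- rewrite ReB (_ : (fun s => _) = (fun s => Re (u s)) - (fun s => Re (v s))).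
    exact: is_deriveB.
  by apply/funext => s; rewrite ReB.
- rewrite ImB (_ : (fun s => _) = (fun s => Im (u s)) - (fun s => Im (v s))).
    exact: is_deriveB.
  by apply/funext => s; rewrite ImB.
Qed.

Lemma cderM u v t d e : cder u t d -> cder v t e ->
  cder (fun s => u s * v s) t (u t * e + v t * d).
Proof.
move=> [u1 u2] [v1 v2]; split.
- rewrite (_ : (fun s => _) = (fun s => Re (u s)) * (fun s => Re (v s))
      - (fun s => Im (u s)) * (fun s => Im (v s))); last first.
    by apply/funext => s; rewrite ReM.
  apply: is_derive_eq; rewrite ReD !ReM /GRing.scale/=; ring.
- rewrite (_ : (fun s => _) = (fun s => Re (u s)) * (fun s => Im (v s))
      + (fun s => Im (u s)) * (fun s => Re (v s))); last first.
    by apply/funext => s; rewrite ImM.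
  apply: is_derive_eq; rewrite ImD !ImM /GRing.scale/=; ring.
Qed.

Lemma cder_ray z t : cder (fun s => s%:C * z) t z.
Proof.
split.
- rewrite (_ : (fun s => _) = (Re z) *: id).
    by apply: is_derive_eq; rewrite [_ *: _]mulr1.
  by apply/funext => s; rewrite ReZ mulrC.
- rewrite (_ : (fun s => _) = (Im z) *: id).
    by apply: is_derive_eq; rewrite [_ *: _]mulr1.
  by apply/funext => s; rewrite ImZ mulrC.
Qed.

Lemma cder_quadratic u t d (k e : R) : 0 < e ->
  (forall h, `|h| < e -> normc (u (t + h) - u t - h%:C * d) <= k * `|h| ^+ 2) ->
  cder u t d.
Proof.
move=> e0 H; split; apply: (@is_derive_quadratic _ _ _ _ k e e0) => h he;
  apply: le_trans (H h he).
- by rewrite -ReZ -!ReB Re_le_normc.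
- by rewrite -ImZ -!ImB Im_le_normc.
Qed.

Lemma cder_pser a z t : subexp a -> normc (t%:C * z) < 1 ->
  cder (fun s => pser a (s%:C * z)) t (z * pser (dcoef a) (t%:C * z)).
Proof.
move=> sa z1; have [|r zr /andP[r0 r1]] := @half_way R (normc (t%:C * z)).
  by rewrite normc_ge0.
set M := limn (series (fun n => normc (dcoef (dcoef a) n) * r ^+ n)).
have n1 : 0 < normc z + 1 by rewrite ltr_wpDl ?normc_ge0.
apply: (@cder_quadratic _ _ _ (normc z ^+ 2 * M)
  ((r - normc (t%:C * z)) / (normc z + 1))).
  by rewrite divr_gt0// subr_gt0.
move=> h; rewrite ltr_pdivlMr// => hr.
have -> : normc z ^+ 2 * M * `|h| ^+ 2 = normc (h%:C * z) ^+ 2 * M.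
  by rewrite Normc.normcM normc_real; ring.
rewrite rmorphD mulrDl mulrA.
apply: pser_taylor => //; first exact: ltW.
rewrite (le_trans (normcD _ _))// -lerBrDl (le_trans _ (ltW hr))//.
by rewrite Normc.normcM normc_real ler_wpM2l// lerDl.
Qed.

Lemma cder0_cst u (a b : R) : a <= b ->
  (forall t, a <= t <= b -> cder u t 0) -> u a = u b.
Proof.
move=> ab H.
have K (f : R -> R) : (forall t, a <= t <= b -> is_derive t 1 f 0) -> f a = f b.
  move=> fd; apply/esym/eqP; rewrite -subr_eq0; apply/eqP.
  have [//|x /andP[ax xb]||c _ ->] := @MVT_segment R f (fun=> 0) a b.
  - by apply: fd; rewrite !ltW.
  - apply: derivable_within_continuous => x; rewrite in_itv/= => xab.
    by have [] := fd x xab.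
  - by rewrite mul0r.
have h1 := K (fun s => Re (u s)) (fun t tab => (H t tab).1).
have h2 := K (fun s => Im (u s)) (fun t tab => (H t tab).2).
by apply/eqP; rewrite eq_complex h1 h2 !eqxx.
Qed.

End complex_curve.

(** * Principal powers on the right half-plane *)

Section right_half_plane_powers.
Context {R : realType}.
Implicit Types (z : R[i]) (s t x : R).

Lemma atan_ge0 x : 0 <= x -> 0 <= atan x.
Proof.
move=> x0; rewrite leNgt; apply/negP => a0.
have c0 : 0 < cos (atan x) by apply: cos_gt0_pihalf; rewrite atan_gtNpi2 atan_ltpi2.
have : 0 < sin (- atan x).
  apply: sin_gt0_pi; rewrite oppr_gt0 a0/= (@lt_trans _ _ (pi / 2))//.
    by rewrite ltrNl atan_gtNpi2.
  by rewrite ltr_pdivrMr// ltr_pMr ?pi_gt0// ltr1n.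
rewrite sinN oppr_gt0 ltNge => /negP; apply.
by rewrite -(divfK (lt0r_neq0 c0) (sin _)) -/(tan _) atanK mulr_ge0// ltW.
Qed.

Lemma carg_atan z : 0 < Re z -> carg z = atan (Im z / Re z).
Proof.
case: z => x y /= x0; rewrite /carg/=.
have -> : x / Num.sqrt (x ^+ 2 + y ^+ 2) = cos (atan (y / x)).
  rewrite cos_atan -[x ^+ 2 + _](_ : x ^+ 2 * (1 + (y / x) ^+ 2) = _); last first.
    by field; rewrite gt_eqF.
  rewrite sqrtrM ?sqr_ge0// sqrtr_sqr gtr0_norm// invfM mulrA divff ?mul1r//.
  by rewrite gt_eqF.
have pi2 : pi / 2 <= pi :> R by rewrite ler_pdivrMr// ler_peMr ?pi_ge0// ler1n.
have [y0|y0] := leP 0 y.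
  rewrite cosK// in_itv/= atan_ge0 ?divr_ge0// 1?ltW//.
  by rewrite (lt_le_trans (atan_ltpi2 _)).
rewrite -cosN cosK ?opprK// in_itv/= -atanN atan_ge0; last first.
  by rewrite -mulNr divr_ge0 ?oppr_ge0 1?ltW.
by rewrite (le_trans (ltW (atan_ltpi2 _))).
Qed.

(** The principal branch of the power in a form that is differentiable without
    case distinction. *)
Definition hpow z s : R[i] :=
  (expR (s / 2 * ln (Re z ^+ 2 + Im z ^+ 2)))%:C *
  (cos (s * atan (Im z / Re z)) +i* sin (s * atan (Im z / Re z))).

Lemma cpow_hpow z s : 0 < Re z -> cpow z s = hpow z s.
Proof.
move=> z0; rewrite /cpow /hpow carg_atan//; congr (_%:C * _).
have n0 : 0 < normc z by rewrite (lt_le_trans z0)// (le_trans (ler_norm _))// Re_le_normc.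
rewrite /powR gt_eqF// -sqr_normc lnXn// -mulr_natr.
by congr expR; field.
Qed.

Lemma hpowD z s t : hpow z (s + t) = hpow z s * hpow z t.
Proof.
rewrite /hpow mulrDl mulrDl expRD mulrDl cosD sinD.
by apply/eqP; rewrite eq_complex !ReM !ImM/=; apply/andP; split; apply/eqP; ring.
Qed.

Lemma hpow0 z : hpow z 0 = 1.
Proof. by rewrite /hpow !mul0r expR0 cos0 sin0 mul1r. Qed.

Lemma hpow1z s : hpow 1 s = 1.
Proof.
by rewrite /hpow/= mul0r atan0 mulr0 expr0n expr1n addr0 ln1 mulr0 expR0 cos0 sin0 mul1r.
Qed.

Lemma hpow1 z : 0 < Re z -> hpow z 1 = z.
Proof.
case: z => x y /= x0.
have n0 : 0 < x ^+ 2 + y ^+ 2 by rewrite ltr_wpDr ?sqr_ge0// exprn_gt0.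
have c0 : 0 < cos (atan (y / x)) by apply: cos_gt0_pihalf; rewrite atan_gtNpi2 atan_ltpi2.
have hs : sin (atan (y / x)) = y / x * cos (atan (y / x)).
  by rewrite -{2}[y / x]atanK /tan divfK// gt_eqF.
have hc : cos (atan (y / x)) = x / Num.sqrt (x ^+ 2 + y ^+ 2).
  rewrite cos_atan -[x ^+ 2 + _](_ : x ^+ 2 * (1 + (y / x) ^+ 2) = _); last first.
    by field; rewrite gt_eqF.
  rewrite sqrtrM ?sqr_ge0// sqrtr_sqr gtr0_norm// invfM mulrA divff ?mul1r//.
  by rewrite gt_eqF.
have he : expR (1 / 2 * ln (x ^+ 2 + y ^+ 2)) = Num.sqrt (x ^+ 2 + y ^+ 2).
  rewrite -{1}(sqr_sqrtr (ltW n0)) lnXn ?sqrtr_gt0// -mulr_natr.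
  rewrite [X in expR X](_ : _ = ln (Num.sqrt (x ^+ 2 + y ^+ 2))); last by field.
  by rewrite lnK// posrE sqrtr_gt0.
have s0 : Num.sqrt (x ^+ 2 + y ^+ 2) != 0 by rewrite gt_eqF// sqrtr_gt0.
rewrite /hpow/= he !mul1r hs hc; apply/eqP; rewrite eq_complex ReZ ImZ/=.
by apply/andP; split; apply/eqP; field; rewrite ?s0 ?gt_eqF.
Qed.

(** The next two lemmas differentiate the modulus and the angle of
    (x + i y) ^ s; their coefficients are the real and imaginary parts of the
    logarithmic derivative of this power. *)
Lemma is_derive_hpow_modulus (x y : R -> R) (p q s t : R) :
  is_derive t 1 x p -> is_derive t 1 y q -> 0 < x t ->
  is_derive t 1 (fun r => expR (s / 2 * ln (x r ^+ 2 + y r ^+ 2)))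
    (s * (p * x t + q * y t) / (x t ^+ 2 + y t ^+ 2) *
     expR (s / 2 * ln (x t ^+ 2 + y t ^+ 2))).
Proof.
move=> dx dy x0.
have n0 : 0 < x t ^+ 2 + y t ^+ 2 by rewrite ltr_wpDr ?sqr_ge0// exprn_gt0.
pose n (r : R) : R := x r ^+ 2 + y r ^+ 2.
have dn : is_derive t 1 n (2 * (p * x t + q * y t)).
  have := is_deriveD (is_deriveM dx dx) (is_deriveM dy dy).
  rewrite (_ : x * x + y * y = n); last first.
    by apply/funext => r; rewrite /n !expr2.
  by move=> dn; apply: is_derive_eq dn _; rewrite /GRing.scale/=; ring.
have dl : is_derive t 1 (@ln R \o n) ((n t)^-1 * (2 * (p * x t + q * y t))).
  by apply: is_derive1_comp; exact: is_derive1_ln.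
have de := is_derive1_comp (is_derive_expR _) (is_deriveZ (s / 2) dl).
apply: is_derive_eq de _; rewrite /= /n [LHS]mulrC; congr (_ * _).
by rewrite /GRing.scale/=; field; rewrite gt_eqF.
Qed.

Lemma is_derive_hpow_angle (x y : R -> R) (p q s t : R) :
  is_derive t 1 x p -> is_derive t 1 y q -> 0 < x t ->
  is_derive t 1 (fun r => s * atan (y r / x r))
    (s * (q * x t - p * y t) / (x t ^+ 2 + y t ^+ 2)).
Proof.
move=> dx dy x0.
have n0 : 0 < x t ^+ 2 + y t ^+ 2 by rewrite ltr_wpDr ?sqr_ge0// exprn_gt0.
have dv : is_derive t 1 (fun r => (x r)^-1) (- (x t) ^- 2 *: p).
  by apply: is_deriveV; rewrite gt_eqF.
have da := is_derive1_comp (is_derive1_atan _) (is_deriveM dy dv).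
have ds := is_deriveZ s da.
apply: is_derive_eq ds _; rewrite -[(y * (fun r : R => (x r)^-1)) t]/(y t / x t) /GRing.scale/=.
by field; rewrite gt_eqF//= gt_eqF.
Qed.

Lemma cder_hpow z s t : 0 < Re (1 - t%:C * z) ->
  cder (fun r => hpow (1 - r%:C * z) s) t
    (- (s%:C * z) / (1 - t%:C * z) * hpow (1 - t%:C * z) s).
Proof.
move=> w0.
have [x xE] : {x : R -> R | forall r, x r = Re (1 - r%:C * z)} by eexists.
have [y yE] : {y : R -> R | forall r, y r = Im (1 - r%:C * z)} by eexists.
have dx : is_derive t 1 x (- Re z).
  have := (cderB (cder_cst 1 t) (cder_ray z t)).1; rewrite ReB sub0r.
  by congr (is_derive _ _ _ _); apply/funext => r; rewrite xE.
have dy : is_derive t 1 y (- Im z).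
  have := (cderB (cder_cst 1 t) (cder_ray z t)).2; rewrite ImB sub0r.
  by congr (is_derive _ _ _ _); apply/funext => r; rewrite yE.
have x0 : 0 < x t by rewrite xE.
have n0 : 0 < x t ^+ 2 + y t ^+ 2 by rewrite ltr_wpDr ?sqr_ge0// exprn_gt0.
have de := is_derive_hpow_modulus s dx dy x0.
have dg := is_derive_hpow_angle s dx dy x0.
have [e eE] : {e : R -> R | forall r, e r = expR (s / 2 * ln (x r ^+ 2 + y r ^+ 2))}.
  by eexists.
have [g gE] : {g : R -> R | forall r, g r = s * atan (y r / x r)} by eexists.
rewrite -eE -(funext eE) in de; rewrite -(funext gE) in dg.
have dc := is_derive1_comp (is_derive_cos _) dg.
have ds := is_derive1_comp (is_derive_sin _) dg.
have hE r : hpow (1 - r%:C * z) s = (e r)%:C * (cos (g r) +i* sin (g r)).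
  by rewrite /hpow eE gE xE yE.
set w := 1 - t%:C * z.
have wE : w = x t +i* y t by apply/eqP; rewrite eq_complex /= xE yE !eqxx.
have quotE : - (s%:C * z) / w =
  (s * (- Re z * x t + - Im z * y t) / (x t ^+ 2 + y t ^+ 2)) +i*
  (s * (- Im z * x t - - Re z * y t) / (x t ^+ 2 + y t ^+ 2)).
  have wn0 : w != 0 by rewrite wE eq_complex/= negb_and gt_eqF.
  apply: (mulIf wn0); rewrite divfK// wE; case: (z) => p q.
  apply/eqP; rewrite eq_complex !ReM !ImM/=.
  by apply/andP; split; apply/eqP; field; rewrite gt_eqF.
split.
- rewrite (_ : (fun r => _) = e * (@cos R \o g)); last first.
    by apply/funext => r; rewrite hE ReZ.
  apply: is_derive_eq (is_deriveM de dc) _.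
  by rewrite quotE hE ReM ReZ ImZ /GRing.scale/=; ring.
- rewrite (_ : (fun r => _) = e * (@sin R \o g)); last first.
    by apply/funext => r; rewrite hE ImZ.
  apply: is_derive_eq (is_deriveM de ds) _.
  by rewrite quotE hE ImM ReZ ImZ /GRing.scale/=; ring.
Qed.

End right_half_plane_powers.

(** * The Bergman kernel as a power series *)

Section coefficient_calculus.
Context {R : realType}.
Implicit Types (a b : nat -> R[i]) (z w : R[i]).

Lemma subexpB a b : subexp a -> subexp b -> subexp (fun n => a n - b n).
Proof.
move=> sa sb r r01; have [M HM] := sa r r01; have [N HN] := sb r r01.
exists (M + N) => n; rewrite (le_trans _ (lerD (HM n) (HN n)))// -mulrDl.
by rewrite ler_wpM2r ?normcB// exprn_ge0//; case/andP: r01.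
Qed.

Lemma subexpZ w a : subexp a -> subexp (fun n => w * a n).
Proof.
by apply: (@subexp_dominated _ _ _ (normc w)) => n; rewrite Normc.normcM.
Qed.

Lemma pserB a b z : subexp a -> subexp b -> normc z < 1 ->
  pser (fun n => a n - b n) z = pser a z - pser b z.
Proof.
move=> sa sb z1; rewrite /pser -csumB; [|exact: summable_pser..].
by congr csum; apply/funext => n; rewrite mulrBl.
Qed.

Lemma pserZ w a z : subexp a -> normc z < 1 ->
  pser (fun n => w * a n) z = w * pser a z.
Proof.
move=> sa z1; rewrite /pser -csumZ; last exact: summable_pser.
by congr csum; apply/funext => n; rewrite mulrA.
Qed.

Lemma subexp_shift a : subexp a -> subexp (fun n => a n.+1).
Proof.
move=> /subexp_dcoef; apply: (@subexp_dominated _ _ _ 1) => n.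
rewrite mul1r /dcoef Normc.normcM normc_real ger0_norm//.
by rewrite ler_peMl ?normc_ge0// ler1n.
Qed.

Lemma pser_shift a z : subexp a -> normc z < 1 ->
  pser a z = a 0%N + z * pser (fun n => a n.+1) z.
Proof.
move=> sa z1; rewrite {1}/pser csum_shift ?expr0 ?mulr1; last exact: summable_pser.
congr (_ + _); rewrite /pser -csumZ; last exact/summable_pser/z1/subexp_shift.
by congr csum; apply/funext => n; rewrite exprS mulrCA.
Qed.

Definition theta a : nat -> R[i] := fun n => n%:R%:C * a n.

Lemma subexp_theta a : subexp a -> subexp (theta a).
Proof.
move=> sa r r01; have [M HM] := subexp_dcoef sa r01.
have /andP[r0 /ltW r1] := r01.
have M0 : 0 <= M by rewrite (le_trans _ (HM 0%N))// expr0 mulr1 normc_ge0.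
exists M => -[|n]; first by rewrite /theta mul0r Normc.normc0 mul0r.
by rewrite exprS mulrCA (le_trans (ler_piMl _ r1)) ?(HM n)// mulr_ge0 ?normc_ge0 ?exprn_ge0.
Qed.

(** The Euler operator z d/dz multiplies the n-th coefficient by n. *)
Lemma pser_theta a z : subexp a -> normc z < 1 ->
  z * pser (dcoef a) z = pser (theta a) z.
Proof.
move=> sa z1; rewrite [RHS]pser_shift//; last exact: subexp_theta.
by rewrite /theta/= mul0r add0r.
Qed.

Lemma pser0 a : pser a 0 = a 0%N.
Proof.
apply: csum_eq; rewrite -cvg_shiftS.
apply: cvg_near_cst; near=> n.
rewrite /series/= big_nat_recl//= expr0 mulr1 big1 ?addr0// => i _.
by rewrite expr0n mulr0.
Unshelve. all: by end_near. Qed.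

(** The ratio test for hypergeometric coefficients. *)
Lemma subexp_linear_ratio a (k e : R) : 0 < e ->
  (forall n, normc (a n.+1) * (n%:R + e) <= (n%:R + k) * normc (a n)) ->
  subexp a.
Proof.
move=> e0 H; apply: subexp_ratio => r /andP[r0 r1].
have HN := archi_boundP (normr_ge0 (k / (1 - r))).
exists (Num.bound `|k / (1 - r)|) => n Nn.
have ne : 0 < n%:R + e by rewrite ltr_wpDl.
rewrite -(ler_pM2r ne) mulrAC (le_trans (ler_wpM2r (ltW r0) (H n)))//.
rewrite mulrAC mulrC ler_wpM2l ?normc_ge0//.
have kn : k <= n%:R * (1 - r).
  rewrite -ler_pdivrMr ?subr_gt0// (le_trans (ler_norm _))//.
  by rewrite (le_trans (ltW HN))// ler_nat.
have n0 : 0 <= n%:R :> R by [].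
have rk : k * r <= Num.max k 0.
  rewrite le_max; have [k0|k0] := leP 0 k; first by rewrite ler_piMr// ltW.
  by apply/orP; right; rewrite pmulr_lle0 ?ltW.
have kn' : Num.max k 0 <= n%:R * (1 - r).
  by rewrite ge_max kn/= mulr_ge0// subr_ge0 ltW.
by move: rk kn'; lra.
Qed.

End coefficient_calculus.

(** If s^b f(s) does not depend on s, where f(s) = O(s) and b > -1, then letting
    s tend to 0 shows that its value is 0. *)
Lemma powR_mul_derivable_eq0 {R : realType} (b : R) (f : R -> R) (x e : R) :
  -1 < b -> is_derive (0 : R) (1 : R) f e -> f 0 = 0 ->
  (forall s, 0 < s <= 1 -> x = s `^ b * f s) -> x = 0.
Proof.
move=> b1 [fd fe] f0 xf; have b0 : 0 < b + 1 by lra.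
have fq : (s^-1 * f s) @[s --> 0^'+] --> e.
  rewrite -fe; apply: cvg_dnbhs_at_right; move/cvg_ex: fd => [l fl].
  rewrite /derive (cvg_lim _ fl); last exact: norm_hausdorff.
  rewrite (_ : (fun s => s^-1 * f s) = fun s => s^-1 *: (f (s *: 1 + 0) - f 0))//.
  by apply/funext => s; rewrite f0 subr0 addr0 [s *: 1]mulr1.
have c2 : x @[s --> (0 : R)^'+] --> 0 * e.
  apply: cvg_trans (cvgM (powR_cvg0 b0) fq); apply: near_eq_cvg.
  near=> s; have s0 : (0 : R) < s by near: s; exact: nbhs_right_gt.
  rewrite (xf s); last by rewrite s0/=; near: s; exact: nbhs_right_le.
  rewrite /= powRD ?(gt_eqF s0) ?implybT// powRr1 1?ltW// -mulrA mulVKf//.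
rewrite mul0r in c2.
by apply: (cvg_unique _ _ c2); [exact: norm_hausdorff|exact: cvg_cst].
Unshelve. all: by end_near. Qed.

Section kernel_power_series.
Context {R : realType}.
Variables alpha beta : R.
Hypotheses (halpha : -1 < alpha) (hbeta : -1 < beta <= 0).
Implicit Types (z w : R[i]).

(** The quotient of Pochhammer symbols
    (alpha + beta + 2)_n / (beta + 1)_n. *)
Definition kcoef (n : nat) : R :=
  \prod_(i < n) ((i%:R + (alpha + beta + 2)) / (i%:R + (beta + 1))).

Local Notation ck := (fun n => (kcoef n)%:C).

(** Taylor coefficients of [(1 - z) ^ (alpha + 1)]. *)
Definition bcoef (n : nat) : R := (-1) ^+ n * gbinom (alpha + 1) n.

Local Notation cb := (fun n => (bcoef n)%:C).

Definition qcoef (n : nat) : R := (-1) ^+ n * Qcoef alpha beta n.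

Local Notation cq := (fun n => (qcoef n)%:C).

Let beta1 : 0 < beta + 1. Proof. by case/andP: hbeta => *; lra. Qed.

Let ab2 : 0 < alpha + beta + 2. Proof. by have ha := halpha; case/andP: hbeta => *; lra. Qed.

Lemma kcoef_gt0 n : 0 < kcoef n.
Proof. by apply: prodr_gt0 => i _; rewrite divr_gt0// ltr_wpDl. Qed.

Lemma kcoefS n :
  kcoef n.+1 * (n%:R + (beta + 1)) = (n%:R + (alpha + beta + 2)) * kcoef n.
Proof.
have nb : n%:R + (beta + 1) != 0 by rewrite gt_eqF// ltr_wpDl.
by rewrite /kcoef big_ord_recr/= -mulrA divfK// mulrC.
Qed.

Lemma subexp_kcoef : subexp ck.
Proof.
apply: (@subexp_linear_ratio _ _ (alpha + beta + 2) (beta + 1)) => // n.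
by rewrite !normc_real !gtr0_norm ?kcoef_gt0// kcoefS.
Qed.

Lemma bcoefS n : bcoef n.+1 * (n%:R + 1) = (n%:R - (alpha + 1)) * bcoef n.
Proof.
rewrite /bcoef /gbinom big_ord_recr/= exprS factS natrM -natr1.
by field; rewrite natr1 !pnatr_eq0 -lt0n fact_gt0.
Qed.

Lemma subexp_bcoef : subexp cb.
Proof.
apply: (@subexp_linear_ratio _ _ (alpha + 1) 1) => // n.
have ha := halpha.
rewrite !normc_real -[X in _ * X](@ger0_norm _ (n%:R + 1))// -normrM bcoefS normrM.
by rewrite ler_wpM2r// (le_trans (ler_normB _ _))// !ger0_norm//; lra.
Qed.

(** The separate value of [Qcoef] for beta = 0 is chosen so that this relation
    persists there. *)
Lemma qcoefE n : (n%:R + beta) * qcoef n = beta * bcoef n.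
Proof.
rewrite /qcoef /Qcoef /bcoef; have [->|b0] := eqVneq beta 0.
  by case: n => [|n]; rewrite ?mul0r ?mulr0 ?addr0 ?mul0r.
have nb : n%:R + beta != 0.
  case: n => [|n]; first by rewrite add0r.
  by rewrite -natr1 -addrA (addrC 1) gt_eqF// ltr_wpDl.
by field.
Qed.

Lemma kcoef0 : kcoef 0 = 1. Proof. by rewrite /kcoef big_ord0. Qed.

Lemma bcoef0 : bcoef 0 = 1.
Proof. by rewrite /bcoef /gbinom big_ord0 fact0 divff ?oner_neq0// expr0 mul1r. Qed.

Lemma qcoef0 : qcoef 0 = 1.
Proof.
have := bcoef0; rewrite /qcoef /bcoef /Qcoef !expr0 !mul1r => ->.
by have [b0|b0] := eqVneq beta 0; rewrite ?eqxx// add0r divff// mulr1.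
Qed.

Lemma subexp_qcoef : subexp cq.
Proof.
apply: (subexp_dominated (K := 1 + (beta + 1)^-1) _ subexp_bcoef) => n.
rewrite !normc_real; have b1 : 0 < (beta + 1)^-1 by rewrite invr_gt0.
case: n => [|n].
  by rewrite qcoef0 bcoef0 normr1 mulr1; lra.
have nb : 0 < n.+1%:R + beta.
  by rewrite -natr1 -addrA (addrC 1) ltr_wpDl.
rewrite -(ler_pM2l nb) -[X in X * `|qcoef _|](gtr0_norm nb) -normrM qcoefE normrM.
rewrite mulrA ler_wpM2r//.
have bb : `|beta| <= 1 by case/andP: hbeta => *; rewrite ler0_norm//; lra.
have nb1 : beta + 1 <= n.+1%:R + beta by rewrite addrC lerD2r ler1n.
apply: (le_trans bb); apply: (@le_trans _ _ ((beta + 1) * (beta + 1)^-1)).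
  by rewrite divff// gt_eqF.
by apply: (ler_pM (ltW beta1) (ltW b1) nb1); rewrite lerDr.
Qed.

Local Notation kser := (pser ck).
Local Notation bser := (pser cb).
Local Notation qser := (pser cq).

(** The recurrences of the three coefficient sequences are first-order linear
    differential equations for the sums. *)
Lemma bser_ode z : normc z < 1 ->
  (1 - z) * pser (dcoef cb) z = - (alpha + 1)%:C * bser z.
Proof.
move=> z1; have sb := subexp_bcoef.
rewrite mulrBl mul1r pser_theta// -pserB//;
  [|exact: subexp_dcoef|exact: subexp_theta].
rewrite -pserZ//; congr (pser _ z); apply/funext => n.
rewrite /dcoef /theta -!rmorphM -rmorphB -rmorphN -rmorphM; congr (_%:C).
by have := bcoefS n; rewrite -natr1; lra.
Qed.

Lemma qser_ode z : normc z < 1 ->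
  z * pser (dcoef cq) z = beta%:C * (bser z - qser z).
Proof.
move=> z1; have sb := subexp_bcoef; have sq := subexp_qcoef.
rewrite pser_theta// -pserB// -pserZ//; last exact: subexpB.
congr (pser _ z); apply/funext => n.
rewrite /theta -!rmorphM -rmorphB -rmorphM; congr (_%:C).
by have := qcoefE n; lra.
Qed.

Lemma kser_ode z : normc z < 1 ->
  (1 - z) * (z * pser (dcoef ck) z) =
  beta%:C - beta%:C * kser z + (alpha + beta + 2)%:C * (z * kser z).
Proof.
move=> z1; have sk := subexp_kcoef; have st := subexp_theta sk.
have e1 : pser (theta ck) z + beta%:C * kser z =
    beta%:C + z * (pser (theta ck) z + (alpha + beta + 2)%:C * kser z).
  have add2 x : pser (theta ck) z + x%:C * kser z =
      pser (fun n => theta ck n - (- x)%:C * ck n) z.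
    by rewrite pserB//; [rewrite pserZ// rmorphN mulNr opprK|exact: subexpZ].
  rewrite !add2 pser_shift//; last by apply: subexpB => //; exact: subexpZ.
  congr (_ + z * _).
    by rewrite /theta/= mul0r sub0r rmorphN mulNr opprK kcoef0 mulr1.
  congr (pser _ z); apply/funext => n; rewrite /theta.
  rewrite -!rmorphM -!rmorphB; congr (_%:C).
  by have := kcoefS n; rewrite -natr1; lra.
rewrite pser_theta//; move: e1; move: (pser (theta ck) z) (kser z) => x y e1.
have -> : (1 - z) * x = x + beta%:C * y - z * x - beta%:C * y by ring.
by rewrite e1; ring.
Qed.

(** The binomial series: its product with the opposite power has derivative 0
    along each ray from the origin. *)
Lemma bser_hpow z : normc z < 1 -> bser z = hpow (1 - z) (alpha + 1).
Proof.
move=> z1; have sb := subexp_bcoef.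
have ray t : 0 <= t <= 1 -> normc (t%:C * z) < 1.
  move=> /andP[t0 t1]; rewrite Normc.normcM normc_real ger0_norm//.
  by rewrite (le_lt_trans _ z1)// ler_piMl// normc_ge0.
have Re_gt0 w : normc w < 1 -> 0 < Re (1 - w).
  move=> w1; rewrite ReB subr_gt0 (le_lt_trans (ler_norm _))//.
  by rewrite (le_lt_trans (Re_le_normc _)).
have cst1 : bser (1%:C * z) * hpow (1 - 1%:C * z) (- (alpha + 1)) =
            bser (0%:C * z) * hpow (1 - 0%:C * z) (- (alpha + 1)).
  apply/esym; pose u t := bser (t%:C * z) * hpow (1 - t%:C * z) (- (alpha + 1)).
  apply: (@cder0_cst _ u 0 1 ler01) => t /ray tz.
  have := cderM (cder_pser sb tz) (cder_hpow (- (alpha + 1)) (Re_gt0 _ tz)).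
  move/cder_eq; apply.
  have w0 : 1 - t%:C * z != 0.
    by apply: contraTneq (Re_gt0 _ tz) => ->; rewrite ltxx.
  apply: (mulfI w0); rewrite mulr0 -[RHS](mul0r (z * hpow (1 - t%:C * z) (- (alpha + 1)))).
  have -> : 0 = (1 - t%:C * z) * pser (dcoef cb) (t%:C * z)
                + (alpha + 1)%:C * bser (t%:C * z) :> R[i].
    by rewrite bser_ode// mulNr addNr.
  by rewrite rmorphN; field.
have := cst1; rewrite mul1r mul0r pser0 subr0 bcoef0 hpow1z mulr1 => H.
have E : hpow (1 - z) (- (alpha + 1)) * hpow (1 - z) (alpha + 1) = 1.
  by rewrite -hpowD addNr hpow0.
by rewrite -[LHS]mulr1 -[X in _ * X]E mulrA H mul1r.
Qed.

(** The difference D of both sides satisfies t D' = - beta D along a ray and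
    vanishes at the origin; since beta > -1, no nonzero solution of this equation
    is differentiable at 0. *)
Lemma qser_kser z : normc z < 1 -> qser z = (1 - z) * bser z * kser z.
Proof.
move=> z1; have sb := subexp_bcoef; have sk := subexp_kcoef; have sq := subexp_qcoef.
have ray t : 0 <= t <= 1 -> normc (t%:C * z) < 1.
  move=> /andP[t0 t1]; rewrite Normc.normcM normc_real ger0_norm//.
  by rewrite (le_lt_trans _ z1)// ler_piMl// normc_ge0.
pose D t := qser (t%:C * z) - (1 - t%:C * z) * bser (t%:C * z) * kser (t%:C * z).
suff D1 : D 1 = 0 by apply/eqP; rewrite -subr_eq0; move: D1; rewrite /D !mul1r => ->.
have dD t : 0 <= t <= 1 -> exists2 d, cder D t d & t%:C * d = - beta%:C * D t.
  move=> /ray tz; eexists.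
    apply: cderB; first exact: cder_pser sq tz.
    apply: cderM; last exact: cder_pser sk tz.
    by apply: cderM; [apply: cderB; [exact: cder_cst|exact: cder_ray]|exact: cder_pser sb tz].
  have e1 := qser_ode tz; have e2 := bser_ode tz; have e3 := kser_ode tz.
  rewrite /D; move: e1 e2 e3; set w := t%:C * z.
  move: (qser w) (bser w) (kser w) => q b k.
  move: (pser (dcoef cq) w) (pser (dcoef cb) w) (pser (dcoef ck) w) => q' b' k'.
  move=> e1 e2 e3.
  transitivity (w * q' - b * ((1 - w) * (w * k')) - k * (w * ((1 - w) * b') - w * b)).
    by rewrite /w; ring.
  by rewrite e1 e2 e3; ring.
have D0 : D 0 = 0.
  rewrite /D mul0r !pser0 qcoef0 bcoef0 kcoef0; ring.
have powD s : 0 < s <= 1 -> D 1 = (s `^ beta)%:C * D s.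
  move=> /andP[s0 s1].
  have := @cder0_cst _ (fun t => (t `^ beta)%:C * D t) s 1 s1.
  rewrite powR1 mul1r => -> // t /andP[st t1].
  have t0 : 0 < t := lt_le_trans s0 st.
  have [|d dDt td] := dD t; first by rewrite (ltW t0).
  have dp : cder (fun r => (r `^ beta)%:C) t (beta * t `^ (beta - 1))%:C.
    by split; [exact: is_derive1_powR|exact: is_derive_cst].
  apply: cder_eq (cderM dp dDt) _.
  have tp : t `^ beta = t * t `^ (beta - 1).
    by rewrite -{2}(powRr1 (ltW t0)) -powRD ?(gt_eqF t0) ?implybT// addrC subrK.
  rewrite tp !rmorphM; transitivity ((t `^ (beta - 1))%:C * (t%:C * d + beta%:C * D t)).
    by ring.
  by rewrite td mulNr addNr mulr0.
have bt : -1 < beta by case/andP: hbeta.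
have [|d0 [dr di] _] := dD 0; first by rewrite lexx ler01.
apply/eqP; rewrite eq_complex; apply/andP; split; apply/eqP => /=.
  apply: (powR_mul_derivable_eq0 bt dr); first by rewrite D0.
  by move=> s /powD ->; rewrite ReZ.
apply: (powR_mul_derivable_eq0 bt di); first by rewrite D0.
by move=> s /powD ->; rewrite ImZ.
Qed.

(** Euler's transformation of the hypergeometric series [2F1(alpha + beta + 2,
    1; beta + 1)], obtained from the differential equation that both sides
    satisfy along each ray. *)
Lemma bergman_kernel_pser w z : normc w < 1 -> normc z < 1 ->
  bergman_kernel alpha beta w z = kser (w * conjc z).
Proof.
move=> w1 z1; have wz : normc (w * conjc z) < 1.
  rewrite Normc.normcM normc_conj (le_lt_trans _ z1)//.
  by rewrite ler_piMl ?normc_ge0// ltW.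
have u0 : 0 < Re (1 - w * conjc z).
  rewrite ReB subr_gt0 (le_lt_trans (ler_norm _))//.
  by rewrite (le_lt_trans (Re_le_normc _)).
have h0 : hpow (1 - w * conjc z) (2 + alpha) != 0.
  apply/eqP => h0; have := hpow0 (1 - w * conjc z).
  by rewrite -(subrr (2 + alpha)) hpowD h0 mul0r => /eqP; rewrite eq_sym oner_eq0.
rewrite /bergman_kernel cpow_hpow//; apply: (mulIf h0); rewrite divfK//.
have -> : Q alpha beta (w * conjc z) = qser (w * conjc z).
  congr csum; apply/funext => n.
  by rewrite /qcoef rmorphM rmorphXn rmorphN1 exprNn mulrCA mulrA.
rewrite qser_kser// bser_hpow// mulrC; congr (_ * _).
by rewrite -{1}(hpow1 u0) -hpowD; congr hpow; ring.
Qed.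

End kernel_power_series.

(** * Invariance of plane Lebesgue measure *)

Section line_lebesgue.
Context {R : realType}.
Local Notation leb := (@lebesgue_measure R).

Lemma measurable_affine (c d : R) :
  measurable_fun setT (fun x : measurableTypeR R => (c * x + d : measurableTypeR R)).
Proof.
by apply: measurable_funD => //; apply: measurable_funM.
Qed.

(** By uniqueness of Lebesgue measure, it suffices to look at intervals. *)
Lemma lebesgue_affine (c d : R) (A : set (measurableTypeR R)) : 0 < c ->
  measurable A ->
  pushforward leb (fun x : measurableTypeR R => (c * x + d : measurableTypeR R)) A
  = (c^-1%:E * leb A)%E.
Proof.
move=> c0 mA.
have mphi := measurable_affine c d.
pose f (x : measurableTypeR R) : measurableTypeR R := c * x + d.
pose cn : {nonneg R} := NngNum (ltW c0).
pose m : {measure set (measurableTypeR R) -> \bar R} :=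
  mscale cn (pushforward leb f).
have -> : leb A = m mphi A.
  apply: (lebesgue_measure_unique (mu := m mphi)) => // _ [[a b]] _ <-.
  rewrite /m/= /mscale/= /pushforward.
  have -> : f @^-1` `]a, b]%classic = `](a - d) / c, (b - d) / c]%classic.
    by apply/seteqP; split => x /=; rewrite !in_itv/= ltr_pdivrMr// ler_pdivlMr//
      ltrBlDr lerBrDr mulrC.
  rewrite !lebesgue_measure_itv/= !lte_fin ltr_pM2r ?invr_gt0// ltrD2r.
  case: ifP => _; last by rewrite mule0.
  by rewrite -!EFinD -EFinM; congr EFin; field; rewrite gt_eqF.
by rewrite /m/= /mscale/= muleA -EFinM mulVf ?gt_eqF// mul1e.
Qed.

Lemma integral_affine (c d : R) (F : R -> \bar R) : 0 < c ->
  measurable_fun setT (F : measurableTypeR R -> _) -> (forall x, 0 <= F x)%E ->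
  (\int[leb]_x F (c * x + d)%R = c^-1%:E * \int[leb]_x F x)%E.
Proof.
move=> c0 mF F0.
have c'0 : 0 <= c^-1 by rewrite invr_ge0 ltW.
rewrite -[c^-1%:E]/((NngNum c'0)%:num%:E).
rewrite -(@ge0_integral_mscale _ _ _ leb setT measurableT)//.
have mphi := measurable_affine c d.
have := @ge0_integral_pushforward _ _ _ _ R _ mphi leb setT F measurableT mF.
rewrite preimage_setT => <-; last by move=> ? _; exact: F0.
apply: eq_measure_integral => A mA _.
exact: lebesgue_affine.
Qed.

End line_lebesgue.

Section plane_lebesgue.
Context {R : realType}.
Implicit Types (F : plane R -> \bar R) (G : R[i] -> \bar R).

Lemma measurable_linear (a b c d : R) : measurable_fun setT
  (fun p : plane R => (a * p.1 + b * p.2, c * p.1 + d * p.2) : plane R).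
Proof.
by apply/measurable_fun_pairP; split; apply: measurable_funD; apply: measurable_funM.
Qed.

Lemma plane_fubini1 F : measurable_fun setT F -> (forall p, 0 <= F p)%E ->
  (\int[lebesgue2]_p F p =
   \int[lebesgue_measure]_x \int[lebesgue_measure]_y F (x, y))%E.
Proof. by move=> mF F0; exact: fubini_tonelli1. Qed.

Lemma plane_fubini2 F : measurable_fun setT F -> (forall p, 0 <= F p)%E ->
  (\int[lebesgue2]_p F p =
   \int[lebesgue_measure]_y \int[lebesgue_measure]_x F (x, y))%E.
Proof. by move=> mF F0; exact: fubini_tonelli2. Qed.

Lemma integral_shear1 (a : R) F : measurable_fun setT F -> (forall p, 0 <= F p)%E ->
  (\int[lebesgue2]_p F (p.1 + a * p.2, p.2)%R = \int[lebesgue2]_p F p)%E.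
Proof.
move=> mF F0.
have mF' : measurable_fun setT (fun p : plane R => F (p.1 + a * p.2, p.2)%R).
  have := measurableT_comp mF (measurable_linear 1 a 0 1).
  by apply: eq_measurable_fun => p _ /=; rewrite !mul1r mul0r add0r.
rewrite (plane_fubini2 mF' (fun=> F0 _)) (plane_fubini2 mF F0).
apply: eq_integral => y _.
have := @integral_affine R 1 (a * y) (fun x => F (x, y)) ltr01.
rewrite invr1 mul1e => <- //; last exact: measurableT_comp.
by apply: eq_integral => x _; rewrite mul1r.
Qed.

Lemma integral_shear2 (a : R) F : measurable_fun setT F -> (forall p, 0 <= F p)%E ->
  (\int[lebesgue2]_p F (p.1, a * p.1 + p.2)%R = \int[lebesgue2]_p F p)%E.
Proof.
move=> mF F0.
have mF' : measurable_fun setT (fun p : plane R => F (p.1, a * p.1 + p.2)%R).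
  have := measurableT_comp mF (measurable_linear 1 0 a 1).
  by apply: eq_measurable_fun => p _ /=; rewrite !mul1r mul0r addr0.
rewrite (plane_fubini1 mF' (fun=> F0 _)) (plane_fubini1 mF F0).
apply: eq_integral => x _.
have := @integral_affine R 1 (a * x) (fun y => F (x, y)) ltr01.
rewrite invr1 mul1e => <- //; last exact: measurableT_comp.
by apply: eq_integral => y _; rewrite mul1r addrC.
Qed.

Lemma integral_dilation (c : R) F : 0 < c ->
  measurable_fun setT F -> (forall p, 0 <= F p)%E ->
  (\int[lebesgue2]_p F (c * p.1, c * p.2)%R =
   (c ^- 2)%:E * \int[lebesgue2]_p F p)%E.
Proof.
move=> c0 mF F0.
have mF' : measurable_fun setT (fun p : plane R => F (c * p.1, c * p.2)%R).
  have := measurableT_comp mF (measurable_linear c 0 0 c).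
  by apply: eq_measurable_fun => p _ /=; rewrite !mul0r addr0 add0r.
rewrite (plane_fubini1 mF' (fun=> F0 _)) (plane_fubini1 mF F0).
pose H x := (\int[lebesgue_measure]_y F (x, y))%E.
have mH : measurable_fun setT (H : measurableTypeR R -> _).
  have := @measurable_fun_fubini_tonelli_F _ _ _ _ R lebesgue_measure _ mF F0.
  exact.
have H0 x : (0 <= H x)%E by exact: integral_ge0.
transitivity (\int[lebesgue_measure]_x (c^-1%:E * H (c * x + 0)%R))%E.
  apply: eq_integral => x _.
  have := @integral_affine R c 0 (fun y => F (c * x, y)) c0.
  rewrite /H addr0 => <- //; last exact: measurableT_comp.
  by apply: eq_integral => y _; rewrite addr0.
rewrite ge0_integralZl//.
- by rewrite integral_affine// muleA -EFinM -invfM.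
- exact: (measurableT_comp mH (measurable_affine c 0)).
- by rewrite lee_fin invr_ge0 ltW.
Qed.

(** A rotation by an angle other than a multiple of a half-turn is a product of three
    shears. *)
Lemma integral_rotation (u : R[i]) G : normc u = 1 -> Im u != 0 ->
  measurable_fun setT (G \o toC) -> (forall z, 0 <= G z)%E ->
  (\int[lebesgue2]_p G (u * toC p)%R = \int[lebesgue2]_p G (toC p))%E.
Proof.
case: u => c s n1 /= s0 mG G0.
have cs : c ^+ 2 + s ^+ 2 = 1 by rewrite -[RHS](expr1n _ 2) -n1 sqr_normc.
(* Minus the tangent of half the angle. *)
pose a := (c - 1) / s.
pose F := G \o toC.
pose F1 (p : plane R) : \bar R := F (p.1 + a * p.2, p.2)%R.
pose F2 (p : plane R) : \bar R := F1 (p.1, s * p.1 + p.2)%R.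
have mF1 : measurable_fun setT F1.
  have := measurableT_comp mG (measurable_linear 1 a 0 1).
  by apply: eq_measurable_fun => p _ /=; rewrite !mul1r mul0r add0r.
have mF2 : measurable_fun setT F2.
  have := measurableT_comp mF1 (measurable_linear 1 0 s 1).
  by apply: eq_measurable_fun => p _ /=; rewrite !mul1r mul0r addr0.
have e1 := integral_shear1 a mG (fun=> G0 _).
have e2 := integral_shear2 s mF1 (fun=> G0 _).
have e3 := integral_shear1 a mF2 (fun=> G0 _).
apply: etrans (etrans e3 (etrans e2 e1)).
apply: eq_integral => -[x y] _; rewrite /F2 /F1 /F /=; congr G.
have as1 : a * s = c - 1 by rewrite /a divfK.
have as2 : a * (c + 1) = - s.
  apply: (mulIf s0); rewrite mulrAC as1 mulNr -expr2 (_ : s ^+ 2 = 1 - c ^+ 2).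
    by ring.
  by rewrite -cs addrAC subrr add0r.
have -> : x + a * y + a * (s * (x + a * y) + y)
    = x * (1 + a * s) + y * (a * (2 + a * s)) by ring.
have -> : s * (x + a * y) + y = s * x + (1 + a * s) * y by ring.
rewrite as1 (_ : 2 + (c - 1) = c + 1); last by ring.
rewrite as2; apply/eqP; rewrite eq_complex/=.
by apply/andP; split; apply/eqP; ring.
Qed.

End plane_lebesgue.

(** * Integration of radial functions *)

Section radial.
Context {R : realType}.
Local Notation leb := (@lebesgue_measure R).

Definition sqmod (p : plane R) : measurableTypeR R := p.1 ^+ 2 + p.2 ^+ 2.

Lemma sqmodE (p : plane R) : normc (toC p) ^+ 2 = sqmod p.
Proof. by rewrite sqr_normc. Qed.

Lemma sqmod_ge0 (p : plane R) : 0 <= sqmod p.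
Proof. by rewrite /sqmod addr_ge0// sqr_ge0. Qed.

Lemma measurable_sqmod : measurable_fun setT sqmod.
Proof. by apply: measurable_funD; apply: measurable_funX. Qed.

Lemma pdisc_sqmod : @pdisc R = sqmod @^-1` `]-oo, 1[.
Proof.
apply/seteqP; split => p; rewrite /pdisc /disc/= in_itv/= -sqmodE;
  by rewrite expr_lt1// normc_ge0.
Qed.

Lemma measurable_pdisc : measurable (@pdisc R).
Proof.
rewrite pdisc_sqmod -[X in measurable X]setTI.
by apply: measurable_sqmod => //; exact: measurable_itv.
Qed.

Definition cdisc (t : R) : set (plane R) := sqmod @^-1` `]-oo, t].

Lemma measurable_cdisc t : measurable (cdisc t).
Proof.
rewrite /cdisc -[X in measurable X]setTI.
by apply: measurable_sqmod => //; exact: measurable_itv.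
Qed.

Definition disc_area : R := fine (lebesgue2 (cdisc 1)).

Lemma lebesgue2_rect (a b : R) : 0 < a -> 0 < b ->
  lebesgue2 (`[- a, a]%classic `*` `[- b, b]%classic : set (plane R))
  = (2 * a * (2 * b))%:E.
Proof.
move=> a0 b0; transitivity (leb `[(- a)%R, a%R]%classic * leb `[(- b)%R, b%R]%classic)%E.
  by apply: product_measure1E; exact: measurable_itv.
rewrite !lebesgue_measure_itv/= !lte_fin !gtrN// -!EFinD -EFinM.
by congr EFin; ring.
Qed.

Lemma disc_area_fin : lebesgue2 (cdisc 1) = disc_area%:E.
Proof.
rewrite /disc_area fineK// ge0_fin_numE//.
apply: (@le_lt_trans _ _ (lebesgue2 (`[- 1, 1] `*` `[- 1, 1] : set (plane R)))).
  apply: le_measure; rewrite ?inE; first exact: measurable_cdisc.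
    by apply: measurableX; exact: measurable_itv.
  move=> [x y]; rewrite /cdisc /sqmod/= !in_itv/= => xy1.
  have sq1 (z : R) : z ^+ 2 <= 1 -> - 1 <= z <= 1.
    by move=> z1; rewrite -ler_norml -(@expr_le1 _ 2)// real_normK// num_real.
  by split; apply: sq1; rewrite (le_trans _ xy1)// ?lerDl ?lerDr sqr_ge0.
by rewrite lebesgue2_rect// ltry.
Qed.

Lemma disc_area_gt0 : 0 < disc_area.
Proof.
rewrite -lte_fin -disc_area_fin.
apply: (@lt_le_trans _ _ (lebesgue2 (`[- 2^-1, 2^-1] `*` `[- 2^-1, 2^-1] : set (plane R)))).
  by rewrite lebesgue2_rect ?invr_gt0// lte_fin; lra.
apply: le_measure; rewrite ?inE; last 2 first.
- exact: measurable_cdisc.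
- move=> [x y]; rewrite /cdisc /sqmod/= !in_itv/= => -[/andP[x1 x2] /andP[y1 y2]].
  by nra.
by apply: measurableX; exact: measurable_itv.
Qed.

(** Dilations of the plane by the square root of t scale areas by t. *)
Lemma lebesgue2_cdisc_gt0 t : 0 < t -> lebesgue2 (cdisc t) = (t * disc_area)%:E.
Proof.
move=> t0; have s0 : 0 < (Num.sqrt t)^-1 by rewrite invr_gt0 sqrtr_gt0.
have m1 := measurable_cdisc 1.
have ind t' : (\int[lebesgue2]_p (\1_(cdisc t') p)%:E = lebesgue2 (cdisc t'))%E.
  by rewrite integral_indic ?setIT//; exact: measurable_cdisc.
have := @integral_dilation R _ (fun p => (\1_(cdisc 1) p)%:E) s0.
rewrite ind disc_area_fin -exprVn invrK sqr_sqrtr ?(ltW t0)// -EFinM => <-.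
- rewrite -ind; apply: eq_integral => p _; congr (_%:E); rewrite !indicE; congr (_%:R).
  congr nat_of_bool; apply/idP/idP; rewrite !inE /cdisc /sqmod/= !in_itv/=;
   by rewrite !exprMn -mulrDr exprVn sqr_sqrtr ?(ltW t0)// mulrC ler_pdivrMr// mul1r.
- by apply/measurable_EFinP; exact: measurable_indic.
- by move=> p; rewrite lee_fin.
Qed.

Lemma lebesgue2_cdisc t : 0 <= t -> lebesgue2 (cdisc t) = (t * disc_area)%:E.
Proof.
rewrite le_eqVlt => /predU1P[<-|]; last exact: lebesgue2_cdisc_gt0.
rewrite mul0r; apply/eqP; rewrite eq_le measure_ge0 andbT.
apply/lee_addgt0Pr => e e0; rewrite add0e.
have t0 : 0 < e / disc_area by rewrite divr_gt0// disc_area_gt0.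
have := lebesgue2_cdisc_gt0 t0; rewrite divfK ?gt_eqF ?disc_area_gt0// => <-.
apply: le_measure; rewrite ?inE; [exact: measurable_cdisc|exact: measurable_cdisc|].
by move=> p; rewrite /cdisc/= !in_itv/= => /le_trans; apply; rewrite ltW.
Qed.

Lemma lebesgue2_annulus (a b : R) : 0 <= a <= b ->
  lebesgue2 (sqmod @^-1` `]a, b]) = ((b - a) * disc_area)%:E.
Proof.
move=> /andP[a0 ab].
have -> : sqmod @^-1` `]a, b] = cdisc b `\` cdisc a.
  apply/seteqP; split => p; rewrite /cdisc/= !in_itv/=.
    by move=> /andP[ap ->]; split => //; apply/negP; rewrite -ltNge.
  by move=> [-> /negP]; rewrite -ltNge => ->.
transitivity (lebesgue2 (cdisc b) - lebesgue2 (cdisc b `&` cdisc a))%E.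
  apply: measureD; [exact: measurable_cdisc..|].
  by have := ltry (b * disc_area); rewrite -(lebesgue2_cdisc (le_trans a0 ab)); exact.
rewrite (_ : _ `&` _ = cdisc a); last first.
  by apply/setIidPr => p; rewrite /cdisc/= !in_itv/= => /le_trans; exact.
by rewrite !lebesgue2_cdisc// ?(le_trans a0)// -EFinB -mulrBl.
Qed.

(** The squared modulus is uniformly distributed. *)
Lemma sqmod_distribution (A : set (measurableTypeR R)) : measurable A ->
  A `<=` `]0, +oo[ ->
  (pushforward lebesgue2 sqmod A = disc_area%:E * leb A)%E.
Proof.
move=> mA A0.
(* Adding Lebesgue measure on the negative half-line makes the normalized law of
   the squared modulus a measure to be compared with Lebesgue measure on the whole
   line. *)
have mneg : measurable (`]-oo, 0] : set (measurableTypeR R)) by exact: measurable_itv.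
have ia0 : 0 <= disc_area^-1 by rewrite invr_ge0 ltW// disc_area_gt0.
pose m1 : {measure set (measurableTypeR R) -> \bar R} :=
  mscale (NngNum ia0) (pushforward lebesgue2 sqmod).
pose m2 : {measure set (measurableTypeR R) -> \bar R} := mrestr leb mneg.
pose m : {measure set (measurableTypeR R) -> \bar R} :=
  measure_add (m1 measurable_sqmod) m2.
have mE B : m B = (disc_area^-1%:E * pushforward lebesgue2 sqmod B + leb (B `&` `]-oo, 0%R]))%E.
  exact: measure_addE.
have -> : leb A = m A.
  apply: (lebesgue_measure_unique (mu := m)) => // _ [[a b]] _ <-; rewrite mE/=.
  have [ab|ba] := ltP a b; last first.
    rewrite set_itv_ge ?bnd_simp -?leNgt//.
    by rewrite /pushforward preimage_set0 set0I !measure0 mule0 adde0.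
  have -> : `]a, b] `&` `]-oo, 0] = `]a, Num.min b 0]%classic.
    by apply/seteqP; split => x /=; rewrite !in_itv/= le_min;
      [move=> [/andP[-> ->] ->]|move=> /and3P[-> -> ->]].
  have -> : pushforward lebesgue2 sqmod `]a, b] =
      ((Num.max b 0 - Num.max a 0) * disc_area)%:E.
    have /orP[b0|b0] : (b < 0) || (0 <= b) by case: ltP.
      rewrite (max_r (ltW b0)) (max_r (ltW (lt_trans ab b0))) subrr mul0r.
      rewrite /pushforward (_ : _ @^-1` _ = set0) ?measure0//.
      apply/seteqP; split => // p /=; rewrite in_itv/= => /andP[_ /le_lt_trans].
      by move=> /(_ _ b0); rewrite ltNge sqmod_ge0.
    have /orP[a0|a0] : (0 <= a) || (a < 0) by case: leP.
      by rewrite (max_l a0) (max_l b0) -lebesgue2_annulus// a0 ltW.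
    rewrite (max_l b0) (max_r (ltW a0)) subr0 -(lebesgue2_cdisc b0).
    rewrite /pushforward /cdisc; congr (lebesgue2 _).
    apply/seteqP; split => p /=; rewrite !in_itv/=; first by case/andP.
    by move=> ->; rewrite (lt_le_trans a0) ?sqmod_ge0.
  rewrite !lebesgue_measure_itv/= !lte_fin ab lt_min ab/=.
  rewrite -EFinM mulrCA mulVf ?gt_eqF ?disc_area_gt0// mulr1.
  case: ifP => a0.
    rewrite (max_r (ltW a0)) subr0 -!EFinD; congr EFin.
    by have := addr_max_min b 0; lra.
  have {}a0 : 0 <= a by rewrite leNgt a0.
  by rewrite adde0 -EFinB max_l ?(le_trans a0)// ?ltW// max_l.
rewrite mE (_ : A `&` _ = set0) ?measure0 ?adde0; last first.
  apply/seteqP; split => // x [/A0]; rewrite /= !in_itv/= andbT => x0.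
  by rewrite leNgt x0.
by rewrite muleA -EFinM divff ?mul1e// gt_eqF// disc_area_gt0.
Qed.

(** Polar coordinates for radial functions: only the law of the squared modulus
    is involved. *)
Lemma integral_radial (phi : R -> \bar R) :
  measurable_fun setT (phi : measurableTypeR R -> _) -> (forall t, 0 <= phi t)%E ->
  (\int[lebesgue2]_(p in pdisc) phi (normc (toC p) ^+ 2)%R =
   disc_area%:E * \int[leb]_(t in `]0%R, 1%R[) phi t)%E.
Proof.
move=> mphi phi0.
transitivity (\int[lebesgue2]_(p in pdisc) (phi \o sqmod) p)%E.
  by apply: eq_integral => p _ /=; rewrite sqmodE.
have m01 : measurable (`]0, 1[%classic : set (measurableTypeR R)) by exact: measurable_itv.
have mn0 : measurable (`]-oo, 0]%classic : set (measurableTypeR R)) by exact: measurable_itv.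
have mn1 : measurable (`]-oo, 1[%classic : set (measurableTypeR R)) by exact: measurable_itv.
have sub T : measurable_fun T (phi : measurableTypeR R -> _).
  exact: measurable_funS mphi.
rewrite pdisc_sqmod.
have [m [mE ->]] : exists m : {measure set (measurableTypeR R) -> \bar R},
    (forall A, m A = lebesgue2 (sqmod @^-1` A)) /\
    (\int[lebesgue2]_(p in sqmod @^-1` `]-oo, 1%R[) (phi \o sqmod) p =
     \int[m]_(t in `]-oo, 1%R[) phi t)%E.
  pose pm : {measure set (measurableTypeR R) -> \bar R} := pushforward lebesgue2 sqmod.
  exists (pm measurable_sqmod); split => //; apply/esym.
  exact: (@ge0_integral_pushforward _ _ _ _ R _ measurable_sqmod lebesgue2
   `]-oo, 1[%classic phi mn1 (sub _) (fun t _ => phi0 t)).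
have da0 : 0 <= disc_area := ltW disc_area_gt0.
have split1 : `]-oo, 1[%classic = `]-oo, 0] `|` `]0, 1[ :> set (measurableTypeR R).
  apply/seteqP; split => x /=; rewrite !in_itv/=.
    by move=> x1; have [x0|x0] := leP x 0; [left|right].
  by case=> [x0|/andP[]//]; rewrite (le_lt_trans x0).
rewrite split1 ge0_integral_setU//=; last first.
  rewrite disj_set2E; apply/eqP/seteqP; split => // x /=; rewrite !in_itv/=.
  by move=> [x0 /andP[]]; rewrite ltNge x0.
rewrite [X in (X + _)%E](_ : _ = 0%E); last first.
  apply: null_set_integral => //.
  by rewrite mE; have := lebesgue2_cdisc (lexx 0); rewrite mul0r.
rewrite add0e -[disc_area%:E]/((NngNum da0)%:num%:E) -ge0_integral_mscale//.
apply: eq_measure_integral => A mA A01; rewrite /= /mscale/= mE.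
apply: sqmod_distribution => // x /A01; rewrite /= !in_itv/= => /andP[-> _]//.
Qed.

End radial.

(** * Beta integrals *)

Section open_interval_FTC.
Context {R : realType}.
Local Notation leb := (@lebesgue_measure R).
Implicit Types (G h : R -> R) (a b A B : R).

(** The fundamental theorem of calculus for a nonnegative, possibly unbounded,
    derivative. *)
Lemma ge0_FTC2_oo G h a b A B : a < b ->
  measurable_fun setT (h : measurableTypeR R -> measurableTypeR R) ->
  (forall x, a < x < b -> 0 <= h x) ->
  (forall x, a < x < b -> is_derive x 1 G (h x)) ->
  (forall x, a < x < b -> {for x, continuous h}) ->
  G x @[x --> a^'+] --> A -> G x @[x --> b^'-] --> B ->
  (\int[leb]_(x in `]a, b[) (h x)%:E = (B - A)%:E)%E.
Proof.
move=> ab mh h0 dG ch GA GB.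
(* The factor 3 keeps the compact intervals that exhaust the open one nonempty. *)
pose d n : R := (b - a) * (harmonic n / 3).
have h01 n : 0 < @harmonic R n <= 1 by rewrite /harmonic invr_gt0 ltr0n invf_le1 ?ler1n.
have d0 n : 0 < d n by rewrite mulr_gt0 ?subr_gt0// divr_gt0//; case/andP: (h01 n).
have d3 n : d n <= (b - a) / 3.
  by rewrite ler_wpM2l ?subr_ge0 ?(ltW ab)// ler_piMl//; case/andP: (h01 n).
have dcvg : d @ \oo --> 0.
  rewrite -(mulr0 (b - a)); apply: cvgMl_tmp; rewrite -(mul0r 3^-1).
  by apply: cvgMr_tmp; exact: cvg_harmonic.
have dn n m : (n <= m)%N -> d m <= d n.
  move=> nm; rewrite ler_wpM2l ?subr_ge0 ?(ltW ab)// ler_wpM2r//.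
  by rewrite /harmonic lef_pV2 ?posrE ?ltr0n// ler_nat.
have inab n x : a + d n <= x <= b - d n -> a < x < b.
  by move=> /andP[ax xb]; have := d0 n; lra.
pose I n : set (measurableTypeR R) := `[a + d n, b - d n]%classic.
have FTC n : (\int[leb]_(x in I n) (h x)%:E = (G (b - d n) - G (a + d n))%:E)%E.
  rewrite EFinB; apply: continuous_FTC2.
  - by have := d3 n; lra.
  - apply: continuous_in_subspaceT => x /set_mem; rewrite /= in_itv/= => /inab.
    exact: ch.
  - split.
    + move=> x; rewrite in_itv/= => /andP[x1 x2].
      by have [] := dG x (inab n x _); rewrite ?(ltW x1) ?(ltW x2).
    + apply: cvg_at_right_filter; apply: differentiable_continuous.
      apply/derivable1_diffP.
      by have [] := dG (a + d n) (inab n _ _) => //; rewrite lexx/=; have := d3 n; lra.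
    + apply: cvg_at_left_filter; apply: differentiable_continuous.
      apply/derivable1_diffP.
      by have [] := dG (b - d n) (inab n _ _) => //; rewrite lexx andbT; have := d3 n; lra.
  - move=> x; rewrite in_itv/= => /andP[x1 x2]; rewrite derive1E.
    by have [] := dG x (inab n x _); rewrite ?(ltW x1) ?(ltW x2).
have UI : \bigcup_n I n = `]a, b[%classic.
  apply/seteqP; split => x /=.
    by move=> [n _]; rewrite /I/= !in_itv/= => /inab.
  rewrite in_itv/= => /andP[ax xb].
  have e0 : 0 < Num.min (x - a) (b - x) by rewrite lt_min !subr_gt0 ax.
  have /cvgrPdist_lt/(_ _ e0)[N _ HN] := dcvg.
  exists N => //; have := HN N (leqnn N).
  rewrite /= sub0r normrN (ger0_norm (ltW (d0 N))) lt_min.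
  by rewrite /I/= in_itv/= => /andP[]; lra.
have c1 : (\int[leb]_(x in I n) (h x)%:E)%E @[n --> \oo] -->
    (\int[leb]_(x in `]a, b[) (h x)%:E)%E.
  rewrite -UI; apply: ge0_nondecreasing_set_cvg_integral.
  - move=> n m nm; apply/subsetPset => x; rewrite /I/= !in_itv/= => /andP[].
    by have := dn _ _ nm; lra.
  - by move=> n; exact: measurable_itv.
  - by move=> n; apply/measurable_EFinP; apply: measurable_funS mh.
  - by move=> n x; rewrite /I/= in_itv/= => /inab/h0; rewrite lee_fin.
have c2 : (\int[leb]_(x in I n) (h x)%:E)%E @[n --> \oo] --> (B - A)%:E.
  under eq_fun do rewrite FTC.
  apply: cvg_EFin; first by near=> n.
  apply: cvgB.
  - move/cvg_at_leftP : GB; apply; split; first by move=> n; rewrite gtrBl.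
    by rewrite -[X in _ --> X]subr0; apply: cvgB => //; exact: cvg_cst.
  - move/cvg_at_rightP : GA; apply; split; first by move=> n; rewrite ltrDl.
    by rewrite -[X in _ --> X]addr0; apply: cvgD => //; exact: cvg_cst.
by apply: (cvg_unique _ c1 c2); exact: ereal_hausdorff.
Unshelve. all: by end_near. Qed.

End open_interval_FTC.

Section beta_integral.
Context {R : realType}.
Local Notation leb := (@lebesgue_measure R).
Implicit Types (a b t : R).

Definition betaf a b t : R := t `^ a * (1 - t) `^ b.

Definition betaI a b : \bar R := (\int[leb]_(t in `]0%R, 1%R[) (betaf a b t)%:E)%E.

Lemma betaf_ge0 a b t : 0 <= betaf a b t.
Proof. by rewrite mulr_ge0// powR_ge0. Qed.

Lemma measurable_betaf a b :
  measurable_fun setT (betaf a b : measurableTypeR R -> measurableTypeR R).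
Proof.
apply: measurable_funM; first exact: measurable_powR.
apply: (measurableT_comp (measurable_powR b)).
by apply: measurable_funB.
Qed.

Lemma is_derive_onem_powR b t : t < 1 ->
  is_derive t 1 (fun s => (1 - s) `^ b) (- (b * (1 - t) `^ (b - 1))).
Proof.
move=> t1; have t0 : 0 < 1 - t by rewrite subr_gt0.
have d1 : is_derive t 1 (fun s : R => 1 - s) (- 1).
  rewrite (_ : (fun s => _) = cst 1 - id)//.
  by apply: is_derive_eq; rewrite sub0r.
have := @is_derive1_comp R (@powR R ^~ b) (fun s => 1 - s) t _ _ (is_derive1_powR b t0) d1.
by move=> H; apply: is_derive_eq H _; rewrite mulrN1.
Qed.

Lemma is_derive_betaf a b t : 0 < t < 1 ->
  is_derive t 1 (betaf a b)
    (t `^ (a - 1) * (1 - t) `^ (b - 1) * (a - (a + b) * t)).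
Proof.
move=> /andP[t0 t1]; have t0' : 0 < 1 - t by rewrite subr_gt0.
have := is_deriveM (is_derive1_powR a t0) (is_derive_onem_powR b t1).
move=> H; apply: is_derive_eq H _; rewrite /GRing.scale/=.
have E (x c : R) : 0 < x -> x `^ c = x * x `^ (c - 1).
  move=> x0; rewrite -{2}(powRr1 (ltW x0)) -powRD ?(gt_eqF x0) ?implybT//.
  by rewrite addrC subrK.
by rewrite (E t a)// (E (1 - t) b)//; ring.
Qed.

Lemma continuous_betaf a b t : 0 < t < 1 -> {for t, continuous (betaf a b)}.
Proof.
move=> t01; apply: differentiable_continuous; apply/derivable1_diffP.
by have [] := is_derive_betaf a b t01.
Qed.

Lemma betaf_cvg0 a b : 0 < a -> betaf a b t @[t --> 0^'+] --> 0.
Proof.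
move=> a0; rewrite -[X in _ --> X](mul0r ((1 - 0) `^ b)); apply: cvgM; first exact: powR_cvg0.
apply: cvg_at_right_filter.
have : {for 0, continuous (fun s : R => (1 - s) `^ b)}.
  apply: differentiable_continuous; apply/derivable1_diffP.
  by have [] := @is_derive_onem_powR b 0 ltr01.
exact.
Qed.

Lemma onem_powR_cvg0 b : 0 < b -> (1 - t) `^ b @[t --> 1^'-] --> 0.
Proof.
move=> b0; apply/cvg_at_leftP => u [u1 uc].
move/cvg_at_rightP : (powR_cvg0 b0); apply; split; first by move=> n; rewrite subr_gt0.
by rewrite -[X in _ --> X](subrr 1); apply: cvgB => //; exact: cvg_cst.
Qed.

Lemma betaf_cvg1 a b : 0 < b -> betaf a b t @[t --> 1^'-] --> 0.
Proof.
move=> b0; rewrite -(mulr0 (1 `^ a)); apply: cvgM; last exact: onem_powR_cvg0.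
apply: cvg_at_left_filter.
have : {for 1, continuous (fun s : R => s `^ a)}.
  apply: differentiable_continuous; apply/derivable1_diffP.
  by have [] := @is_derive1_powR R a 1 ltr01.
exact.
Qed.

Lemma integral_powR a : -1 < a ->
  (\int[leb]_(t in `]0%R, 1%R[) (t `^ a)%:E = ((a + 1)^-1)%:E)%E.
Proof.
move=> a1; have a0 : 0 < a + 1 by lra.
pose G (t : R) := (a + 1)^-1 * t `^ (a + 1).
have GE : G = (a + 1)^-1 *: (fun t => t `^ (a + 1)) by [].
have dG t : 0 < t -> is_derive t 1 G (t `^ a).
  move=> t0; rewrite GE; apply: is_derive_eq (is_deriveZ _ (is_derive1_powR _ t0)) _.
  by rewrite /GRing.scale/= mulrA mulVf ?gt_eqF// mul1r addrK.
transitivity (((a + 1)^-1 - 0)%:E); last by rewrite subr0.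
apply: (@ge0_FTC2_oo R G).
- exact: ltr01.
- exact: measurable_powR.
- by move=> t _; exact: powR_ge0.
- by move=> t /andP[t0 _]; exact: dG.
- move=> t /andP[t0 _]; apply: differentiable_continuous; apply/derivable1_diffP.
  by have [] := is_derive1_powR a t0.
- by rewrite -[X in _ --> X](mulr0 (a + 1)^-1); apply: cvgMl_tmp; exact: powR_cvg0.
- have G1 : G 1 = (a + 1)^-1 by rewrite /G powR1 mulr1.
  rewrite -[X in _ --> X]G1; apply: cvg_at_left_filter.
  have : {for 1, continuous G}.
    apply: differentiable_continuous; apply/derivable1_diffP.
    by have [] := dG 1 ltr01.
  exact.
Qed.

Lemma integral_onem_powR b : -1 < b ->
  (\int[leb]_(t in `]0%R, 1%R[) ((1 - t) `^ b)%:E = ((b + 1)^-1)%:E)%E.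
Proof.
move=> b1; have b0 : 0 < b + 1 by lra.
pose G (t : R) := - (b + 1)^-1 * (1 - t) `^ (b + 1).
have GE : G = - (b + 1)^-1 *: (fun t => (1 - t) `^ (b + 1)) by [].
have dG t : t < 1 -> is_derive t 1 G ((1 - t) `^ b).
  move=> t1; rewrite GE; apply: is_derive_eq (is_deriveZ _ (is_derive_onem_powR _ t1)) _.
  by rewrite /GRing.scale/= mulrNN mulrA mulVf ?gt_eqF// mul1r addrK.
transitivity ((0 - (- (b + 1)^-1))%:E); last by rewrite sub0r opprK.
apply: (@ge0_FTC2_oo R G).
- exact: ltr01.
- by apply: (measurableT_comp (measurable_powR b)); apply: measurable_funB.
- by move=> t _; exact: powR_ge0.
- by move=> t /andP[_ t1]; exact: dG.
- move=> t /andP[_ t1]; apply: differentiable_continuous; apply/derivable1_diffP.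
  by have [] := is_derive_onem_powR b t1.
- have G0 : G 0 = - (b + 1)^-1 by rewrite /G subr0 powR1 mulr1.
  rewrite -[X in _ --> X]G0.
  apply: cvg_at_right_filter.
  have : {for 0, continuous G}.
    apply: differentiable_continuous; apply/derivable1_diffP.
    by have [] := dG 0 ltr01.
  exact.
- by rewrite -[X in _ --> X](mulr0 (- (b + 1)^-1)); apply: cvgMl_tmp; exact: onem_powR_cvg0.
Qed.

Lemma powR_le2 b t : -1 < b -> 2^-1 <= t <= 1 -> t `^ b <= 2.
Proof.
move=> b1 /andP[t2 t1]; have t0 : 0 < t by lra.
have -> : t `^ b = t `^ (b + 1) / t.
  by rewrite powRD ?(gt_eqF t0) ?implybT// powRr1 ?(ltW t0)// mulfK// gt_eqF.
have h1 : t `^ (b + 1) <= 1.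
  apply: (@le_trans _ _ (1 `^ (b + 1))); last by rewrite powR1.
  by rewrite ge0_ler_powR ?nnegrE ?(ltW t0)//; lra.
by rewrite ler_pdivrMr// (le_trans h1)//; lra.
Qed.

(** On each half of the interval one of the two factors is at most 2. *)
Lemma betaI_lty a b : -1 < a -> -1 < b -> (betaI a b < +oo)%E.
Proof.
move=> a1 b1.
have ma : measurable_fun (`]0, 1[%classic : set (measurableTypeR R)) (fun t : measurableTypeR R => (2 * t `^ a)%:E).
  apply/measurable_EFinP; apply: measurable_funM => //.
  by apply: measurable_funS (measurable_powR a).
have mb : measurable_fun (`]0, 1[%classic : set (measurableTypeR R)) (fun t : measurableTypeR R => (2 * (1 - t) `^ b)%:E).
  apply/measurable_EFinP; apply: measurable_funM => //.
  apply: (@measurable_funS _ _ _ _ setT) => //.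
  by apply: (measurableT_comp (measurable_powR b)); apply: measurable_funB.
apply: (@le_lt_trans _ _ (\int[leb]_(t in `]0%R, 1%R[)
    ((2 * t `^ a)%:E + (2 * (1 - t) `^ b)%:E))%E).
  apply: ge0_le_integral => //.
  - by move=> t _; rewrite lee_fin betaf_ge0.
  - by apply/measurable_EFinP; apply: measurable_funS (measurable_betaf a b).
  - exact: emeasurable_funD.
  - move=> t; rewrite /= in_itv/= => /andP[t0 t1]; rewrite -EFinD lee_fin /betaf.
    have ta := powR_ge0 t a; have tb := powR_ge0 (1 - t) b.
    have [th|th] := leP t 2^-1.
      have := @powR_le2 b (1 - t) b1; nra.
    by have := @powR_le2 a t a1; nra.
rewrite ge0_integralD//; first last.
- by move=> t _; rewrite lee_fin mulr_ge0// powR_ge0.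
- by move=> t _; rewrite lee_fin mulr_ge0// powR_ge0.
under eq_integral do rewrite EFinM.
under [X in (_ + X)%E]eq_integral do rewrite EFinM.
rewrite ge0_integralZl//; last 2 first.
- by apply/measurable_EFinP; apply: measurable_funS (measurable_powR a).
- by move=> t _; rewrite lee_fin powR_ge0.
rewrite ge0_integralZl//; last 2 first.
- apply/measurable_EFinP; apply: (@measurable_funS _ _ _ _ setT) => //.
  by apply: (measurableT_comp (measurable_powR b)); apply: measurable_funB.
- by move=> t _; rewrite lee_fin powR_ge0.
by rewrite integral_powR// integral_onem_powR// -!EFinM -EFinD ltry.
Qed.

Lemma betaI_split a b c : 0 < c < 1 ->
  (betaI a b = \int[leb]_(t in `]0%R, c[) (betaf a b t)%:E
             + \int[leb]_(t in `]c, 1%R[) (betaf a b t)%:E)%E.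
Proof.
move=> /andP[c0 c1].
have mI (i : interval R) : measurable ([set` i] : set (measurableTypeR R)).
  exact: measurable_itv.
have mf D : measurable_fun D (fun t : measurableTypeR R => (betaf a b t)%:E).
  by apply/measurable_EFinP; apply: measurable_funS (measurable_betaf a b).
rewrite /betaI (_ : `]0, 1[%classic = `]0, c] `|` `]c, 1[ :> set (measurableTypeR R)).
  rewrite ge0_integral_setU//.
  - by congr (_ + _)%E; apply/esym; exact: (integral_itv_bndo_bndc (mf _)).
  - by move=> t _; rewrite lee_fin betaf_ge0.
  rewrite disj_set2E; apply/eqP/seteqP; split => // x /=; rewrite !in_itv/=.
  by move=> [/andP[_ xc] /andP[]]; rewrite ltNge xc.
apply/seteqP; split => x /=; rewrite !in_itv/=.
  by move=> /andP[x0 x1]; have [xc|xc] := leP x c; [left|right]; rewrite ?x0 ?x1 ?andbT.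
by case=> /andP[x0 x1]; rewrite ?x0 ?x1 ?(le_lt_trans x1)// (lt_trans c0).
Qed.

(** The derivative of [betaf (a + 1) (b + 1)] is [betaf a b] times a linear
    function that changes sign at [(a + 1) / (a + b + 2)]; integrating on both
    sides of that point relates two consecutive beta integrals. *)
Lemma betaI_recurrence a b : -1 < a -> -1 < b ->
  ((a + b + 2)%:E * betaI (a + 1) b = (a + 1)%:E * betaI a b)%E
  /\ (0 < betaI a b)%E.
Proof.
move=> a1 b1; set p := a + 1; set q := a + b + 2.
have p0 : 0 < p by rewrite /p; lra.
have q0 : 0 < q by rewrite /q; lra.
have pq : p < q by rewrite /p /q; lra.
pose c := p / q.
have c01 : 0 < c < 1 by rewrite divr_gt0//= ltr_pdivrMr// mul1r.
have /andP[c0 c1] := c01.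
pose G := betaf p (b + 1).
pose h t := betaf a b t * (p - q * t).
have dG t : 0 < t < 1 -> is_derive t 1 G (h t).
  move=> t01; apply: is_derive_eq (is_derive_betaf p (b + 1) t01) _.
  by rewrite /h /betaf /p /q !addrK; ring.
have hc t : 0 < t < 1 -> {for t, continuous h}.
  move=> t01; apply: cvgM; first exact: continuous_betaf.
  by apply: cvgB; [exact: cvg_cst|apply: cvgMl_tmp; exact: cvg_id].
have mh : measurable_fun setT (h : measurableTypeR R -> measurableTypeR R).
  apply: measurable_funM; first exact: measurable_betaf.
  by apply: measurable_funB => //; apply: measurable_funM.
have Gc : {for c, continuous G} by exact: continuous_betaf.
have G0 : 0 < G c by rewrite mulr_gt0// powR_gt0// subr_gt0.
have sgl t : t < c -> 0 <= p - q * t.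
  by rewrite ltr_pdivlMr// => tc; rewrite subr_ge0 mulrC ltW.
have sgr t : c < t -> p - q * t <= 0.
  by rewrite ltr_pdivrMr// => tc; rewrite subr_le0 mulrC ltW.
have I1 : (\int[leb]_(t in `]0%R, c[) (h t)%:E = (G c)%:E)%E.
  transitivity ((G c - 0)%:E); last by rewrite subr0.
  have inI t : 0 < t < c -> 0 < t < 1.
    by move=> /andP[-> tc]; rewrite (lt_trans tc).
  apply: (@ge0_FTC2_oo R G) => //.
  - by move=> t /andP[_ tc]; rewrite mulr_ge0 ?betaf_ge0// sgl.
  - by move=> t /inI; exact: dG.
  - by move=> t /inI; exact: hc.
  - exact: betaf_cvg0.
  - exact: cvg_at_left_filter.
have I2 : (\int[leb]_(t in `]c, 1%R[) (- h t)%:E = (G c)%:E)%E.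
  transitivity ((0 - (- G c))%:E); last by rewrite sub0r opprK.
  have inI t : c < t < 1 -> 0 < t < 1.
    by move=> /andP[ct ->]; rewrite (lt_trans c0).
  apply: (@ge0_FTC2_oo R (- G)) => //.
  - exact: (measurable_funN mh).
  - by move=> t /andP[ct _]; rewrite oppr_ge0 mulr_ge0_le0 ?betaf_ge0// sgr.
  - by move=> t /inI/dG dGt; exact: is_deriveN.
  - by move=> t /inI ti; apply: continuousN; exact: hc.
  - by apply: cvgN; exact: cvg_at_right_filter.
  - by rewrite -oppr0; apply: cvgN; apply: betaf_cvg1; lra.
have mI (i : interval R) : measurable ([set` i] : set (measurableTypeR R)).
  exact: measurable_itv.
have mf k a' D : measurable_fun D (fun t : measurableTypeR R => (k * betaf a' b t)%:E).
  apply/measurable_EFinP; apply: measurable_funM => //.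
  by apply: measurable_funS (measurable_betaf a' b).
have mf1 a' D : measurable_fun D (fun t : measurableTypeR R => (betaf a' b t)%:E).
  by apply/measurable_EFinP; apply: measurable_funS (measurable_betaf a' b).
have shift t : 0 < t -> betaf p b t = t * betaf a b t.
  move=> t0; rewrite /betaf /p powRD ?(gt_eqF t0) ?implybT// powRr1 1?ltW//.
  by ring.
have J k a' D : 0 <= k -> measurable D ->
    (\int[leb]_(t in D) (k * betaf a' b t)%:E =
     k%:E * \int[leb]_(t in D) (betaf a' b t)%:E)%E.
  move=> k0 mD; under eq_integral do rewrite EFinM.
  by rewrite ge0_integralZl// => t _; rewrite lee_fin betaf_ge0.
have E1 : (p%:E * \int[leb]_(t in `]0%R, c[) (betaf a b t)%:E =
   (G c)%:E + q%:E * \int[leb]_(t in `]0%R, c[) (betaf p b t)%:E)%E.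
  rewrite -I1 -!J ?(ltW p0) ?(ltW q0)// -ge0_integralD//.
  - apply: eq_integral => t /set_mem; rewrite /= in_itv/= => /andP[t0 _].
    by rewrite -EFinD shift// /h; congr EFin; ring.
  - move=> t; rewrite /= in_itv/= => /andP[_ tc].
    by rewrite lee_fin mulr_ge0 ?betaf_ge0// sgl.
  - by apply/measurable_EFinP; apply: measurable_funS mh.
  - by move=> t _; rewrite lee_fin mulr_ge0 ?betaf_ge0// ltW.
have E2 : (q%:E * \int[leb]_(t in `]c, 1%R[) (betaf p b t)%:E =
   (G c)%:E + p%:E * \int[leb]_(t in `]c, 1%R[) (betaf a b t)%:E)%E.
  rewrite -I2 -!J ?(ltW p0) ?(ltW q0)// -ge0_integralD//.
  - apply: eq_integral => t /set_mem; rewrite /= in_itv/= => /andP[ct _].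
    by rewrite -EFinD shift ?(lt_trans c0)// /h; congr EFin; ring.
  - move=> t; rewrite /= in_itv/= => /andP[ct _].
    by rewrite lee_fin oppr_ge0 mulr_ge0_le0 ?betaf_ge0// sgr.
  - by apply/measurable_EFinP; apply: measurable_funS (measurable_funN mh).
  - by move=> t _; rewrite lee_fin mulr_ge0 ?betaf_ge0// ltW.
have ge0 a' D : (0 <= \int[leb]_(t in D) (betaf a' b t)%:E)%E.
  by apply: integral_ge0 => t _; rewrite lee_fin betaf_ge0.
split.
  rewrite (betaI_split p b c01) (betaI_split a b c01).
  rewrite (ge0_muleDr q%:E (ge0 p _) (ge0 p _)) (ge0_muleDr p%:E (ge0 a _) (ge0 a _)).
  by rewrite E1 E2 addeCA addeA.
rewrite (betaI_split _ _ c01).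
have : (0 < p%:E * \int[leb]_(t in `]0%R, c[) (betaf a b t)%:E)%E.
  rewrite E1; apply: (@lt_le_trans _ _ (G c)%:E); first by rewrite lte_fin.
  by rewrite leeDl// mule_ge0// lee_fin ltW.
by rewrite pmule_rgt0 ?lte_fin// => H; apply: (lt_le_trans H); rewrite leeDl.
Qed.

End beta_integral.

(** * Measurability on the plane and Fatou's lemma *)

Section plane_measurability.
Context {R : realType}.
Implicit Types (U : set R[i]) (f g : R[i] -> R[i]).

(** An open set is a countable union of rational squares. *)
Lemma measurable_open_plane U :
  (forall z, U z -> exists2 e : R, 0 < e & forall w, normc (w - z) < e -> U w) ->
  measurable (toC @^-1` U : set (plane R)).
Proof.
move=> oU.
pose box (q r : rat) (d : R) : set (plane R) :=
  (`](ratr q - d), (ratr q + d)[%classic : set (measurableTypeR R)) `*`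
  (`](ratr r - d), (ratr r + d)[%classic : set (measurableTypeR R)).
pose S q r k : set (plane R) :=
  if `[< box q r k.+1%:R^-1 `<=` toC @^-1` U >] then box q r k.+1%:R^-1 else set0.
have mbox q r k : measurable (box q r k).
  by apply: measurableX; exact: measurable_itv.
have -> : toC @^-1` U = \bigcup_q \bigcup_r \bigcup_k S q r k.
  apply/seteqP; split; last first.
    move=> p [q _ [r _ [k _]]]; rewrite /S; case: ifPn => [/asboolP sub /sub//|_ []].
  move=> [x y] Uxy; have [e e0 He] := oU _ Uxy.
  have [k ke] : exists k : nat, 4 * k.+1%:R^-1 < e.
    have e4 : 0 < e / 4 by rewrite divr_gt0.
    have /cvgrPdist_lt/(_ _ e4)[N _ /(_ N (leqnn N))] := @cvg_harmonic R.
    rewrite sub0r normrN ger0_norm ?invr_ge0// /harmonic => h.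
    by exists N; rewrite mulrC -ltr_pdivlMr.
  suff [q [r [bxy sub]]] : exists q r, box q r k.+1%:R^-1 (x, y) /\
      box q r k.+1%:R^-1 `<=` toC @^-1` U.
    by exists q => //; exists r => //; exists k => //; rewrite /S asboolT.
  have : 0 < k.+1%:R^-1 :> R by rewrite invr_gt0.
  move: (k.+1%:R^-1 : R) ke => d ke d0.
  have [q] : exists q : rat, ratr q \in `](x - d), x[ by apply: rat_in_itvoo; lra.
  rewrite in_itv/= => /andP[q1 q2].
  have [r] : exists r : rat, ratr r \in `](y - d), y[ by apply: rat_in_itvoo; lra.
  rewrite in_itv/= => /andP[r1 r2].
  exists q, r; split; first by split; rewrite /= in_itv/=; apply/andP; split; lra.
  move=> -[x' y'] []; rewrite /= !in_itv/= => /andP[x1 x2] /andP[y1 y2].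
  apply: He; rewrite (le_lt_trans (normc_le_ReIm _))//= (le_lt_trans _ ke)//.
  have xx : `|x' - x| <= 2 * d by rewrite ler_norml; apply/andP; split; lra.
  have yy : `|y' - y| <= 2 * d by rewrite ler_norml; apply/andP; split; lra.
  lra.
apply: bigcupT_measurable_rat => q; apply: bigcupT_measurable_rat => r.
by apply: bigcup_measurable => k _; rewrite /S; case: ifP.
Qed.

Lemma continuous_measurable_plane U (h : R[i] -> R) :
  (forall z, U z -> exists2 e : R, 0 < e & forall w, normc (w - z) < e -> U w) ->
  (forall z, U z -> h w @[w --> z] --> h z) ->
  measurable_fun (toC @^-1` U : set (plane R)) (h \o toC).
Proof.
move=> oU ch; apply: (measurability _ (RGenOInfty.measurableE R)).
move=> _ [_ [a ->] <-].
rewrite (_ : _ `&` _ = toC @^-1` (U `&` [set z | a < h z])); last first.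
  by apply/seteqP; split => p /=; rewrite in_itv/= andbT.
apply: measurable_open_plane => z [Uz az]; have [e e0 He] := oU z Uz.
have := ch z Uz => /cvgrPdist_lt/(_ (h z - a)); rewrite subr_gt0 => /(_ az).
rewrite -nbhs_ballE => -[d /= d0 Hd]; have [d' d'0 dd'] := posc_real d0.
exists (Num.min e d'); first by rewrite lt_min e0.
move=> w; rewrite lt_min => /andP[we wd]; split; first exact: He.
have /= := Hd w; rewrite -ball_normE/= dd' normcE ltcR -normcN opprB => /(_ wd).
by rewrite ltr_norml => /andP[_] /=; lra.
Qed.

Definition cmeasurable (D : set (plane R)) f :=
  measurable_fun D (fun p => Re (f (toC p)) : measurableTypeR R) /\
  measurable_fun D (fun p => Im (f (toC p)) : measurableTypeR R).

Lemma continuous_cmeasurable U f :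
  (forall z, U z -> exists2 e : R, 0 < e & forall w, normc (w - z) < e -> U w) ->
  (forall z, U z -> f w @[w --> z] --> f z) ->
  cmeasurable (toC @^-1` U) f.
Proof.
move=> oU cf; split.
- apply: (continuous_measurable_plane (h := fun z => Re (f z)) oU) => z /cf.
  by move=> /cvg_ReIm[].
- apply: (continuous_measurable_plane (h := fun z => Im (f z)) oU) => z /cf.
  by move=> /cvg_ReIm[].
Qed.

Lemma disc_open z : disc z -> exists2 e : R, 0 < e &
  forall w : R[i], normc (w - z) < e -> disc w.
Proof.
rewrite /disc/= => z1; exists (1 - normc z); first by rewrite subr_gt0.
move=> w; rewrite ltrBrDr => wz; rewrite -(subrK z w).
by rewrite (le_lt_trans (normcD _ _)).
Qed.

Lemma pser_cmeasurable a : subexp a -> cmeasurable pdisc (pser a).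
Proof.
move=> sa; apply: continuous_cmeasurable; first exact: disc_open.
by move=> z z1; exact: continuous_pser.
Qed.

Lemma cmeasurableM D f g : cmeasurable D f -> cmeasurable D g ->
  cmeasurable D (fun z => f z * g z).
Proof.
move=> [f1 f2] [g1 g2]; split.
- rewrite (_ : (fun p => _) = (fun p => Re (f (toC p)) * Re (g (toC p))
     - Im (f (toC p)) * Im (g (toC p)))); last by apply/funext => p; rewrite ReM.
  by apply: measurable_funB; apply: measurable_funM.
- rewrite (_ : (fun p => _) = (fun p => Re (f (toC p)) * Im (g (toC p))
     + Im (f (toC p)) * Re (g (toC p)))); last by apply/funext => p; rewrite ImM.
  by apply: measurable_funD; apply: measurable_funM.
Qed.

Lemma cmeasurable_conj D f : cmeasurable D f -> cmeasurable D (fun z => conjc (f z)).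
Proof.
move=> [f1 f2]; split.
- rewrite (_ : (fun p => _) = (fun p => Re (f (toC p))))//.
  by apply/funext => p; case: (f _).
- rewrite (_ : (fun p => _) = (fun p => - Im (f (toC p)))).
    exact: (measurable_funN f2).
  by apply/funext => p; case: (f _).
Qed.

Lemma cmeasurable_normc2 D f : cmeasurable D f ->
  measurable_fun D (fun p => normc (f (toC p)) ^+ 2 : measurableTypeR R).
Proof.
move=> [f1 f2]; rewrite (_ : (fun p => _) =
  (fun p => Re (f (toC p)) ^+ 2 + Im (f (toC p)) ^+ 2)).
  by apply: measurable_funD; apply: measurable_funX.
by apply/funext => p; rewrite sqr_normc.
Qed.

End plane_measurability.

Section fatou_bound.
Local Open Scope ereal_scope.
Context d (T : measurableType d) (R : realType) (mu : {measure set T -> \bar R}).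

(** Fatou's lemma in the form of a bound that survives pointwise limits. *)
Lemma fatou_le (D : set T) (f_ : nat -> T -> \bar R) (f : T -> \bar R) (B : \bar R) k :
  measurable D ->
  (forall n, measurable_fun D (f_ n)) -> (forall n x, D x -> 0 <= f_ n x) ->
  (forall x, D x -> f_ n x @[n --> \oo] --> f x) ->
  (forall n, (k <= n)%N -> \int[mu]_(x in D) f_ n x <= B) ->
  \int[mu]_(x in D) f x <= B.
Proof.
move=> mD mf f0 cf fB.
rewrite (_ : \int[mu]_(x in D) f x = \int[mu]_(x in D) limn_einf (f_ ^~ x)).
  apply: (le_trans (fatou _ mD mf f0)); rewrite limn_einf_lim.
  apply: lime_le; first exact: is_cvg_einfs.
  near=> n; apply: (@le_trans _ _ (\int[mu]_(x in D) f_ (maxn n k) x)).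
    by apply: ereal_inf_lbound; exists (maxn n k) => //=; exact: leq_maxl.
  by apply: fB; exact: leq_maxr.
apply: eq_integral => x /set_mem Dx.
by rewrite (cvg_limn_einf_sup (cf x Dx)).1.
Unshelve. all: by end_near. Qed.

End fatou_bound.

(** * Orthogonality in the weighted Bergman space *)

Section monomial_norms.
Context {R : realType}.
Variables alpha beta : R.
Hypotheses (halpha : -1 < alpha) (hbeta : -1 < beta <= 0).
Local Notation leb := (@lebesgue_measure R).
Local Notation weight := (weight alpha beta).

Let b1 : -1 < beta. Proof. by case/andP: hbeta. Qed.

Definition wnorm : R := (Beta (alpha + 1) (beta + 1))^-1 * pi^-1.

(** The squared norm of the constant function 1. *)
Definition kappa : R := disc_area * (wnorm * fine (betaI beta alpha)).

Lemma betaI_gt0 (a b : R) : -1 < a -> -1 < b -> 0 < fine (betaI a b).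
Proof.
move=> a1 b1'; have [_ B0] := betaI_recurrence a1 b1'.
by rewrite fine_gt0// B0 betaI_lty.
Qed.

Lemma betaI_fineK (a b : R) : -1 < a -> -1 < b -> betaI a b = (fine (betaI a b))%:E.
Proof.
move=> a1 b1'; have [_ B0] := betaI_recurrence a1 b1'.
by rewrite fineK// ge0_fin_numE ?betaI_lty// ltW.
Qed.

Lemma wnorm_gt0 : 0 < wnorm.
Proof.
rewrite /wnorm mulr_gt0 ?invr_gt0 ?pi_gt0//.
have -> : Beta (alpha + 1) (beta + 1) = fine (betaI alpha beta).
  by rewrite /Beta /Rintegral /betaI /betaf !addrK.
exact: betaI_gt0.
Qed.

Lemma kappa_gt0 : 0 < kappa.
Proof.
have w0 := wnorm_gt0; have B0 := betaI_gt0 b1 halpha.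
by rewrite mulr_gt0 ?disc_area_gt0// mulr_gt0.
Qed.

Lemma weightE z : weight z = wnorm * betaf beta alpha (normc z ^+ 2).
Proof.
rewrite /weight /betaf /wnorm powRrM powR_mulrn ?normc_ge0//.
by rewrite mulrAC.
Qed.

Lemma weight_ge0 z : 0 <= weight z.
Proof. by rewrite weightE mulr_ge0 ?betaf_ge0// ltW// wnorm_gt0. Qed.

Lemma measurable_weight D : measurable_fun D
  (fun p : plane R => weight (toC p) : measurableTypeR R).
Proof.
apply: (@measurable_funS _ _ _ _ setT) => //.
rewrite (_ : (fun p => _) = (fun p => wnorm * betaf beta alpha (sqmod p))).
  apply: measurable_funM => //.
  exact: measurableT_comp (measurable_betaf beta alpha) measurable_sqmod.
by apply/funext => p; rewrite weightE sqmodE.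
Qed.

(** The recurrence of the beta integrals is inverse to that of the kernel
    coefficients. *)
Lemma betaI_kcoef n :
  fine (betaI (beta + n%:R) alpha) = fine (betaI beta alpha) / kcoef alpha beta n.
Proof.
elim: n => [|n IH]; first by rewrite addr0 kcoef0 divr1.
have bn : -1 < beta + n%:R by rewrite ltr_wpDr.
have [rec _] := betaI_recurrence bn halpha.
rewrite -natr1 addrA; move: rec.
rewrite (betaI_fineK bn halpha) (@betaI_fineK (beta + n%:R + 1)) //; last first.
  by rewrite ltr_wpDr// ler01.
rewrite -!EFinM => -[]; rewrite IH => rec.
have k0 := kcoef_gt0 halpha hbeta n; have k1 := kcoef_gt0 halpha hbeta n.+1.
have := kcoefS alpha hbeta n => kS.
have q0 : beta + n%:R + alpha + 2 != 0 by have ha := halpha; rewrite gt_eqF//; lra.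
apply: (mulfI q0); rewrite rec.
have -> : beta + n%:R + alpha + 2 = n%:R + (alpha + beta + 2) by ring.
have -> : beta + n%:R + 1 = n%:R + (beta + 1) by ring.
apply: (mulfI (lt0r_neq0 k0)); apply: (mulfI (lt0r_neq0 k1)).
rewrite [LHS](_ : _ = kcoef alpha beta n.+1 * (n%:R + (beta + 1)) * fine (betaI beta alpha)).
  by rewrite kS; field; rewrite gt_eqF.
by field; rewrite gt_eqF.
Qed.

Lemma monomial_norm n :
  (\int[lebesgue2]_(p in pdisc) (normc (toC p) ^+ n ^+ 2 * weight (toC p))%:E
   = (kappa / kcoef alpha beta n)%:E)%E.
Proof.
have bn : -1 < beta + n%:R by rewrite ltr_wpDr.
have w0 := ltW wnorm_gt0.
pose phi (t : R) : \bar R := (wnorm * (`|t| ^+ n * betaf beta alpha t))%:E.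
transitivity (\int[lebesgue2]_(p in pdisc) phi (normc (toC p) ^+ 2)%R)%E.
  apply: eq_integral => p _; rewrite /phi weightE ger0_norm ?exprn_ge0 ?normc_ge0//.
  by congr EFin; rewrite -!exprM mulnC mulrCA.
rewrite integral_radial.
- transitivity (disc_area%:E * (wnorm%:E * betaI (beta + n%:R) alpha))%E.
    congr (_ * _)%E; rewrite /betaI -ge0_integralZl//.
    + apply: eq_integral => t /set_mem; rewrite /= in_itv/= => /andP[t0 t1].
      rewrite /phi EFinM; congr (_ * _)%E; congr EFin; rewrite /betaf gtr0_norm//.
      by rewrite powRD ?(gt_eqF t0) ?implybT// powR_mulrn ?ltW//; ring.
    + by apply/measurable_EFinP; apply: measurable_funS (measurable_betaf _ _).
    + by move=> t _; rewrite lee_fin betaf_ge0.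
  by rewrite betaI_fineK// -!EFinM betaI_kcoef /kappa; congr EFin; ring.
- apply/measurable_EFinP; apply: measurable_funM => //; apply: measurable_funM.
    by apply: measurable_funX; exact: normr_measurable.
  exact: measurable_betaf.
- by move=> t; rewrite lee_fin mulr_ge0// mulr_ge0 ?exprn_ge0 ?betaf_ge0.
Qed.

End monomial_norms.

Section discrete_parseval.
Context {R : realType}.
Implicit Types (u z : R[i]) (a b : nat -> R[i]).

Lemma de_moivre (x : R) k :
  (cos x +i* sin x) ^+ k = cos (x * k%:R) +i* sin (x * k%:R).
Proof.
elim: k => [|k IH]; first by rewrite expr0 mulr0 cos0 sin0.
rewrite exprS IH -natr1 mulrDr mulr1 cosD sinD; apply/eqP; rewrite eq_complex ReM ImM/=.
by apply/andP; split; apply/eqP; ring.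
Qed.

Lemma exists_primitive_rotation N : (3 <= N)%N -> exists u,
  [/\ normc u = 1, Im u != 0, u ^+ N = 1 & forall k, (0 < k < N)%N -> u ^+ k != 1].
Proof.
move=> N3; have N0 : (0 < N%:R :> R) by rewrite ltr0n (leq_trans _ N3).
pose x : R := 2 * pi / N%:R; exists (cos x +i* sin x); split.
- by apply/eqP; rewrite -(@eqrXn2 _ 2) ?normc_ge0// expr1n sqr_normc/= cos2Dsin2.
- rewrite /= gt_eqF// sin_gt0_pi// /x divr_gt0 ?mulr_gt0 ?pi_gt0//=.
  by rewrite ltr_pdivrMr// mulrC ltr_pM2l ?pi_gt0// ltr_nat.
- rewrite de_moivre /x divfK ?gt_eqF//.
  have -> : 2 * pi = pi *+ 2 :> R by rewrite mulr_natl.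
  by rewrite cos2pi sin2pi.
- move=> k /andP[k0 kN]; apply/eqP; rewrite de_moivre => -[ck _].
  have [y yE] : {y : R | y = pi * k%:R / N%:R} by eexists.
  have xy : x * k%:R = y *+ 2 by rewrite /x yE -mulr_natr; ring.
  move: ck; rewrite xy mulr2n cosD -!expr2 => ck.
  have : 0 < sin y.
    have kR : 0 < k%:R :> R by rewrite ltr0n.
    apply: sin_gt0_pi; rewrite yE divr_gt0 ?mulr_gt0 ?pi_gt0//=.
    by rewrite ltr_pdivrMr// ltr_pM2l ?pi_gt0// ltr_nat.
  move=> /(exprn_gt0 2); have := cos2Dsin2 y; lra.
Qed.

(** The characters of the cyclic group of order N are orthogonal: the sum over l
    of the powers of u^m conj(u)^n is a geometric sum, which vanishes unless
    m = n. *)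
Lemma discrete_parseval u N b : normc u = 1 -> u ^+ N = 1 -> (0 < N)%N ->
  (forall k, (0 < k < N)%N -> u ^+ k != 1) ->
  \sum_(l < N) normc (\sum_(n < N) b n * u ^+ (l * n)) ^+ 2 =
  N%:R * \sum_(n < N) normc (b n) ^+ 2.
Proof.
move=> u1 uN N0 uprim; apply: (@complexI R).
have uu : u * conjc u = 1 by rewrite mulr_conjc u1 expr1n.
have un0 : u != 0 by rewrite -normc_eq0 u1 oner_neq0.
rewrite rmorphM !rmorph_sum rmorph_nat mulr_sumr.
transitivity (\sum_(l < N) \sum_(m < N) \sum_(n < N)
    b m * u ^+ (l * m) * conjc (b n * u ^+ (l * n))).
  apply: eq_bigr => l _; rewrite -[LHS]mulr_conjc rmorph_sum mulr_suml.
  by apply: eq_bigr => m _; rewrite mulr_sumr.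
rewrite exchange_big; apply: eq_bigr => m _ /=.
rewrite exchange_big (bigD1 m)//= [X in _ + X]big1 ?addr0; last first.
  move=> n nm.
  pose v := u ^+ m * conjc u ^+ n.
  have vN : v ^+ N = 1.
    by rewrite /v exprMn -!exprM ![(_ * N)%N]mulnC !exprM -rmorphXn uN rmorph1 !expr1n mulr1.
  have v1 : v - 1 != 0.
    rewrite subr_eq0; apply/eqP => v1.
    have mn : u ^+ m = u ^+ n.
      by rewrite -[LHS]mulr1 -(expr1n _ n) -uu exprMn mulrCA -/v v1 mulr1.
    have [lt|lt|eq] := ltngtP m n.
    - have := uprim (n - m)%N; rewrite subn_gt0 lt (leq_ltn_trans (leq_subr _ _))// => /(_ isT).
      move/eqP; apply; apply: (mulfI (expf_neq0 m un0)).
      by rewrite -exprD subnKC ?(ltnW lt)// mulr1.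
    - have := uprim (m - n)%N; rewrite subn_gt0 lt (leq_ltn_trans (leq_subr _ _))// => /(_ isT).
      move/eqP; apply; apply: (mulfI (expf_neq0 n un0)).
      by rewrite -exprD subnKC ?(ltnW lt)// mulr1.
    - by move/eqP: nm; apply; apply/val_inj.
  transitivity (b m * conjc (b n) * \sum_(l < N) v ^+ l).
    rewrite mulr_sumr; apply: eq_bigr => l _.
    by rewrite rmorphM rmorphXn /v exprMn -!exprM ![(_ * l)%N]mulnC; ring.
  suff -> : \sum_(l < N) v ^+ l = 0 by rewrite mulr0.
  by apply: (mulfI v1); rewrite -subrX1 vN subrr mulr0.
transitivity (\sum_(l < N) b m * conjc (b m)).
  apply: eq_bigr => l _; rewrite rmorphM rmorphXn mulrACA -exprMn uu expr1n mulr1//.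
by rewrite sumr_const card_ord mulr_conjc mulr_natl.
Qed.

End discrete_parseval.

Section truncation.
Context {R : realType}.
Implicit Types (u z : R[i]) (a : nat -> R[i]).

Definition psum a N z := \sum_(n < N) a n * z ^+ n.

Lemma psumE a N z : psum a N z = series (fun n => a n * z ^+ n) N.
Proof. by rewrite /series/= big_mkord. Qed.

Lemma psum_cvg a z : subexp a -> normc z < 1 -> psum a n z @[n --> \oo] --> pser a z.
Proof.
move=> sa z1; under eq_fun do rewrite psumE.
exact: cvg_csum (summable_pser sa z1).
Qed.

Lemma csum_tail (v : nat -> R[i]) N : summable v ->
  normc (csum v - series v N) <=
  limn (series (fun n => normc (v n))) - series (fun n => normc (v n)) N.
Proof.
move=> sv; apply/ler_addgt0Pr => e e0.
have /cvgcP/(_ e e0)[K _ HK] := cvg_csum sv.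
set K' := maxn K N.
have h1 : normc (series v K' - csum v) < e by apply: HK; exact: leq_maxl.
have nd : nondecreasing_seq (series (fun n => normc (v n))).
  by apply/nondecreasing_seqP => n; rewrite seriesSr/= lerDl normc_ge0.
have h2 : normc (series v K' - series v N) <=
    series (fun n => normc (v n)) K' - series (fun n => normc (v n)) N.
  rewrite !sub_series_geq ?leq_maxr//; exact: normc_sum.
have h3 : series (fun n => normc (v n)) K' <= limn (series (fun n => normc (v n))).
  exact: nondecreasing_cvgn_le.
have -> : csum v - series v N = (series v K' - series v N) - (series v K' - csum v).
  by ring.
by rewrite (le_trans (normcB _ _))//; lra.
Qed.

(** For the partial sum of order N the average is exactly the diagonal sum, by
    Parseval. Replacing the partial sum s by the full sum g costs at most
    |s - g| (|s| + |g|), and both factors are controlled by the series t of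
    absolute values. *)
Lemma average_lower_bound a u z N : (0 < N)%N -> subexp a -> normc z < 1 ->
  normc u = 1 -> u ^+ N = 1 -> (forall k, (0 < k < N)%N -> u ^+ k != 1) ->
  forall t, t = series (fun n => normc (a n) * normc z ^+ n) ->
  \sum_(n < N) normc (a n) ^+ 2 * normc z ^+ n ^+ 2 - 2 * limn t * (limn t - t N)
  <= N%:R^-1 * \sum_(l < N) normc (pser a (u ^+ l * z)) ^+ 2.
Proof.
move=> N0 sa z1 u1 uN up t t_def.
have Nr : 0 < N%:R :> R by rewrite ltr0n.
have diag : \sum_(l < N) normc (psum a N (u ^+ l * z)) ^+ 2 =
    N%:R * \sum_(n < N) normc (a n) ^+ 2 * normc z ^+ n ^+ 2.
  transitivity (\sum_(l < N) normc (\sum_(n < N) a n * z ^+ n * u ^+ (l * n)) ^+ 2).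
    apply: eq_bigr => l _; congr (normc _ ^+ 2); apply: eq_bigr => n _.
    by rewrite exprMn exprM; ring.
  rewrite (discrete_parseval (fun n => a n * z ^+ n) u1 uN N0 up); congr (_ * _).
  by apply: eq_bigr => n _; rewrite Normc.normcM normcX exprMn.
have low l : normc (psum a N (u ^+ l * z)) ^+ 2 - 2 * limn t * (limn t - t N)
    <= normc (pser a (u ^+ l * z)) ^+ 2.
  set v := u ^+ l * z.
  have vz : normc v = normc z by rewrite /v Normc.normcM normcX u1 expr1n mul1r.
  have sv : summable (fun n => a n * v ^+ n) by apply: summable_pser; rewrite ?vz.
  have tE : t = series (fun n => normc (a n * v ^+ n)).
    by rewrite t_def; congr series; apply/funext => n; rewrite Normc.normcM normcX vz.
  have h1 : normc (pser a v - psum a N v) <= limn t - t N.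
    by rewrite psumE tE; exact: csum_tail.
  have h2 : normc (pser a v) <= limn t by rewrite tE; exact: normc_csum.
  have h3 : normc (psum a N v) <= limn t.
    rewrite (@le_trans _ _ (t N))//; last by have := le_trans (normc_ge0 _) h1; lra.
    by rewrite psumE tE /series/= normc_sum.
  have h4 : normc (psum a N v) <= normc (pser a v) + (limn t - t N).
    rewrite -lerBlDl (le_trans _ h1)// lerBlDl -{1}(subKr (pser a v) (psum a N v)).
    exact: normcB.
  have g0 := normc_ge0 (pser a v); have s0 := normc_ge0 (psum a N v).
  move: h2 h3 h4 g0 s0 (le_trans (normc_ge0 _) h1).
  move: (normc _) (normc _) (limn t) (t N) => x y A B; nra.
rewrite -(ler_pM2l Nr) mulVKf ?gt_eqF// mulrBr -diag.
rewrite (_ : _ - _ = \sum_(l < N) (normc (psum a N (u ^+ l * z)) ^+ 2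
   - 2 * limn t * (limn t - t N))).
  by apply: ler_sum => l _; exact: low.
by rewrite sumrB sumr_const card_ord; congr (_ - _); rewrite -[RHS]mulr_natl.
Qed.

End truncation.

Section bergman_norms.
Context {R : realType}.
Variables alpha beta : R.
Hypotheses (halpha : -1 < alpha) (hbeta : -1 < beta <= 0).
Local Notation weight := (weight alpha beta).
Local Notation sqnorm := (sqnorm alpha beta).
Local Notation ck := (kcoef alpha beta).
Local Notation kap := (kappa alpha beta).
Implicit Types (H : R[i] -> R) (u : R[i]) (a : nat -> R[i]).

Let w0 z : 0 <= weight z. Proof. exact: weight_ge0. Qed.

Lemma measurable_weighted H : measurable_fun pdisc (H \o toC : plane R -> measurableTypeR R) ->
  measurable_fun pdisc (fun p : plane R => (H (toC p) * weight (toC p))%:E).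
Proof.
move=> mH; apply/measurable_EFinP; apply: measurable_funM => //.
exact: measurable_weight.
Qed.

(** The weight is radial. *)
Lemma weighted_integral_rotation H u :
  measurable_fun pdisc (H \o toC : plane R -> measurableTypeR R) ->
  (forall z, 0 <= H z) -> normc u = 1 -> Im u != 0 ->
  (\int[lebesgue2]_(p in pdisc) (H (u * toC p) * weight (toC p))%:E =
   \int[lebesgue2]_(p in pdisc) (H (toC p) * weight (toC p))%:E)%E.
Proof.
move=> mH H0 u1 us.
pose G (z : R[i]) : \bar R := if normc z < 1 then (H z * weight z)%:E else 0%E.
have GE p : ((fun p => (H (toC p) * weight (toC p))%:E) \_ pdisc) p = G (toC p).
  rewrite patchE /G; have [z1|z1] := ltP (normc (toC p)) 1.
    by rewrite ifT// inE.
  by rewrite ifF//; apply/negbTE; rewrite notin_setE /pdisc /disc /= => /lt_geF; rewrite z1.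
rewrite [RHS]integral_mkcond [LHS]integral_mkcond.
transitivity (\int[lebesgue2]_p G (u * toC p)%R)%E.
  apply: eq_integral => p _; rewrite patchE /G Normc.normcM u1 mul1r.
  have [z1|z1] := ltP (normc (toC p)) 1.
    rewrite ifT ?inE//; congr (_%:E); rewrite !(weightE alpha beta) Normc.normcM u1 mul1r//.
  by rewrite ifF//; apply/negbTE; rewrite notin_setE /pdisc /disc /= => /lt_geF; rewrite z1.
rewrite integral_rotation//.
- by apply: eq_integral => p _; rewrite GE.
- have /(measurable_restrictT _ measurable_pdisc) := measurable_weighted mH.
  by apply: eq_measurable_fun => p _; rewrite /= GE.
- by move=> z; rewrite /G; case: ifP => // _; rewrite lee_fin mulr_ge0.
Qed.

Lemma measurable_rotate H u : normc u = 1 ->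
  measurable_fun pdisc (H \o toC : plane R -> measurableTypeR R) ->
  measurable_fun pdisc (fun p : plane R => H (u * toC p) : measurableTypeR R).
Proof.
move=> u1 mH.
pose r (p : plane R) : plane R :=
  (Re u * p.1 + (- Im u) * p.2, Im u * p.1 + Re u * p.2).
have rE p : toC (r p) = u * toC p.
  rewrite /r; case: u {u1 r} => c s.
  by apply/eqP; rewrite eq_complex/=; apply/andP; split; apply/eqP; ring.
have -> : (fun p : plane R => H (u * toC p)) = (H \o toC) \o r.
  by apply/funext => p; rewrite /= rE.
apply: (measurable_comp measurable_pdisc _ mH).
  move=> _ [p pD <-]; have : normc (toC (r p)) < 1; last exact.
  by rewrite rE Normc.normcM u1 mul1r.
by apply: measurable_funS (measurable_linear _ _ _ _).
Qed.

Lemma weighted_integral_rotations H u l :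
  measurable_fun pdisc (H \o toC : plane R -> measurableTypeR R) ->
  (forall z, 0 <= H z) -> normc u = 1 -> Im u != 0 ->
  (\int[lebesgue2]_(p in pdisc) (H (u ^+ l * toC p) * weight (toC p))%:E =
   \int[lebesgue2]_(p in pdisc) (H (toC p) * weight (toC p))%:E)%E.
Proof.
move=> mH H0 u1 us; elim: l => [|l IH].
  by apply: eq_integral => p _; rewrite expr0 mul1r.
rewrite -IH -(@weighted_integral_rotation (fun z => H (u ^+ l * z)) u)//.
  by apply: eq_integral => p _; rewrite exprSr mulrA.
by apply: measurable_rotate => //; rewrite normcX u1 expr1n.
Qed.

Lemma sqnorm_average (f : R[i] -> R[i]) u N : cmeasurable pdisc f ->
  normc u = 1 -> Im u != 0 ->
  (\int[lebesgue2]_(p in pdisc)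
     ((\sum_(l < N) normc (f (u ^+ l * toC p)) ^+ 2) * weight (toC p))%:E
   = N%:R%:E * sqnorm f)%E.
Proof.
move=> mf u1 us; have mH := cmeasurable_normc2 mf.
have ul l : normc (u ^+ l) = 1 by rewrite normcX u1 expr1n.
transitivity (\int[lebesgue2]_(p in pdisc) \sum_(l < N)
    (normc (f (u ^+ l * toC p)) ^+ 2 * weight (toC p))%:E)%E.
  by apply: eq_integral => p _; rewrite sumEFin mulr_suml.
rewrite ge0_integral_sum//; first last.
- by move=> l p _; rewrite lee_fin mulr_ge0// exprn_ge0// normc_ge0.
- move=> l; apply: (@measurable_weighted (fun z => normc (f (u ^+ l * z)) ^+ 2)).
  exact: (@measurable_rotate (fun z => normc (f z) ^+ 2) _ (ul l) mH).
- exact: measurable_pdisc.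
under eq_bigr => l _.
  rewrite (@weighted_integral_rotations (fun z => normc (f z) ^+ 2) u l mH)//; last first.
    by move=> z; rewrite exprn_ge0// normc_ge0.
  over.
by rewrite sumr_const card_ord mule_natl.
Qed.

Lemma weighted_integral_diag (d : nat -> R) N : (forall n, 0 <= d n) ->
  (\int[lebesgue2]_(p in pdisc)
     ((\sum_(n < N) d n * normc (toC p) ^+ n ^+ 2) * weight (toC p))%:E
   = (kap * \sum_(n < N) d n / ck n)%:E)%E.
Proof.
move=> d0.
have mn n : measurable_fun pdisc (fun p : plane R =>
    (normc (toC p) ^+ n ^+ 2 * weight (toC p))%:E).
  apply: (@measurable_weighted (fun z => normc z ^+ n ^+ 2)).
  apply: (@measurable_funS _ _ _ _ setT) => //.
  rewrite (_ : _ \o _ = fun p : plane R => sqmod p ^+ n).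
    by apply: measurable_funX; exact: measurable_sqmod.
  by apply/funext => p; rewrite /= -exprM mulnC exprM sqmodE.
have p0 n (p : plane R) : 0 <= normc (toC p) ^+ n ^+ 2 * weight (toC p).
  by rewrite mulr_ge0 ?exprn_ge0 ?normc_ge0.
transitivity (\int[lebesgue2]_(p in pdisc) \sum_(n < N)
    ((d n)%:E * (normc (toC p) ^+ n ^+ 2 * weight (toC p))%:E))%E.
  apply: eq_integral => p _; rewrite mulr_suml -sumEFin.
  by apply: eq_bigr => n _; rewrite -mulrA EFinM.
rewrite ge0_integral_sum//.
- rewrite mulr_sumr -sumEFin; apply: eq_bigr => n _.
  rewrite (ge0_integralZl _ measurable_pdisc (mn n)) ?lee_fin//;
    last by move=> p _; rewrite lee_fin.
  by rewrite monomial_norm// -EFinM; congr EFin; rewrite mulrCA.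
- exact: measurable_pdisc.
- by move=> n; exact: measurable_funeM.
- by move=> n p _; rewrite mule_ge0 ?lee_fin.
Qed.

Lemma sqnorm1_lty : (sqnorm (fun=> 1%R) < +oo)%E.
Proof.
have := @monomial_norm _ alpha beta halpha hbeta 0.
rewrite /sqnorm => H.
rewrite (_ : (\int[lebesgue2]_(p in _) _)%E = (kap / ck 0)%:E) ?ltry// -H.
by apply: eq_integral => p _; rewrite Normc.normc1 expr0.
Qed.

(** Partial sums are themselves power series, which gives them measurability and
    membership in the Bergman space. *)
Definition padded a N : nat -> R[i] := fun n => if (n < N)%N then a n else 0.

Lemma subexp_padded a N : subexp (padded a N).
Proof.
move=> r /andP[r0 r1]; exists (\sum_(n < N) normc (a n)) => n.
rewrite /padded; case: ifP => nN; last first.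
  by rewrite Normc.normc0 mul0r sumr_ge0// => i _; exact: normc_ge0.
rewrite (@le_trans _ _ (normc (a n)))//.
  by rewrite ler_piMr ?normc_ge0// exprn_ile1// ltW.
by rewrite (bigD1 (Ordinal nN))//= lerDl sumr_ge0// => i _; exact: normc_ge0.
Qed.

Lemma pser_padded a N z : pser (padded a N) z = psum a N z.
Proof.
apply: csum_eq; apply: cvg_near_cst; near=> n.
rewrite /series/= (@big_cat_nat _ _ _ N)//=; last by near: n; exact: nbhs_infty_ge.
rewrite [X in _ + X]big_nat_cond [X in _ + X]big1 ?addr0; last first.
  by move=> i /andP[/andP[Ni _] _]; rewrite /padded ltnNge Ni mul0r.
rewrite /psum big_mkord; apply: eq_bigr => i _.
by rewrite /padded ltn_ord.
Unshelve. all: by end_near. Qed.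

Lemma psum_cmeasurable a N : cmeasurable pdisc (psum a N).
Proof.
by rewrite -(funext (pser_padded a N)); apply: pser_cmeasurable; exact: subexp_padded.
Qed.

(** The monomials are orthogonal: averaging over the rotations by the N-th roots
    of unity leaves the norm unchanged and removes the off-diagonal terms. The
    bound 3 makes a primitive N-th root of unity non-real. *)
Lemma sqnorm_psum a N : (3 <= N)%N ->
  sqnorm (psum a N) = (kap * \sum_(n < N) normc (a n) ^+ 2 / ck n)%:E.
Proof.
move=> N3; have [u [u1 us uN up]] := @exists_primitive_rotation R _ N3.
have N0 : (0 < N)%N := ltn_trans (isT : (0 < 2)%N) N3.
have := sqnorm_average N (psum_cmeasurable a N) u1 us.
under eq_integral => p _.
  rewrite (_ : \sum_(l < N) _ = \sum_(n < N) (N%:R * normc (a n) ^+ 2) * normc (toC p) ^+ n ^+ 2).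
    over.
  transitivity (\sum_(l < N) normc (\sum_(n < N) a n * toC p ^+ n * u ^+ (l * n)) ^+ 2).
    apply: eq_bigr => l _; congr (normc _ ^+ 2); apply: eq_bigr => n _.
    by rewrite exprMn exprM; ring.
  rewrite (discrete_parseval (fun n => a n * toC p ^+ n) u1 uN N0 up) mulr_sumr.
  by apply: eq_bigr => n _; rewrite Normc.normcM normcX exprMn mulrA.
rewrite (weighted_integral_diag N (d := fun n => N%:R * normc (a n) ^+ 2)); last first.
  by move=> n; rewrite mulr_ge0// exprn_ge0// normc_ge0.
under eq_bigr do rewrite -mulrA.
rewrite -mulr_sumr mulrCA EFinM => H.
have N0r : N%:R != 0 :> R by rewrite pnatr_eq0 -lt0n.
rewrite -[LHS]mul1e -[RHS]mul1e -(mulVf N0r) EFinM -!muleA.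
by rewrite -H.
Qed.

End bergman_norms.

Section bergman_bounds.
Context {R : realType}.
Variables alpha beta : R.
Hypotheses (halpha : -1 < alpha) (hbeta : -1 < beta <= 0).
Local Notation weight := (weight alpha beta).
Local Notation sqnorm := (sqnorm alpha beta).
Local Notation bnorm := (bnorm alpha beta).
Local Notation ck := (kcoef alpha beta).
Local Notation kap := (kappa alpha beta).
Implicit Types (a : nat -> R[i]) (f g : R[i] -> R[i]).

Let w0 z : 0 <= weight z. Proof. exact: weight_ge0. Qed.

Lemma measurable_sqnorm f : cmeasurable pdisc f ->
  measurable_fun pdisc (fun p : plane R => (normc (f (toC p)) ^+ 2 * weight (toC p))%:E).
Proof.
move=> /cmeasurable_normc2 mf.
exact: (@measurable_weighted R alpha beta (fun z => normc (f z) ^+ 2)).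
Qed.

Lemma cvg_sqr_normc (u : nat -> R[i]) l : u @ \oo --> l ->
  normc (u n) ^+ 2 @[n --> \oo] --> normc l ^+ 2.
Proof.
move=> /cvg_ReIm[ur ui]; rewrite sqr_normc.
under eq_fun do rewrite sqr_normc.
by apply: cvgD; [under eq_fun do rewrite expr2|under eq_fun do rewrite expr2];
  rewrite expr2; apply: cvgM.
Qed.

Lemma sqnorm_pser_le a (B : \bar R) : subexp a ->
  (forall N, (3 <= N)%N -> sqnorm (psum a N) <= B)%E -> (sqnorm (pser a) <= B)%E.
Proof.
move=> sa aB.
apply: (fatou_le (f_ := fun N p => (normc (psum a N (toC p)) ^+ 2 * weight (toC p))%:E)
  (k := 3)) => //.
- exact: measurable_pdisc.
- by move=> n; apply: measurable_sqnorm; exact: psum_cmeasurable.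
- by move=> n p _; rewrite lee_fin mulr_ge0// exprn_ge0// normc_ge0.
- move=> p pD; apply: cvg_EFin; first by near=> n.
  by apply: cvgMr_tmp; apply: cvg_sqr_normc; exact: psum_cvg.
Unshelve. all: by end_near. Qed.

(** Bessel's inequality. The norm is that of the averages of |pser a|^2 over the
    rotations by the N-th roots of unity, and these are bounded below by the
    diagonal sums up to an error that tends to 0 pointwise. *)
Lemma bessel a M : subexp a ->
  ((kap * \sum_(n < M) normc (a n) ^+ 2 / ck n)%:E <= sqnorm (pser a))%E.
Proof.
move=> sa.
have [U HU] : exists U : nat -> R[i], forall N, [/\ normc (U N) = 1, Im (U N) != 0,
    U N ^+ N.+3 = 1 & forall k, (0 < k < N.+3)%N -> U N ^+ k != 1].
  have [U HU] := choice (fun N => @exists_primitive_rotation R N.+3 isT).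
  by exists U.
pose diag (p : plane R) : R :=
  (\sum_(n < M) normc (a n) ^+ 2 * normc (toC p) ^+ n ^+ 2) * weight (toC p).
pose avg N (p : plane R) : R :=
  (N.+3%:R^-1 * \sum_(l < N.+3) normc (pser a (U N ^+ l * toC p)) ^+ 2) * weight (toC p).
have sq0 z : 0 <= normc z ^+ 2 :> R by rewrite exprn_ge0// normc_ge0.
have diag0 p : 0 <= diag p.
  by rewrite mulr_ge0// sumr_ge0// => n _; rewrite mulr_ge0 ?exprn_ge0 ?normc_ge0.
have avg0 N p : 0 <= avg N p.
  by rewrite /avg mulr_ge0// mulr_ge0 ?invr_ge0 ?sumr_ge0.
have mpser := pser_cmeasurable sa; have mH := cmeasurable_normc2 mpser.
have mavg N : measurable_fun pdisc (fun p => (avg N p)%:E).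
  have [u1 _ _ _] := HU N.
  apply: (@measurable_weighted R alpha beta (fun z => N.+3%:R^-1 *
    \sum_(l < N.+3) normc (pser a (U N ^+ l * z)) ^+ 2)).
  apply: measurable_funM => //; apply: measurable_sum => l.
  apply: (@measurable_rotate _ (fun z => normc (pser a z) ^+ 2)) => //.
  by rewrite normcX u1 expr1n.
have mdiag : measurable_fun pdisc (fun p => (diag p)%:E).
  apply: (@measurable_weighted R alpha beta (fun z =>
    \sum_(n < M) normc (a n) ^+ 2 * normc z ^+ n ^+ 2)).
  apply: measurable_sum => n; apply: measurable_funM => //.
  apply: (@measurable_funS _ _ _ _ setT) => //.
  rewrite (_ : (fun p => _) = fun p : plane R => sqmod p ^+ n).
    by apply: measurable_funX; exact: measurable_sqmod.
  by apply/funext => p; rewrite /= -exprM mulnC exprM sqmodE.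
have mavg' N := (measurable_EFinP _ _).1 (mavg N).
have mdiag' := (measurable_EFinP _ _).1 mdiag.
rewrite -(@weighted_integral_diag _ _ _ halpha hbeta (fun n => normc (a n) ^+ 2))//.
(* Truncating the averages at the diagonal sum turns the lower bound into
   convergence. *)
apply: (fatou_le (f_ := fun N p => (Num.min (avg N p) (diag p))%:E) (k := 0)) => //.
- exact: measurable_pdisc.
- move=> N; apply/measurable_EFinP; exact: measurable_minr (mavg' N) mdiag'.
- by move=> N p _; rewrite lee_fin le_min avg0 diag0.
- move=> p pD; apply: cvg_EFin; first by near=> n.
  set t := series (fun n => normc (a n) * normc (toC p) ^+ n).
  have tc : t @ \oo --> limn t by apply: subexp_series => //; rewrite normc_ge0.
  apply: (@squeeze_cvgr _ _ _ _ (fun N => diag p -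
     2 * limn t * (limn t - t (N + 3)%N) * weight (toC p)) (cst (diag p))).
  + near=> N; rewrite /= ge_min lexx orbT andbT le_min.
    have [u1 us uN up] := HU N.
    have c0 : 0 <= 2 * limn t * (limn t - t (N + 3)%N) * weight (toC p).
      have nd : nondecreasing_seq t.
        by apply/nondecreasing_seqP => n; rewrite /t seriesSr/= lerDl mulr_ge0 ?exprn_ge0 ?normc_ge0.
      have tl n : t n <= limn t by apply: nondecreasing_cvgn_le => //; exact: (cvgP _ tc).
      have t00 : 0 <= limn t by rewrite (le_trans _ (tl 0%N))// /t /series/= big_nil.
      by apply: mulr_ge0 => //; apply: mulr_ge0; [rewrite mulr_ge0|rewrite subr_ge0].
    rewrite gerBl c0 andbT /diag /avg -mulrBl ler_wpM2r//.
    have := average_lower_bound (ltn0Sn _) sa pD u1 uN up (erefl t).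
    apply: le_trans; rewrite addn3 lerB//.
    rewrite -!(big_mkord xpredT (fun n => normc (a n) ^+ 2 * normc (toC p) ^+ n ^+ 2)).
    rewrite (@big_cat_nat _ _ _ M 0 N.+3)//= ?lerDl ?sumr_ge0//.
      by move=> i _; rewrite mulr_ge0 ?exprn_ge0 ?normc_ge0.
    by near: N; exists M => // n /= Mn; rewrite (leq_trans Mn)// -addn3 leq_addr.
  + rewrite -[X in _ --> X]subr0; apply: cvgB; first exact: cvg_cst.
    rewrite -(mul0r (weight (toC p))); apply: cvgMr_tmp.
    rewrite -(mulr0 (2 * limn t)); apply: cvgMl_tmp.
    rewrite -(subrr (limn t)); apply: cvgB; first exact: cvg_cst.
    by apply: (@cvg_comp _ _ _ (fun N => (N + 3)%N) t _ _ _ _ tc); exact: cvg_addnr.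
  + exact: cvg_cst.
- move=> N _; have [u1 us _ _] := HU N.
  have n0 : N.+3%:R != 0 :> R by rewrite pnatr_eq0.
  have <- : (\int[lebesgue2]_(p in pdisc) (avg N p)%:E = sqnorm (pser a))%E.
    have H := sqnorm_average halpha hbeta N.+3 mpser u1 us.
    have mS : measurable_fun pdisc (fun p : plane R =>
      ((\sum_(l < N.+3) normc (pser a (U N ^+ l * toC p)) ^+ 2) * weight (toC p))%:E).
      have := measurable_funeM N.+3%:R%:E (mavg N).
      apply: eq_measurable_fun => p _; rewrite -EFinM /avg; congr EFin.
      by rewrite !mulrA divff// mul1r.
    rewrite -[RHS]mul1e -(mulVf n0) EFinM -muleA -H -(ge0_integralZl _ measurable_pdisc mS).
    + by apply: eq_integral => p _; rewrite -EFinM mulrA.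
    + by move=> p _; rewrite lee_fin mulr_ge0// sumr_ge0.
    + by rewrite lee_fin invr_ge0.
  apply: ge0_le_integral => //.
  + exact: measurable_pdisc.
  + by move=> p _; rewrite lee_fin le_min avg0 diag0.
  + by apply/measurable_EFinP; exact: measurable_minr (mavg' N) mdiag'.
  + by move=> p _; rewrite lee_fin ge_min lexx.
Unshelve. all: by end_near. Qed.

End bergman_bounds.

(** * Complex integrals and the Taylor coefficients of a Toeplitz operator *)

Section complex_integral.
Context {R : realType}.
Variable nu : {measure set (plane R) -> \bar R}.
Implicit Types (f g F : R[i] -> R[i]) (h : plane R -> R) (c : R[i]).
Local Notation mD := measurable_pdisc.

Lemma cintegrable_dominated f h : cmeasurable pdisc f ->
  nu.-integrable pdisc (fun p => (h p)%:E) ->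
  (forall p, pdisc p -> normc (f (toC p)) <= h p) -> cintegrable nu pdisc f.
Proof.
move=> [f1 f2] ih fh; split; apply: (le_integrable mD _ _ ih).
- exact/measurable_EFinP.
- move=> p pD; rewrite !abse_EFin lee_fin (le_trans (Re_le_normc _))//.
  by rewrite (le_trans (fh p pD))// ler_norm.
- exact/measurable_EFinP.
- move=> p pD; rewrite !abse_EFin lee_fin (le_trans (Im_le_normc _))//.
  by rewrite (le_trans (fh p pD))// ler_norm.
Qed.

Lemma cintegralD f g : cintegrable nu pdisc f -> cintegrable nu pdisc g ->
  cintegral nu pdisc (fun z => f z + g z) = cintegral nu pdisc f + cintegral nu pdisc g.
Proof.
move=> [f1 f2] [g1 g2]; apply/eqP; rewrite eq_complex /=.
rewrite -(RintegralD mD f1 g1) -(RintegralD mD f2 g2).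
by apply/andP; split; apply/eqP; apply: eq_Rintegral => p _; rewrite (ReD, ImD).
Qed.

Lemma cintegralZ c f : cintegrable nu pdisc f ->
  cintegral nu pdisc (fun z => c * f z) = c * cintegral nu pdisc f.
Proof.
move=> [f1 f2]; apply/eqP; rewrite eq_complex ReM ImM /=.
have i1 k := integrableZl mD k f1; have i2 k := integrableZl mD k f2.
rewrite -!(RintegralZl _ mD) //.
apply/andP; split; apply/eqP.
- rewrite -(RintegralB mD (i1 (Re c)) (i2 (Im c))).
  by apply: eq_Rintegral => p _; rewrite ReM.
- rewrite -(RintegralD mD (i2 (Re c)) (i1 (Im c))).
  by apply: eq_Rintegral => p _; rewrite ImM.
Qed.

Lemma cintegral0 : cintegral nu pdisc (fun=> 0 : R[i]) = 0.
Proof.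
by apply/eqP; rewrite eq_complex /=; apply/andP; split; apply/eqP;
   rewrite (Rintegral_cst _ mD) mul0r.
Qed.

Lemma cintegral_sum N (f_ : nat -> R[i] -> R[i]) :
  (forall n, cintegrable nu pdisc (f_ n)) ->
  cintegrable nu pdisc (fun z => \sum_(n < N) f_ n z) /\
  cintegral nu pdisc (fun z => \sum_(n < N) f_ n z) =
  \sum_(n < N) cintegral nu pdisc (f_ n).
Proof.
move=> fi; elim: N => [|N [IH1 IH2]].
  rewrite (_ : (fun z => _) = fun=> 0); last by apply/funext => z; rewrite big_ord0.
  rewrite big_ord0 cintegral0; split => //.
  by split; exact: integrable0.
rewrite (_ : (fun z => _) = fun z => \sum_(n < N) f_ n z + f_ N z); last first.
  by apply/funext => z; rewrite big_ord_recr.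
rewrite cintegralD// IH2 big_ord_recr; split => //.
have [[a1 a2] [c1 c2]] := (IH1, fi N).
split.
- have := integrableD mD a1 c1; apply: eq_integrable; first exact: mD.
  by move=> p _; rewrite /= -EFinD ReD.
- have := integrableD mD a2 c2; apply: eq_integrable; first exact: mD.
  by move=> p _; rewrite /= -EFinD ImD.
Qed.

Lemma normc_cintegral f h : cintegrable nu pdisc f ->
  nu.-integrable pdisc (fun p => (h p)%:E) ->
  (forall p, pdisc p -> normc (f (toC p)) <= h p) ->
  normc (cintegral nu pdisc f) <= 2 * \int[nu]_(p in pdisc) h p.
Proof.
move=> [f1 f2] ih fh; rewrite (le_trans (normc_le_ReIm _))//= mulr_natl mulr2n.
apply: lerD.
- rewrite (le_trans (le_normr_Rintegral mD f1))// le_Rintegral//.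
  + exact: mD.
  + exact: (integrable_norm f1).
  + by move=> p pD; rewrite (le_trans (Re_le_normc _))// fh.
- rewrite (le_trans (le_normr_Rintegral mD f2))// le_Rintegral//.
  + exact: mD.
  + exact: (integrable_norm f2).
  + by move=> p pD; rewrite (le_trans (Im_le_normc _))// fh.
Qed.

Lemma Rintegral_dominated_cvg (g_ : nat -> plane R -> R) (g h : plane R -> R) :
  (forall n, measurable_fun pdisc (g_ n : plane R -> measurableTypeR R)) ->
  measurable_fun pdisc (g : plane R -> measurableTypeR R) ->
  nu.-integrable pdisc (fun p => (h p)%:E) ->
  (forall n p, pdisc p -> `|g_ n p| <= h p) ->
  (forall p, pdisc p -> g_ n p @[n --> \oo] --> g p) ->
  (\int[nu]_(p in pdisc) g_ n p) @[n --> \oo] --> \int[nu]_(p in pdisc) g p.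
Proof.
move=> mg_ mg ih gh gc.
have h0 p : pdisc p -> 0 <= h p by move=> /(gh 0%N); exact: le_trans.
have gh' p : pdisc p -> `|g p| <= h p.
  move=> pD; apply: (ler_cvg_to (cvg_norm (gc p pD)) (cvg_cst (h p))).
  by near=> n; exact: gh.
have int (k : plane R -> R) : measurable_fun pdisc (k : plane R -> measurableTypeR R) ->
    (forall p, pdisc p -> `|k p| <= h p) -> nu.-integrable pdisc (fun p => (k p)%:E).
  move=> mk kh; apply: (le_integrable mD _ _ ih); first exact/measurable_EFinP.
  by move=> p pD; rewrite !abse_EFin lee_fin (le_trans (kh p pD))// ler_norm.
have := @dominated_cvg _ _ _ nu pdisc mD (fun n p => (g_ n p)%:E) (fun p => (g p)%:E)
  (fun p => (h p)%:E).
move=> /(_ _ _ _ ih) H; apply: fine_cvg.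
rewrite fineK; last exact: (integral_fune_fin_num mD (int g mg gh')).
apply: H => //.
- by move=> n; apply/measurable_EFinP; exact: mg_.
- by move=> p pD; apply: cvg_EFin; [near=> n|exact: gc].
Unshelve. all: by end_near. Qed.

Lemma cintegral_dominated_cvg (g_ : nat -> R[i] -> R[i]) g h :
  (forall n, cmeasurable pdisc (g_ n)) -> cmeasurable pdisc g ->
  nu.-integrable pdisc (fun p => (h p)%:E) ->
  (forall n p, pdisc p -> normc (g_ n (toC p)) <= h p) ->
  (forall p, pdisc p -> g_ n (toC p) @[n --> \oo] --> g (toC p)) ->
  cintegral nu pdisc (g_ n) @[n --> \oo] --> cintegral nu pdisc g.
Proof.
move=> mg_ [m1 m2] ih gh gc; apply/cvg_ReIm; split => /=.
- apply: (@Rintegral_dominated_cvg (fun n p => Re (g_ n (toC p))) _ h) => //.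
  + by move=> n; have [] := mg_ n.
  + by move=> n p pD; rewrite (le_trans (Re_le_normc _))// gh.
  + by move=> p /gc/cvg_ReIm[].
- apply: (@Rintegral_dominated_cvg (fun n p => Im (g_ n (toC p))) _ h) => //.
  + by move=> n; have [] := mg_ n.
  + by move=> n p pD; rewrite (le_trans (Im_le_normc _))// gh.
  + by move=> p /gc/cvg_ReIm[].
Qed.

End complex_integral.

Section toeplitz_expansion.
Context {R : realType}.
Variables alpha beta : R.
Hypotheses (halpha : -1 < alpha) (hbeta : -1 < beta <= 0).
Variable nu : {measure set (plane R) -> \bar R}.
Local Notation ck := (kcoef alpha beta).
Local Notation cc := (fun n => (kcoef alpha beta n)%:C).
Implicit Types (f g F : R[i] -> R[i]) (h : plane R -> R) (z w : R[i]).

Definition moment F n : R[i] := cintegral nu pdisc (fun w => F w * conjc w ^+ n).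

(** The Taylor coefficients of the image of F under the Toeplitz operator. *)
Definition tcoef F n : R[i] := (ck n)%:C * moment F n.

Lemma conjc_pser a z : (forall n, conjc (a n) = a n) -> subexp a -> normc z < 1 ->
  conjc (pser a z) = pser a (conjc z).
Proof.
move=> ar sa z1; apply/esym/csum_eq; apply/cvgcP => e e0.
have /cvgcP/(_ e e0) := cvg_csum (summable_pser sa z1).
apply: filterS => n.
rewrite -normc_conj rmorphB; congr (normc (_ - _) < e).
rewrite /series/= rmorph_sum; apply: eq_bigr => i _.
by rewrite rmorphM rmorphXn/= ar.
Qed.

Lemma conjc_kernel z w : disc z -> disc w ->
  conjc (bergman_kernel alpha beta w z) = pser cc (z * conjc w).
Proof.
move=> z1 w1; rewrite bergman_kernel_pser// conjc_pser.
- by congr pser; rewrite rmorphM/= conjcK mulrC.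
- by move=> n; rewrite conjc_real.
- exact: subexp_kcoef.
- by rewrite Normc.normcM normc_conj mulr_ilt1 ?normc_ge0.
Qed.

Section expansion.
Variables (F : R[i] -> R[i]) (h : plane R -> R).
Hypotheses (mF : cmeasurable pdisc F) (ih : nu.-integrable pdisc (fun p => (h p)%:E))
  (Fh : forall p, pdisc p -> normc (F (toC p)) <= h p).

Lemma cmeasurable_conjX n : cmeasurable (@pdisc R) (fun w => conjc w ^+ n).
Proof.
elim: n => [|n IH].
  by split; exact: measurable_cst.
rewrite (_ : (fun w => _) = fun w => conjc w * conjc w ^+ n).
  apply: cmeasurableM => //; apply: cmeasurable_conj; split.
  - by apply: measurable_funS measurable_fst.
  - by apply: measurable_funS measurable_snd.
by apply/funext => w; rewrite exprS.
Qed.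

Lemma moment_integrand_le n p : pdisc p -> normc (F (toC p) * conjc (toC p) ^+ n) <= h p.
Proof.
move=> pD; rewrite Normc.normcM normcX normc_conj (le_trans _ (Fh pD))//.
by rewrite ler_piMr ?normc_ge0// exprn_ile1 ?normc_ge0// ltW.
Qed.

Lemma moment_cintegrable n : cintegrable nu pdisc (fun w => F w * conjc w ^+ n).
Proof.
apply: (cintegrable_dominated _ ih); last exact: moment_integrand_le.
by apply: cmeasurableM => //; exact: cmeasurable_conjX.
Qed.

Lemma subexp_tcoef : subexp (tcoef F).
Proof.
apply: (subexp_dominated (K := 2 * \int[nu]_(p in pdisc) h p) _
  (subexp_kcoef halpha hbeta)) => n.
rewrite /tcoef Normc.normcM mulrC ler_wpM2r ?normc_ge0//.
apply: (normc_cintegral (moment_cintegrable n) ih).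
exact: moment_integrand_le.
Qed.

Lemma cintegral_conj_psum b z N :
  cintegrable nu pdisc (fun w => F w * psum b N (z * conjc w)) /\
  cintegral nu pdisc (fun w => F w * psum b N (z * conjc w)) =
  \sum_(n < N) b n * z ^+ n * moment F n.
Proof.
have int n : cintegrable nu pdisc (fun w => b n * z ^+ n * (F w * conjc w ^+ n)).
  apply: (cintegrable_dominated (h := fun p => normc (b n * z ^+ n) * h p)).
  - apply: cmeasurableM; first by split; exact: measurable_cst.
    by apply: cmeasurableM => //; exact: cmeasurable_conjX.
  - have := integrableZl measurable_pdisc (normc (b n * z ^+ n)) ih.
    by apply: eq_integrable => [|p _]; [exact: measurable_pdisc|rewrite EFinM].
  - move=> p pD; rewrite Normc.normcM ler_wpM2l ?normc_ge0//.
    exact: moment_integrand_le.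
have E : (fun w => F w * psum b N (z * conjc w)) =
    fun w => \sum_(n < N) b n * z ^+ n * (F w * conjc w ^+ n).
  apply/funext => w; rewrite /psum mulr_sumr; apply: eq_bigr => n _.
  by rewrite exprMn; ring.
have [i1 i2] := cintegral_sum N int; rewrite E; split => //.
rewrite i2; apply: eq_bigr => n _; rewrite cintegralZ//.
exact: moment_cintegrable.
Qed.

Lemma kernel_expansion_bound z w N : disc z -> disc w ->
  normc (psum cc N (z * conjc w)) <= limn (series (fun n => ck n * normc z ^+ n)).
Proof.
move=> z1 w1; have sk := subexp_kcoef halpha hbeta.
have k0 n : 0 <= ck n by rewrite ltW// kcoef_gt0.
have cv : cvgn (series (fun n => ck n * normc z ^+ n)).
  have := subexp_series sk (r := normc z); rewrite normc_ge0 => /(_ z1).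
  apply: series_le_cvg => n; rewrite ?mulr_ge0 ?exprn_ge0 ?normc_ge0//.
  by rewrite normc_real ger0_norm.
rewrite (le_trans (normc_sum _ _ _))//.
apply: (@le_trans _ _ (series (fun n => ck n * normc z ^+ n) N)).
  rewrite /series/= big_mkord; apply: ler_sum => n _.
  rewrite Normc.normcM normc_real ger0_norm// normcX ler_wpM2l//.
  rewrite lerXn2r ?nnegrE ?normc_ge0// Normc.normcM normc_conj ler_piMr ?normc_ge0//.
  exact: ltW.
apply: nondecreasing_cvgn_le => //; apply/nondecreasing_seqP => n.
by rewrite seriesSr/= lerDl mulr_ge0 ?exprn_ge0 ?normc_ge0.
Qed.

(** The power series of the kernel is integrated term by term, by dominated
    convergence: its partial sums are bounded uniformly in w. *)
Lemma toeplitz_expansion z : disc z ->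
  cintegrable nu pdisc (fun w => F w * conjc (bergman_kernel alpha beta w z)) /\
  cintegral nu pdisc (fun w => F w * conjc (bergman_kernel alpha beta w z)) =
  pser (tcoef F) z.
Proof.
move=> z1; have sk := subexp_kcoef halpha hbeta.
set G := fun w => _.
set S := limn (series (fun n => ck n * normc z ^+ n)).
have S0 : 0 <= S.
  have d0 : disc (0 : R[i]) by rewrite /disc /mkset Normc.normc0 ltr01.
  exact: le_trans (normc_ge0 _) (kernel_expansion_bound 0 z1 d0).
have cK w : disc w -> psum cc N (z * conjc w) @[N --> \oo] -->
    conjc (bergman_kernel alpha beta w z).
  move=> w1; rewrite conjc_kernel//; apply: psum_cvg => //.
  by rewrite Normc.normcM normc_conj mulr_ilt1 ?normc_ge0.
have ihS : nu.-integrable pdisc (fun p => (S * h p)%:E).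
  have := integrableZl measurable_pdisc S ih.
  by apply: eq_integrable => [|p _]; [exact: measurable_pdisc|rewrite EFinM].
have bN N p : pdisc p -> normc (F (toC p) * psum cc N (z * conjc (toC p))) <= S * h p.
  move=> pD; rewrite Normc.normcM mulrC ler_pM ?normc_ge0// ?Fh//.
  exact: kernel_expansion_bound.
have mN N : cmeasurable pdisc (fun w => F w * psum cc N (z * conjc w)).
  apply: cmeasurableM => //.
  rewrite (_ : (fun w => _) = fun w => conjc (psum (fun n => conjc (cc n * z ^+ n)) N w)).
    by apply: cmeasurable_conj; exact: psum_cmeasurable.
  apply/funext => w; rewrite /psum rmorph_sum; apply: eq_bigr => n _.
  by rewrite rmorphM/= conjcK rmorphXn/= exprMn mulrA.
have mK : cmeasurable pdisc (fun w => bergman_kernel alpha beta w z).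
  have sa : subexp (fun n => cc n * conjc z ^+ n).
    apply: (subexp_dominated (K := 1) _ sk) => n; rewrite mul1r Normc.normcM.
    by rewrite ler_piMr ?normc_ge0// normcX normc_conj exprn_ile1 ?normc_ge0// ltW.
  have [m1 m2] := pser_cmeasurable sa.
  have E p : pdisc p -> bergman_kernel alpha beta (toC p) z =
      pser (fun n => cc n * conjc z ^+ n) (toC p).
    move=> pD; rewrite bergman_kernel_pser//; congr csum; apply/funext => n.
    by rewrite exprMn; ring.
  by split; [move: m1|move: m2]; apply: eq_measurable_fun => p /set_mem pD; rewrite E.
have mG : cmeasurable pdisc G by apply: cmeasurableM => //; exact: cmeasurable_conj.
have cG p : pdisc p -> (F (toC p) * psum cc N (z * conjc (toC p))) @[N --> \oo] --> G (toC p).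
  by move=> pD; apply: cvgMl_tmp; exact: cK.
have bG p : pdisc p -> normc (G (toC p)) <= S * h p.
  move=> pD; apply/ler_addgt0Pr => e e0.
  have /cvgcP/(_ e e0)[N _ HN] := cG p pD.
  rewrite -(subKr (F (toC p) * psum cc N (z * conjc (toC p))) (G (toC p))).
  by rewrite (le_trans (normcB _ _))// lerD ?bN// ltW//; exact: (HN N (leqnn N)).
split; first exact: cintegrable_dominated mG ihS bG.
have c1 := cintegral_dominated_cvg mN mG ihS bN cG.
have c2 := psum_cvg subexp_tcoef z1.
apply: (cvg_unique _ c1 _); first exact: norm_hausdorff.
rewrite (_ : (fun n => _) = psum (tcoef F) ^~ z)//.
apply/funext => N; rewrite (cintegral_conj_psum _ _ _).2 /psum.
by apply: eq_bigr => n _; rewrite /tcoef; ring.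
Qed.

End expansion.
End toeplitz_expansion.

(** * Carleson measures, Toeplitz operators and the Berezin symbol *)

Section bergman_space.
Context {R : realType}.
Variables alpha beta : R.
Hypotheses (halpha : -1 < alpha) (hbeta : -1 < beta <= 0).
Local Notation sqnorm := (sqnorm alpha beta).
Local Notation bnorm := (bnorm alpha beta).
Local Notation bergman := (bergman alpha beta).
Implicit Types (a : nat -> R[i]) (f g : R[i] -> R[i]).

Lemma ext0_pser a z : subexp a -> disc z -> ext0 (pser a) z = pser a z.
Proof.
move=> sa z1; rewrite /ext0; case: eqP => // ->.
apply: cvg_lim; first exact: norm_hausdorff.
by apply/continuous_withinNx; apply: continuous_pser => //; rewrite Normc.normc0 ltr01.
Qed.

Lemma punctured_disc_open z : (disc `\ 0) z -> exists2 e : R, 0 < e &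
  forall w : R[i], normc (w - z) < e -> (disc `\ 0) w.
Proof.
move=> [z1 z0]; have [e e0 He] := disc_open z1.
have nz : 0 < normc z by rewrite lt0r normc_ge0 normc_eq0 andbT; apply/eqP.
exists (Num.min e (normc z)); first by rewrite lt_min e0.
move=> w; rewrite lt_min => /andP[we wz]; split; first exact: He.
by move=> w0; move: wz; rewrite w0 sub0r normcN ltxx.
Qed.

(** By continuity off the origin, which is a single point. *)
Lemma ext0_cmeasurable f : holomorphic_on (disc `\ 0) f -> cmeasurable pdisc (ext0 f).
Proof.
move=> hf.
have cf : cmeasurable (toC @^-1` (disc `\ 0)) f.
  apply: continuous_cmeasurable; first exact: punctured_disc_open.
  move=> z /hf fz; apply: differentiable_continuous; exact/derivable1_diffP.
have split0 : @pdisc R = (toC @^-1` (disc `\ 0)) `|` [set (0, 0)].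
  apply/seteqP; split => p.
    move=> p1; have [p0|p0] := eqVneq (toC p) 0.
      by right; case: p p0 {p1} => x y [/= -> ->].
    by left; split => //; apply/eqP.
  move=> [[]//|->]; rewrite /pdisc /disc/= expr0n/= addr0 sqrtr0; exact: ltr01.
have mp : measurable (toC @^-1` (disc `\ 0) : set (plane R)).
  by apply: measurable_open_plane; exact: punctured_disc_open.
have m0 : measurable ([set (0, 0)] : set (plane R)).
  rewrite (_ : [set _] = (([set 0] : set (measurableTypeR R)) `*` ([set 0] : set (measurableTypeR R)))).
    by apply: measurableX; exact: measurable_set1.
  by apply/seteqP; split => -[x y] /= => [[-> ->]|[-> ->]].
have ext p : p \in toC @^-1` (disc `\ 0) -> f (toC p) = ext0 f (toC p).
  by move=> /set_mem[_ /eqP p0]; rewrite /ext0 (negbTE p0).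
have [c1 c2] := cf.
rewrite split0; split; apply/measurable_funU => //; split;
  try exact: measurable_fun_set1.
- by apply: eq_measurable_fun c1 => p /ext <-.
- by apply: eq_measurable_fun c2 => p /ext <-.
Qed.

Lemma sqnorm_ge0 f : (0 <= sqnorm f)%E.
Proof.
apply: integral_ge0 => p _.
by rewrite lee_fin mulr_ge0 ?exprn_ge0 ?normc_ge0// weight_ge0.
Qed.

Lemma sqnorm_eq f g : (forall z, disc z -> f z = g z) -> sqnorm f = sqnorm g.
Proof. by move=> fg; apply: eq_integral => p /set_mem pD; rewrite fg. Qed.

Lemma bnorm_eq f g : (forall z, disc z -> f z = g z) -> bnorm f = bnorm g.
Proof. by move=> /sqnorm_eq fg; rewrite /Defs.bnorm fg. Qed.

Lemma bnormK f : (bnorm f `^ 2 = sqnorm f)%E.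
Proof. by rewrite /Defs.bnorm -poweRrM mulVf// poweRe1// sqnorm_ge0. Qed.

Lemma sqnorm_lty f : bergman f -> (sqnorm f < +oo)%E.
Proof. by move=> [_ /(poweR_lty 2)]; rewrite bnormK. Qed.

Lemma bergman_eq f g : (forall z, disc z -> f z = g z) -> bergman g -> bergman f.
Proof.
move=> fg [hg ng]; split; last by rewrite (bnorm_eq fg).
move=> z [z1 z0]; have := hg z (conj z1 z0).
apply: near_eq_derivable.
have [e e0 He] := disc_open z1.
apply/nbhs_ballP; exists e%:C; rewrite /= ?ltcR// => w.
by rewrite -ball_normE/= normcE ltcR -normcN opprB => /He/fg/esym.
Qed.

Lemma bergman_pser a : subexp a -> (sqnorm (pser a) < +oo)%E -> bergman (pser a).
Proof. by move=> sa na; split; [exact: holomorphic_pser|exact: poweR_lty]. Qed.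

Lemma bnorm_le f g (C : R) : 0 <= C ->
  (sqnorm g <= (C ^+ 2)%:E * sqnorm f)%E -> (bnorm g <= C%:E * bnorm f)%E.
Proof.
move=> C0 gf; have -> : C%:E = ((C ^+ 2)%:E `^ 2^-1)%E.
  by rewrite poweR_EFin powR12_sqrt ?sqr_ge0// sqrtr_sqr ger0_norm.
rewrite /Defs.bnorm -poweRM ?sqnorm_ge0 ?lee_fin ?sqr_ge0//.
apply: gt0_ler_poweR => //; rewrite in_itv/= leey andbT ?sqnorm_ge0//.
by rewrite mule_ge0 ?sqnorm_ge0// lee_fin sqr_ge0.
Qed.

Lemma sqnorm_le f g (C : R) : 0 <= C ->
  (bnorm g <= C%:E * bnorm f)%E -> (sqnorm g <= (C ^+ 2)%:E * sqnorm f)%E.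
Proof.
move=> C0 gf; rewrite -!bnormK -(powR_mulrn 2 C0) -poweR_EFin -poweRM ?poweR_ge0 ?lee_fin//.
apply: gt0_ler_poweR => //; rewrite in_itv/= leey andbT ?poweR_ge0//.
by rewrite mule_ge0 ?poweR_ge0.
Qed.

End bergman_space.

Section carleson_toeplitz.
Context {R : realType}.
Variables alpha beta : R.
Hypotheses (halpha : -1 < alpha) (hbeta : -1 < beta <= 0).
Variable nu : {finite_measure set (plane R) -> \bar R}.
Local Notation sqnorm := (sqnorm alpha beta).
Local Notation bnorm := (bnorm alpha beta).
Local Notation bergman := (bergman alpha beta).
Local Notation ck := (kcoef alpha beta).
Local Notation kap := (kappa alpha beta).
Local Notation tc := (tcoef alpha beta nu).
Local Notation mD := measurable_pdisc.
Implicit Types (a : nat -> R[i]) (f g F : R[i] -> R[i]).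

Definition sqint F : R := \int[nu]_(p in pdisc) normc (F (toC p)) ^+ 2.

Definition sqintegrable F :=
  nu.-integrable pdisc (fun p => (normc (F (toC p)) ^+ 2)%:E).

Lemma sqint_bound F (B : R) : cmeasurable pdisc F ->
  (\int[nu]_(p in pdisc) (normc (F (toC p)) ^+ 2)%:E <= B%:E)%E ->
  sqintegrable F /\ sqint F <= B.
Proof.
move=> mF FB; have iF : sqintegrable F.
  apply/integrableP; split; first by apply/measurable_EFinP; exact: cmeasurable_normc2.
  apply: (@le_lt_trans _ _ B%:E); last exact: ltry.
  apply: le_trans FB; rewrite le_eqVlt; apply/orP; left; apply/eqP.
  by apply: eq_integral => p _; rewrite abse_EFin ger0_norm// exprn_ge0// normc_ge0.
split => //; rewrite -lee_fin; apply: le_trans FB.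
by rewrite fineK//; exact: (integral_fune_fin_num mD iF).
Qed.

Lemma sqintegrable1 F : sqintegrable F ->
  nu.-integrable pdisc (fun p => (1 + normc (F (toC p)) ^+ 2)%:E).
Proof.
move=> iF; have := integrableD mD (finite_measure_integrable_cst nu 1 mD) iF.
by apply: eq_integrable => [|p _]; [exact: mD|rewrite EFinD].
Qed.

(** Square-integrable functions are thus dominated by an integrable function,
    the measure being finite. *)
Lemma normc_le_sqr F (p : plane R) : normc (F (toC p)) <= 1 + normc (F (toC p)) ^+ 2.
Proof. by have := normc_ge0 (F (toC p)); move: (normc _) => x; nra. Qed.

(** The sum on the left is the integral of F times the conjugate of the partial
    sum G of its own image under the Toeplitz operator; the right-hand side comes
    from 2 Re(x conj y) <= l |x|^2 + |y|^2 / l. *)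
Lemma moment_sum_bound F N (l : R) : cmeasurable pdisc F -> sqintegrable F ->
  sqintegrable (psum (tc F) N) -> 0 < l ->
  2 * \sum_(n < N) ck n * normc (moment nu F n) ^+ 2 <=
  l * sqint F + l^-1 * sqint (psum (tc F) N).
Proof.
move=> mF iF iG l0; set G := psum (tc F) N.
have [[i1 _] e] := cintegral_conj_psum mF (sqintegrable1 iF) (fun p _ => normc_le_sqr F p)
  (fun n => conjc (tc F n)) 1 N.
have GE w : psum (fun n => conjc (tc F n)) N (1 * conjc w) = conjc (G w).
  rewrite /G /psum mul1r rmorph_sum; apply: eq_bigr => n _.
  by rewrite [RHS]rmorphM rmorphXn.
have -> : \sum_(n < N) ck n * normc (moment nu F n) ^+ 2 =
    \int[nu]_(p in pdisc) Re (F (toC p) * conjc (G (toC p))).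
  transitivity (Re (\sum_(n < N) conjc (tc F n) * 1 ^+ n * moment nu F n)); last first.
    by rewrite -e; apply: eq_Rintegral => p _; rewrite GE.
  rewrite Re_sum; apply: eq_bigr => n _.
  have -> : conjc (tc F n) = (ck n)%:C * conjc (moment nu F n).
    by rewrite /tcoef [LHS]rmorphM; congr (_ * _); exact: conjc_real.
  by rewrite expr1n mulr1 -mulrA ReZ [conjc _ * _]mulrC mulr_conjc.
have i2 := integrableZl mD l iF; have i3 := integrableZl mD l^-1 iG.
have i1' : nu.-integrable pdisc (fun p => (Re (F (toC p) * conjc (G (toC p))))%:E).
  by apply: eq_integrable i1 => [|p _]; [exact: mD|rewrite GE].
rewrite /sqint -(RintegralZl _ mD iF) -(RintegralZl _ mD iG) -(RintegralZl _ mD i1').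
rewrite -(RintegralD mD i2 i3).
apply: le_Rintegral.
- exact: mD.
- exact: (integrableZl mD 2 i1').
- exact: (integrableD mD i2 i3).
move=> p _; rewrite -/G; move: (F (toC p)) (G (toC p)) => x y; rewrite !sqr_normc ReM.
case: x => a b; case: y => c d /=.
have l0' : l != 0 by rewrite gt_eqF.
rewrite -subr_ge0 [X in 0 <= X](_ : _ = l^-1 * ((l * a - c) ^+ 2 + (l * b - d) ^+ 2)).
  by rewrite mulr_ge0 ?invr_ge0 ?(ltW l0)// addr_ge0// sqr_ge0.
by field.
Qed.

Lemma tcoef_sum F N :
  \sum_(n < N) normc (tc F n) ^+ 2 / ck n =
  \sum_(n < N) ck n * normc (moment nu F n) ^+ 2.
Proof.
apply: eq_bigr => n _; have k0 := kcoef_gt0 halpha hbeta n.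
rewrite /tcoef Normc.normcM normc_real gtr0_norm//.
by field; rewrite gt_eqF.
Qed.

(** Let G be a partial sum of the image of f. With S as in the proof, the squared
    norm of G is kappa S, so that the Carleson inequality for f and for G bounds
    2 S by l C |f|^2 + C kappa S / l. The choice l = C kappa lets the last term be
    absorbed, and the resulting bound on the norm of G does not depend on the
    order of the partial sum. *)
Lemma carleson_toeplitz_bounded :
  carleson alpha beta nu -> toeplitz_bounded alpha beta nu.
Proof.
move=> [C C0 HC].
have k0 : 0 < kap by exact: kappa_gt0.
have bergF f : bergman f -> cmeasurable pdisc (ext0 f).
  by move=> [hf _]; exact: ext0_cmeasurable.
have sqf f : bergman f -> sqnorm f = (fine (sqnorm f))%:E.
  by move=> /sqnorm_lty nf; rewrite fineK// ge0_fin_numE ?nf ?sqnorm_ge0.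
have carl f : bergman f ->
    sqintegrable (ext0 f) /\ sqint (ext0 f) <= C * fine (sqnorm f).
  move=> bf; apply: sqint_bound; first exact: bergF.
  by rewrite EFinM -sqf//; exact: HC.
have exp f : bergman f -> forall z, disc z ->
    cintegrable nu pdisc (toeplitz_integrand alpha beta f z) /\
    toeplitz alpha beta nu f z = pser (tc (ext0 f)) z.
  move=> bf z z1; have [iF _] := carl f bf.
  exact: (toeplitz_expansion halpha hbeta (bergF f bf) (sqintegrable1 iF)
    (fun p _ => normc_le_sqr (ext0 f) p) z1).
split; first by move=> f z bf z1; have [] := exp f bf z z1.
exists (C * kap) => f bf.
set F := ext0 f; have [iF sF] := carl f bf; have mF := bergF f bf.
have st : subexp (tc F).
  exact: (subexp_tcoef halpha hbeta mF (sqintegrable1 iF) (fun p _ => normc_le_sqr F p)).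
have nT : (sqnorm (pser (tc F)) <= ((C * kap) ^+ 2)%:E * sqnorm f)%E.
  apply: sqnorm_pser_le => // N N3.
  set S := \sum_(n < N) ck n * normc (moment nu F n) ^+ 2.
  have nG : sqnorm (psum (tc F) N) = (kap * S)%:E.
    by rewrite sqnorm_psum// tcoef_sum.
  have bG : bergman (psum (tc F) N).
    rewrite -(funext (pser_padded (tc F) N)); apply: bergman_pser.
      exact: subexp_padded.
    by rewrite (funext (pser_padded (tc F) N)) nG ltry.
  have extG z : disc z -> ext0 (psum (tc F) N) z = psum (tc F) N z.
    rewrite -(funext (pser_padded (tc F) N)); apply: ext0_pser.
    exact: subexp_padded.
  have [iG sG] := carl _ bG.
  have iG' : sqintegrable (psum (tc F) N).
    by apply: eq_integrable iG => [|p /set_mem pD]; [exact: mD|rewrite extG].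
  have sG' : sqint (psum (tc F) N) <= C * (kap * S).
    move: sG; rewrite nG /=; apply: le_trans; rewrite le_eqVlt; apply/orP; left.
    by apply/eqP; apply: eq_Rintegral => p /set_mem pD; rewrite extG.
  have l0 : 0 < C * kap by rewrite mulr_gt0.
  have := moment_sum_bound (l := C * kap) mF iF iG' l0.
  rewrite -/S nG (sqf f bf) -EFinM lee_fin => H.
  have h1 : C * kap * sqint F <= C * kap * (C * fine (sqnorm f)).
    by rewrite ler_wpM2l// ltW.
  have h2 : (C * kap)^-1 * sqint (psum (tc F) N) <= S.
    by rewrite mulrC ler_pdivrMr// (le_trans sG')// mulrA mulrC.
  have SB : S <= C * kap * (C * fine (sqnorm f)) by lra.
  rewrite (le_trans (ler_wpM2l (ltW k0) SB))// le_eqVlt; apply/orP; left; apply/eqP.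
  by ring.
have eT z : disc z -> toeplitz alpha beta nu f z = pser (tc F) z.
  by move=> z1; have [] := exp f bf z z1.
split.
  apply: (@bergman_eq R alpha beta _ _ eT); apply: bergman_pser => //; apply: (le_lt_trans nT).
  by rewrite (sqf f bf) -EFinM ltry.
rewrite (@bnorm_eq R alpha beta _ _ eT); apply: bnorm_le => //.
by rewrite mulr_ge0 ?ltW.
Qed.

(** The kernel function as a power series: unlike [bergman_kernel ^~ z] it is
    analytic by construction; the two agree on the disc. *)
Definition kernel_at z : R[i] -> R[i] := pser (fun n => (ck n)%:C * conjc z ^+ n).

Lemma subexp_kernel_at z : disc z -> subexp (fun n => (ck n)%:C * conjc z ^+ n).
Proof.
move=> z1; have sk := subexp_kcoef halpha hbeta.
apply: (subexp_dominated (K := 1) _ sk) => n; rewrite mul1r Normc.normcM.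
by rewrite ler_piMr ?normc_ge0// normcX normc_conj exprn_ile1 ?normc_ge0// ltW.
Qed.

Lemma kernel_atE z w : disc z -> disc w -> bergman_kernel alpha beta w z = kernel_at z w.
Proof.
move=> z1 w1; rewrite bergman_kernel_pser//; congr csum; apply/funext => n.
by rewrite exprMn; ring.
Qed.

Lemma kernel_at_bounded z : disc z -> exists B : R, forall w, disc w -> normc (kernel_at z w) <= B.
Proof.
move=> z1; have sk := subexp_kcoef halpha hbeta.
have cv : cvgn (series (fun n => normc ((ck n)%:C) * normc z ^+ n)).
  by apply: subexp_series => //; rewrite normc_ge0.
exists (limn (series (fun n => normc ((ck n)%:C) * normc z ^+ n))) => w w1.
have le n : normc ((ck n)%:C * conjc z ^+ n * w ^+ n) <= normc ((ck n)%:C) * normc z ^+ n.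
  rewrite !Normc.normcM !normcX normc_conj ler_piMr ?mulr_ge0 ?exprn_ge0 ?normc_ge0//.
  by rewrite exprn_ile1 ?normc_ge0// ltW.
have sw := summable_le le cv.
by rewrite (le_trans (normc_csum sw))// lim_series_le.
Qed.

Lemma sqnorm_kernel_at_lty z : disc z -> (sqnorm (kernel_at z) < +oo)%E.
Proof.
move=> z1; have [B HB] := kernel_at_bounded z1.
apply: (@le_lt_trans _ _ ((B ^+ 2)%:E * sqnorm (fun=> 1%R))%E); last first.
  by rewrite lte_mul_pinfty ?lee_fin ?sqr_ge0// sqnorm1_lty.
rewrite /Defs.sqnorm -ge0_integralZl//.
- apply: ge0_le_integral => //.
  + exact: mD.
  + by move=> p _; rewrite lee_fin mulr_ge0 ?exprn_ge0 ?normc_ge0// weight_ge0.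
  + by apply: measurable_sqnorm; apply: pser_cmeasurable; exact: subexp_kernel_at.
  + apply/measurable_EFinP; apply: measurable_funM => //; apply: measurable_funM => //.
    exact: measurable_weight.
  + move=> p pD; rewrite -EFinM lee_fin Normc.normc1 expr1n mul1r ler_wpM2r ?weight_ge0//.
    by rewrite lerXn2r ?nnegrE ?normc_ge0 ?HB// (le_trans (normc_ge0 _) (HB _ pD)).
- exact: mD.
- apply/measurable_EFinP; apply: measurable_funM => //; exact: measurable_weight.
- by move=> p _; rewrite lee_fin mulr_ge0 ?exprn_ge0 ?normc_ge0// weight_ge0.
- by rewrite lee_fin sqr_ge0.
Qed.

(** Point evaluations are bounded, by the kernel. The inequality
    2 x y <= l x^2 / c + c y^2 / l is applied to each term |a_n| |z|^n, with c the
    n-th kernel coefficient, and the two resulting sums are estimated by Bessel's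
    inequality for the given series and for the kernel function. *)
Lemma point_evaluation a z (l : R) : subexp a -> disc z -> 0 < l ->
  (sqnorm (pser a) < +oo)%E ->
  2 * kap * normc (pser a z) <=
  l * fine (sqnorm (pser a)) + l^-1 * fine (sqnorm (kernel_at z)).
Proof.
move=> sa z1 l0 na; have k0 : 0 < kap by exact: kappa_gt0.
have bes b N : subexp b -> (sqnorm (pser b) < +oo)%E ->
    kap * \sum_(n < N) normc (b n) ^+ 2 / ck n <= fine (sqnorm (pser b)).
  move=> sb nb; rewrite -lee_fin fineK; last by rewrite ge0_fin_numE ?sqnorm_ge0.
  exact: bessel.
apply/ler_addgt0Pr => e e0; have e2 : 0 < e / (2 * kap) by rewrite divr_gt0// mulr_gt0.
have /cvgcP/(_ _ e2)[N _ /(_ N (leqnn N)) HN] := psum_cvg sa z1.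
have h1 := bes a N sa na.
have h2 := bes _ N (subexp_kernel_at z1) (sqnorm_kernel_at_lty z1).
have h3 : 2 * normc (psum a N z) <= l * \sum_(n < N) normc (a n) ^+ 2 / ck n
   + l^-1 * \sum_(n < N) normc ((ck n)%:C * conjc z ^+ n) ^+ 2 / ck n.
  rewrite (le_trans (ler_wpM2l _ (normc_sum _ _ _)))// !mulr_sumr -big_split/=.
  apply: ler_sum => n _; have c0 := kcoef_gt0 halpha hbeta n.
  rewrite !Normc.normcM !normcX normc_conj normc_real gtr0_norm//.
  move: (normc (a n)) (normc z ^+ n) => x y.
  rewrite -subr_ge0 [X in 0 <= X](_ : _ = (l * x - ck n * y) ^+ 2 / (l * ck n)).
    by rewrite divr_ge0 ?sqr_ge0// mulr_ge0 ?ltW.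
  by field; rewrite !gt_eqF.
have h4 : normc (pser a z) <= normc (psum a N z) + e / (2 * kap).
  rewrite -(subKr (psum a N z) (pser a z)) (le_trans (normcB _ _))// lerD2l.
  exact: ltW.
have k2 : 0 < 2 * kap by rewrite mulr_gt0.
rewrite (le_trans (ler_wpM2l (ltW k2) h4))// mulrDr [X in _ + X]mulrC.
rewrite (divfK (lt0r_neq0 k2)).
rewrite lerD2r.
have := ler_wpM2l (ltW k0) h3.
have := ler_wpM2l (ltW l0) h1.
have l1 : 0 <= l^-1 by rewrite invr_ge0 ltW.
have := ler_wpM2l l1 h2.
rewrite -/(kernel_at z) mulrDr; lra.
Qed.

Lemma sqnorm_kernel_at_gt0 z : disc z -> 0 < fine (sqnorm (kernel_at z)).
Proof.
move=> z1; have k0 : 0 < kap by exact: kappa_gt0.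
have nk := sqnorm_kernel_at_lty z1.
rewrite -lte_fin fineK; last by rewrite ge0_fin_numE ?sqnorm_ge0.
apply: (lt_le_trans _ (bessel halpha hbeta 1 (subexp_kernel_at z1))).
rewrite lte_fin big_ord1 expr0 mulr1 normc_real mulr_gt0//.
by rewrite kcoef0 normr1 expr1n divr1 ltr01.
Qed.

(** The integral of |k|^2 against nu, for k the kernel function at z, is the value
    at z of the image of k. This image has norm at most C |k|, so that its value
    at z is at most C |k|^2 / kappa. *)
Lemma toeplitz_bounded_berezin : toeplitz_bounded alpha beta nu ->
  exists M : R, forall z : R[i], disc z -> (berezin alpha beta nu z <= M%:E)%E.
Proof.
move=> [_ [C0 HC]]; have k0 : 0 < kap by exact: kappa_gt0.
pose C := `|C0| + 1.
have Cp : 0 < C by rewrite ltr_wpDl.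
exists (C / kap) => z z1.
set k := kernel_at z; have sk := subexp_kernel_at z1.
have nk := sqnorm_kernel_at_lty z1; have X0 := sqnorm_kernel_at_gt0 z1.
have kX : sqnorm k = (fine (sqnorm k))%:E.
  by rewrite fineK// ge0_fin_numE ?sqnorm_ge0.
set X := fine (sqnorm k) in X0 kX.
have bk : bergman k by apply: bergman_pser.
have ek w : disc w -> ext0 k w = k w by exact: ext0_pser.
have mk : cmeasurable pdisc k by exact: pser_cmeasurable.
have mF : cmeasurable pdisc (ext0 k) by case: bk => hk _; exact: ext0_cmeasurable.
have ik : sqintegrable k.
  have [B HB] := kernel_at_bounded z1.
  apply: (le_integrable mD _ _ (finite_measure_integrable_cst nu (B ^+ 2) mD)).
    by apply/measurable_EFinP; exact: cmeasurable_normc2.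
  move=> p pD; rewrite !abse_EFin lee_fin /= !ger0_norm ?sqr_ge0//.
  by rewrite lerXn2r ?nnegrE ?normc_ge0 ?HB// (le_trans (normc_ge0 _) (HB _ pD)).
have iF : sqintegrable (ext0 k).
  by apply: eq_integrable ik => [|p /set_mem pD]; [exact: mD|rewrite ek].
have Fh (p : plane R) (_ : pdisc p) := normc_le_sqr (ext0 k) p.
have exp w : disc w -> toeplitz alpha beta nu k w = pser (tc (ext0 k)) w.
  move=> w1.
  by have [] := toeplitz_expansion halpha hbeta mF (sqintegrable1 iF) Fh w1.
have st : subexp (tc (ext0 k)) by exact: (subexp_tcoef halpha hbeta mF (sqintegrable1 iF) Fh).
have nT : (sqnorm (pser (tc (ext0 k))) <= (C ^+ 2)%:E * sqnorm k)%E.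
  apply: sqnorm_le => //; first exact: ltW.
  rewrite -(@bnorm_eq R alpha beta _ _ exp); have [_ /le_trans] := HC k bk; apply.
  by rewrite lee_wpmul2r ?poweR_ge0// lee_fin /C (le_trans (ler_norm _))// lerDl.
have nTy : (sqnorm (pser (tc (ext0 k))) < +oo)%E.
  by apply: (le_lt_trans nT); rewrite kX -EFinM ltry.
have nTX : fine (sqnorm (pser (tc (ext0 k)))) <= C ^+ 2 * X.
  rewrite -lee_fin fineK ?EFinM -?kX//; by rewrite ge0_fin_numE ?sqnorm_ge0.
have Ci : 0 < C^-1 by rewrite invr_gt0.
(* The weight l = 1 / C balances the two terms. *)
have pe := point_evaluation st z1 Ci nTy.
have Yle : sqint k <= normc (pser (tc (ext0 k)) z).
  rewrite -(exp z z1) (le_trans _ (Re_le_normc _))// (le_trans _ (ler_norm _))//.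
  rewrite le_eqVlt; apply/orP; left; apply/eqP.
  apply: eq_Rintegral => p /set_mem pD.
  by rewrite /toeplitz_integrand ek// kernel_atE// mulr_conjc.
have -> : berezin alpha beta nu z = (X^-1 * sqint k)%:E.
  have Kn : fine (bnorm ((bergman_kernel alpha beta)^~ z)) ^+ 2 = X.
    rewrite (@bnorm_eq R alpha beta _ k); last by move=> w w1; exact: kernel_atE.
    by rewrite /Defs.bnorm fine_poweR powR12_sqrt ?sqr_sqrtr ?ltW.
  rewrite /berezin EFinM fineK; last exact: (integral_fune_fin_num mD ik).
  rewrite -ge0_integralZl//.
  - apply: eq_integral => p /set_mem pD; rewrite -EFinM; congr EFin.
    rewrite /nkernel kernel_atE// Normc.normcM Normc.normcV normc_real exprMn exprVn.
    by rewrite real_normK ?num_real// Kn mulrC.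
  - exact: mD.
  - by apply/measurable_EFinP; exact: cmeasurable_normc2.
  - by move=> p _; rewrite lee_fin sqr_ge0.
  - by rewrite lee_fin invr_ge0 ltW.
rewrite lee_fin mulrC ler_pdivrMr// mulrAC ler_pdivlMr//.
have h1 : C^-1 * fine (sqnorm (pser (tc (ext0 k)))) <= C * X.
  by rewrite mulrC ler_pdivrMr// (le_trans nTX)// expr2 mulrAC.
have h2 := ler_wpM2r (ltW k0) Yle.
move: pe; rewrite invrK -/k -/X => pe; lra.
Qed.

End carleson_toeplitz.

Theorem theorem5 (R : realType) (alpha beta : R)
    (halpha : -1 < alpha) (hbeta : Jset alpha beta)
    (nu : {finite_measure set (plane R) -> \bar R})
    (hnu : nu (~` pdisc) = 0%E) :
  (carleson alpha beta nu -> toeplitz_bounded alpha beta nu) /\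
  (toeplitz_bounded alpha beta nu ->
   exists M : R, forall z : R[i], disc z -> (berezin alpha beta nu z <= M%:E)%E).
Proof.
have [hb _] := hbeta; split.
- exact: carleson_toeplitz_bounded.
- exact: toeplitz_bounded_berezin.
Qed.
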